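(* Let $\Omega\subset\mathbb{R}^d$ be a bounded domain with Lipschitz boundary and let $s,s'\ge 0$ be integers. Let $\Psi^\dagger: C^s(\overline{\Omega};\mathbb{R}^k)\to C^{s'}(\overline{\Omega};\mathbb{R}^{k'})$ be a continuous operator and let $\mathsf{K}\subset C^s(\overline{\Omega};\mathbb{R}^k)$ be a compact subset. Assume that $\Psi^\dagger(\mathsf{K})$ satisfies the Smoothed Approximation Assumption in $C^{s'}(\Omega;\mathbb{R}^{k'})$ with respect to some sequence of functions $\{\xi_j\}_{j=1}^\infty$, and that $\{\xi_j\}_{j=1}^\infty\subset C^{s'}(\overline{\Omega})$. Let $\sigma$ be an activation function satisfying the Activation Assumption with $s_\sigma=s'$. Let $\eta_1,\eta_2$ be any pair of real-valued functions such that: $\eta_1\ge 0$ on $\Omega$; $\eta_1=0$ only on a set of Lebesgue measure $0$; $\sup_{y\in\Omega}|\eta_1(y)|<\infty$; $\eta_1\in C(\Omega)$; $\eta_2\in C^{s'}(\overline{\Omega})$ and $\eta_2\neq 0$ at every point of $\overline{\Omega}$. Then for any $\varepsilon>0$ there exists a nonlocal neural operator $\Psi$ with activation $\sigma$, with a single hidden layer ($L=1$) and a single basis function pair ($M=1$) given by $\psi_{1,1}=\eta_1$ and $\phi_{1,1}=\eta_2$, such that $$\sup_{u\in\mathsf{K}}\|\Psi^\dagger(u)-\Psi(u)\|_{C^{s'}(\Omega)}<\varepsilon.$$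
   Context: Norms: $C^{s}(\Omega)$ is the Banach space with norm $\|\eta\|_{C^s(\Omega)}=\sum_{|\alpha|\le s}\sup_{x\in\Omega}|\partial^\alpha\eta(x)|<\infty$. Feedforward neural network with activation $\sigma:\mathbb{R}\to\mathbb{R}$: a map $G:\mathbb{R}^{d_x}\to\mathbb{R}^{d_y}$ of the form $G(x)=A_N\,(L_{N-1}\circ\cdots\circ L_1)(x)+b_N$ with $L_l(z)=\sigma(A_l z+b_l)$, where $A_l$ are matrices and $b_l$ vectors of compatible sizes and $\sigma$ acts componentwise. Nonlocal neural operator (NNO): let $\sigma$ be a non-polynomial $C^\infty$ function on $\mathbb{R}$, acting componentwise on vectors. An NNO with input functions $a:\Omega\to\mathbb{R}^k$ and output functions $\Omega\to\mathbb{R}^{k'}$, with channel width $d_c$, $L$ hidden layers and (per layer) $M$ basis function pairs is a map $\Psi(a)=\mathcal{Q}\circ\mathcal{L}_L\circ\cdots\circ\mathcal{L}_1\circ\mathcal{R}(a)$, where $(\mathcal{R}a)(x)=R(a(x),x)$ with $R:\mathbb{R}^k\times\mathbb{R}^d\to\mathbb{R}^{d_c}$ a feedforward neural network, $(\mathcal{Q}v)(x)=Q(v(x))$ with $Q:\mathbb{R}^{d_c}\to\mathbb{R}^{k'}$ a feedforward neural network, and $$(\mathcal{L}_\ell v)(x)=\sigma\Big(W_\ell v(x)+b_\ell+\sum_{m=1}^M\langle T_{\ell,m}v,\psi_{\ell,m}\rangle\,\phi_{\ell,m}(x)\Big),$$ with $W_\ell,T_{\ell,m}\in\mathbb{R}^{d_c\times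 d_c}$, $b_\ell\in\mathbb{R}^{d_c}$, real-valued basis functions $\psi_{\ell,m}$ (inner), $\phi_{\ell,m}$ (outer), and $\langle T_{\ell,m}v,\psi_{\ell,m}\rangle=T_{\ell,m}\int_\Omega v(y)\psi_{\ell,m}(y)\,dy\in\mathbb{R}^{d_c}$ (componentwise $L^2(\Omega)$ inner product). The width $d_c$ is free. Activation Assumption (with parameter $s_\sigma\ge 0$): $\sigma$ is non-polynomial and $C^\infty$, $\sigma(0)=0$, and for every finite dimension $n$, every $\epsilon>0$ and every closed ball $\mathcal{K}\subset\mathbb{R}^n$ there is a feedforward neural network $G:\mathbb{R}^n\to\mathbb{R}^n$ with activation $\sigma$ such that $G(0)=0$ and $\|G-\mathrm{id}\|_{C^{s_\sigma}(\mathcal{K})}<\epsilon$. Smoothed Approximation Assumption: let $\Omega\subset\mathbb{R}^d$ be a bounded set and $\mathcal{B}(\Omega)$ a Banach space of functions on $\Omega$ continuously embedded in $L^1(\Omega)$. A compact subset $\mathsf{K}'\subset\mathcal{B}(\Omega)$ satisfies the assumption in $\mathcal{B}(\Omega)$ with respect to functions $\{\eta_j\}_{j=1}^\infty$ if there exist a set $B\subset\mathbb{R}^d$ with $B\supseteq\Omega$ on which all $\eta_j$ are defined, and a family of linear maps $\{f_\delta\}_{\delta>0}$, $f_\delta:\mathcal{B}(\Omega)\to\mathcal{B}(\Omega)$, with $f_\delta(w)$ also defined on $B$, such that: (S1) $\lim_{\delta\to0}\sup_{w\in\mathsf{K}'}\|f_\delta(w)-w\|_{\mathcal{B}(\Omega)}=0$;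 (S2) for each $\delta>0$, $\lim_{J\to\infty}\sup_{w\in\mathsf{K}'}\|f_\delta(w)-\sum_{j=1}^J\langle f_\delta(w),\eta_j\rangle_{L^2(B)}\eta_j\|_{\mathcal{B}(\Omega)}=0$; (S3) for each $\delta>0$ and $j\in\mathbb{N}$, $w\mapsto\langle f_\delta(w),\eta_j\rangle_{L^2(B)}$ is a continuous functional on $\mathcal{B}(\Omega)$. For $\mathbb{R}^{k'}$-valued function spaces the $\eta_j$ are real-valued and the inner products are taken componentwise (so they are $\mathbb{R}^{k'}$-valued). *)

(* Defs.v *)
From HB Require Import structures.
From mathcomp Require Import all_boot all_order all_algebra.
From mathcomp Require Import all_classical all_reals all_analysis.

Set Implicit Arguments.
Unset Strict Implicit.
Unset Printing Implicit Defensive.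

Import Order.TTheory GRing.Theory Num.Theory.
Import numFieldNormedType.Exports.

Local Open Scope classical_set_scope.
Local Open Scope ring_scope.

(* Borel sigma-algebra of R^d, generated by the coordinates. *)
Definition coord_mx (R : realType) (d : nat) (i : 'I_d) (x : 'rV[R]_d) :
  measurableTypeR R := x 0 i.

Definition rV_display (R : realType) : measure_display.
Proof. by constructor. Qed.

Section borel_rV.
Variables (R : realType) (d : nat).

Let rV_set0 : g_sigma_preimage (@coord_mx R d) set0.
Proof. exact: sigma_algebra0. Qed.

Let rV_setC A :
  g_sigma_preimage (@coord_mx R d) A -> g_sigma_preimage (@coord_mx R d) (~` A).
Proof. exact: sigma_algebraC. Qed.

Let rV_bigcup (F : (set 'rV[R]_d)^nat) :
  (forall i, g_sigma_preimage (@coord_mx R d) (F i)) ->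
  g_sigma_preimage (@coord_mx R d) (\bigcup_i (F i)).
Proof. exact: sigma_algebra_bigcup. Qed.

HB.instance Definition _ := @isMeasurable.Build (rV_display R)
  'rV[R]_d (g_sigma_preimage (@coord_mx R d)) rV_set0 rV_setC rV_bigcup.

Definition cons_rV (p : measurableTypeR R * 'rV[R]_d) : 'rV[R]_(d.+1) :=
  row_mx (const_mx p.1 : 'M[R]_1) p.2.

End borel_rV.

Lemma measurable_coord_mx (R : realType) (d : nat) (i : 'I_d) :
  measurable_fun setT (@coord_mx R d i).
Proof.
move=> _ Y mY; rewrite setTI; apply: sub_sigma_algebra => /=.
rewrite -bigcup_seq/=; exists i => /=; first by rewrite mem_index_enum.
by exists Y => //; rewrite setTI.
Qed.

Lemma measurable_fun_coordP d1 (T : measurableType d1) (R : realType) (d : nat)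
    (f : T -> 'rV[R]_d) :
  (forall i, measurable_fun setT (@coord_mx R d i \o f)) ->
  measurable_fun setT f.
Proof.
move=> mf _ Y; rewrite setTI.
have : g_sigma_preimage (@coord_mx R d) `<=` [set A | measurable (f @^-1` A)].
  apply: smallest_sub.
    split => /=.
    - by rewrite preimage_set0.
    - by move=> A mA; rewrite setTD -preimage_setC; exact: measurableC.
    - by move=> F mF; rewrite preimage_bigcup; exact: bigcup_measurable.
  move=> A; rewrite -bigcup_seq => -[i _ [B mB <-]] /=.
  by rewrite setTI; have := mf i measurableT B mB; rewrite setTI.
exact.
Qed.


Lemma measurable_cons_rV (R : realType) (d : nat) :
  measurable_fun setT (@cons_rV R d).
Proof.
apply: measurable_fun_coordP => i.
have [j ij|j ij] := splitP (i : 'I_(1 + d)).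
  suff -> : @coord_mx R d.+1 i \o @cons_rV R d = fst by exact: measurable_fst.
  apply/funext => p; rewrite /coord_mx /cons_rV/=.
  have -> : i = lshift d j by apply: val_inj.
  by apply: (etrans (row_mxEl _ _ _ _)); rewrite mxE.
suff -> : @coord_mx R d.+1 i \o @cons_rV R d = @coord_mx R d j \o snd.
  by apply: measurableT_comp; [exact: measurable_coord_mx|exact: measurable_snd].
apply/funext => p; rewrite /coord_mx /cons_rV/=.
have -> : i = rshift 1 j by apply: val_inj.
exact: row_mxEr.
Qed.


Section lebesgue_rV_succ.
Variables (R : realType) (d : nat).
Variable m : {sigma_finite_measure set 'rV[R]_d -> \bar R}.
Local Open Scope ereal_scope.

Definition lebesgue_rV_succ : set 'rV[R]_d.+1 -> \bar R :=
  pushforward (@lebesgue_measure R \x m) (@cons_rV R d).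

Let succ0 : lebesgue_rV_succ set0 = 0.
Proof. by rewrite /lebesgue_rV_succ /pushforward preimage_set0 measure0. Qed.

Let succ_ge0 A : 0 <= lebesgue_rV_succ A.
Proof. by rewrite /lebesgue_rV_succ /pushforward; exact: measure_ge0. Qed.

Let succ_sigma_additive : semi_sigma_additive lebesgue_rV_succ.
Proof.
exact: (@measure_semi_sigma_additive _ _ _
  (measure_function_pushforward__canonical__measure_function_Measure
    (@lebesgue_measure R \x m) (@measurable_cons_rV R d))).
Qed.

HB.instance Definition _ := isMeasure.Build _ _ _ lebesgue_rV_succ
  succ0 succ_ge0 succ_sigma_additive.

Let uncons (x : 'rV[R]_d.+1) : measurableTypeR R * 'rV[R]_d :=
  (coord_mx ord0 x, rsubmx (x : 'rV_(1 + d))).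

Let cons_rVK : cancel (@cons_rV R d) uncons.
Proof.
case=> a x; rewrite /uncons /cons_rV /coord_mx/=; congr pair.
  suff -> : ord0 = lshift d (ord0 : 'I_1) by apply: (etrans (row_mxEl _ _ _ _)); rewrite mxE.
  exact: val_inj.
exact: row_mxKr.
Qed.

Let measurable_uncons : measurable_fun setT uncons.
Proof.
apply: measurable_fun_pair; first exact: measurable_coord_mx.
apply: measurable_fun_coordP => i.
suff -> : @coord_mx R d i \o (fun x : 'rV[R]_d.+1 => rsubmx (x : 'rV_(1 + d))) =
    @coord_mx R d.+1 (rshift 1 i) by exact: measurable_coord_mx.
by apply/funext => x; rewrite /coord_mx/= mxE.
Qed.

Let succ_sigma_finite : sigma_finite setT lebesgue_rV_succ.
Proof.
have /sigma_finiteP[F [TF ndF Foo]] := sigma_finiteT (@lebesgue_measure R).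
have /sigma_finiteP[G [TG ndG Goo]] := sigma_finiteT m.
exists (fun n => uncons @^-1` (F n `*` G n)).
  rewrite predeqE => x; split=> // _.
  have [a _ Fa] : (\bigcup_k F k) (uncons x).1 by rewrite -TF.
  have [b _ Gb] : (\bigcup_k G k) (uncons x).2 by rewrite -TG.
  exists (maxn a b) => //; split => /=.
    by move: Fa; exact/subsetPset/ndF/leq_maxl.
  by move: Gb; exact/subsetPset/ndG/leq_maxr.
move=> k; have [mF Fk] := Foo k; have [mG Gk] := Goo k.
have mFG : measurable (F k `*` G k) by exact: measurableX.
split; first by rewrite -[X in measurable X]setTI; exact: measurable_uncons.
rewrite /lebesgue_rV_succ /pushforward -comp_preimage.
suff -> : uncons \o @cons_rV R d = id.
  by rewrite preimage_id product_measure1E// lte_mul_pinfty// ge0_fin_numE.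
by apply/funext => x; rewrite /= cons_rVK.
Qed.

HB.instance Definition _ := Measure_isSigmaFinite.Build _ _ _ lebesgue_rV_succ
  succ_sigma_finite.

End lebesgue_rV_succ.

Fixpoint borel_lebesgue_rV (R : realType) (d : nat) :
    {sigma_finite_measure set 'rV[R]_d -> \bar R} :=
  match d with
  | 0 => dirac (0 : 'rV[R]_0)
  | d'.+1 => lebesgue_rV_succ (borel_lebesgue_rV R d')
  end.

(* R^d with the Lebesgue sigma-algebra: the completion of the Borel one for the
   iterated product measure. *)
Notation lebesgueT R d :=
  (caratheodory_type (mu_ext (borel_lebesgue_rV R d))).


Definition lebesgue_rV (R : realType) (d : nat) :
    set (lebesgueT R d) -> \bar R :=
  @completed_measure_extension _ _ _ (borel_lebesgue_rV R d).
Arguments lebesgue_rV : clear implicits.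
HB.instance Definition _ (R : realType) (d : nat) :=
  Measure.on (lebesgue_rV R d).


(* Supremum of a family of nonnegative extended reals; 0 is thrown in so that
   the empty family has supremum 0 and not -oo. *)
Definition esup (R : realType) (T : Type) (A : set T) (g : T -> \bar R) :
  \bar R := ereal_sup ([set 0%E] `|` [set g x | x in A]).

Section partial_derivatives.
Variables (R : realType) (d : nat) (V : normedModType R).
Implicit Types (f : 'rV[R]_d -> V) (l : seq 'I_d) (A : set 'rV[R]_d).

Definition axis (i : 'I_d) : 'rV[R]_d := delta_mx 0 i.

Definition partials l f : 'rV[R]_d -> V :=
  foldr (fun i g => 'D_(axis i) g) f l.

(* d_1^(a_1) ... d_d^(a_d) f; the multi-indices of order at most s are the
   elements a of {ffun 'I_d -> 'I_s.+1} with \sum_i a i <= s. *)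
Definition pderiv s (a : {ffun 'I_d -> 'I_s.+1}) f : 'rV[R]_d -> V :=
  partials (flatten [seq nseq (a i) i | i <- enum 'I_d]) f.

(* For vector-valued f, `|.| is the max norm of 'rV, which is equivalent to the
   Euclidean one. *)
Definition Cnorm (s : nat) A f : \bar R :=
  (\sum_(a : {ffun 'I_d -> 'I_s.+1} | (\sum_i a i <= s)%N)
    esup A (fun x => (`|pderiv a f x|)%:E))%E.

(* For Omega open: f is in C^s(Omega) when D = Omega, and in C^s(closure Omega)
   when D = closure Omega, i.e. all partial derivatives of order at most s
   extend continuously to D. Derivatives are iterated in every order, and the
   values of f outside D are irrelevant. *)
Record Cs_on (s : nat) (Omega D : set 'rV[R]_d) f : Prop := {
  Cs_derivable : forall l i x, (size l < s)%N -> Omega x ->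
    derivable (partials l f) x (axis i);
  Cs_continuous : {within D, continuous f};
  Cs_extension : forall l, (size l <= s)%N ->
    exists2 g : 'rV[R]_d -> V, {within D, continuous g} &
      forall x, Omega x -> g x = partials l f x;
  Cs_bounded : (Cnorm s Omega f < +oo)%E
}.

End partial_derivatives.

Section lemmas.
Variables (R : realType) (d : nat) (V : normedModType R).
Implicit Types (f g : 'rV[R]_d -> V) (l : seq 'I_d) (Omega D : set 'rV[R]_d).

Lemma esup_ge0 T (A : set T) (g : T -> \bar R) : (0 <= esup A g)%E.
Proof. by apply: ereal_sup_ubound; left. Qed.

Lemma esup_ub T (A : set T) (g : T -> \bar R) x : A x -> (g x <= esup A g)%E.
Proof. by move=> Ax; apply: ereal_sup_ubound; right; exists x. Qed.

Lemma esup_le T (A : set T) (g : T -> \bar R) y :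
  (0 <= y)%E -> (forall x, A x -> (g x <= y)%E) -> (esup A g <= y)%E.
Proof. by move=> y0 gy; apply: ge_ereal_sup => _ [->//|[x Ax <-]]; exact: gy. Qed.

Lemma Cnorm_ge0 s Omega f : (0 <= Cnorm s Omega f)%E.
Proof. by apply: sume_ge0 => a _; exact: esup_ge0. Qed.

Lemma eq_partials Omega f g l : open Omega ->
  (forall x, Omega x -> f x = g x) ->
  forall x, Omega x -> partials l f x = partials l g x.
Proof.
move=> oO fg; elim: l => [|i l IH] //= x Ox.
by apply: near_eq_derive; near=> y; apply: IH; near: y; exact: open_nbhs_nbhs.
Unshelve. all: by end_near. Qed.

Lemma eq_Cnorm s Omega f g : open Omega ->
  (forall x, Omega x -> f x = g x) -> Cnorm s Omega f = Cnorm s Omega g.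
Proof.
move=> oO fg; apply: eq_bigr => a _; congr ereal_sup; congr (_ `|` _).
by apply: eq_imagel => x Ox; rewrite /pderiv (eq_partials _ oO fg).
Qed.


Definition Csder s Omega f := forall l i x, (size l < s)%N -> Omega x ->
  derivable (partials l f) x (axis R i).

Lemma partialsD s Omega f g l : open Omega -> Csder s Omega f ->
  Csder s Omega g -> (size l <= s)%N ->
  forall x, Omega x -> partials l (f + g) x = partials l f x + partials l g x.
Proof.
move=> oO df dg; elim: l => [|i l IH] //= sl x Ox.
rewrite -[RHS]deriveD; [|exact: df|exact: dg].
apply: near_eq_derive; near=> y; apply: (IH (ltnW sl)).
by near: y; exact: open_nbhs_nbhs.
Unshelve. all: by end_near. Qed.

Lemma partialsZ s Omega c f l : open Omega -> Csder s Omega f ->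
  (size l <= s)%N ->
  forall x, Omega x -> partials l (c *: f) x = c *: partials l f x.
Proof.
move=> oO df; elim: l => [|i l IH] //= sl x Ox.
rewrite -[RHS]deriveZ; last exact: df.
apply: near_eq_derive; near=> y; apply: (IH (ltnW sl)).
by near: y; exact: open_nbhs_nbhs.
Unshelve. all: by end_near. Qed.

Lemma size_multi s (a : {ffun 'I_d -> 'I_s.+1}) :
  size (flatten [seq nseq (a i) i | i <- enum 'I_d]) = (\sum_i a i)%N.
Proof.
rewrite size_flatten /shape -map_comp sumnE big_map big_enum/=.
by apply: eq_bigr => i _; rewrite size_nseq.
Qed.

Lemma CnormD s Omega f g : open Omega -> Csder s Omega f -> Csder s Omega g ->
  (Cnorm s Omega (f + g)%R <= Cnorm s Omega f + Cnorm s Omega g)%E.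
Proof.
move=> oO df dg; rewrite /Cnorm -big_split/=; apply: lee_sum => a sa.
apply: esup_le => [|x Ox]; first by rewrite adde_ge0 ?esup_ge0.
rewrite {1}/pderiv (partialsD oO df dg) ?size_multi// (@le_trans _ _
  (`|pderiv a f x|%:E + `|pderiv a g x|%:E)%E)//.
  by rewrite -EFinD lee_fin ler_normD.
by rewrite leeD ?(esup_ub (fun x => `|pderiv a _ x|%:E) Ox).
Qed.

Lemma CnormZ_le s Omega c f : open Omega -> Csder s Omega f ->
  (Cnorm s Omega (c *: f)%R <= `|c|%:E * Cnorm s Omega f)%E.
Proof.
move=> oO df; rewrite /Cnorm ge0_sume_distrr; last by move=> *; exact: esup_ge0.
apply: lee_sum => a sa; apply: esup_le => [|x Ox].
  by rewrite mule_ge0 ?esup_ge0// lee_fin.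
rewrite {1}/pderiv (partialsZ c oO df) ?size_multi// normrZ EFinM.
by rewrite lee_wpmul2l ?lee_fin// (esup_ub (fun x => `|pderiv a _ x|%:E) Ox).
Qed.

Lemma Csder_D s Omega f g : open Omega -> Csder s Omega f -> Csder s Omega g ->
  Csder s Omega (f + g).
Proof.
move=> oO df dg l i x sl Ox.
apply: (near_eq_derivable _ (derivableD (df l i x sl Ox) (dg l i x sl Ox))).
near=> y; apply/esym/(partialsD oO df dg (ltnW sl)).
by near: y; exact: open_nbhs_nbhs.
Unshelve. all: by end_near. Qed.

Lemma Csder_Z s Omega c f : open Omega -> Csder s Omega f ->
  Csder s Omega (c *: f).
Proof.
move=> oO df l i x sl Ox.
apply: (near_eq_derivable _ (@derivableZ _ _ _ _ c _ _ (df l i x sl Ox))).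
near=> y; apply/esym/(partialsZ c oO df (ltnW sl)).
by near: y; exact: open_nbhs_nbhs.
Unshelve. all: by end_near. Qed.

Lemma within_continuousD (D : set 'rV[R]_d) f g : {within D, continuous f} ->
  {within D, continuous g} -> {within D, continuous (f + g)}.
Proof. by move=> cf cg x; exact: (cvgD (cf x) (cg x)). Qed.

Lemma within_continuousZ (D : set 'rV[R]_d) c f : {within D, continuous f} ->
  {within D, continuous (c *: f)}.
Proof. by move=> cf x; exact: (cvgZl_tmp (k := c) (cf x)). Qed.

Lemma Cs_onD s Omega D f g : open Omega -> Cs_on s Omega D f ->
  Cs_on s Omega D g -> Cs_on s Omega D (f + g).
Proof.
move=> oO [df cf ef bf] [dg cg eg bg]; split.
- exact: Csder_D.
- exact: within_continuousD.
- move=> l sl; have [f' cf' ff'] := ef l sl; have [g' cg' gg'] := eg l sl.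
  exists (f' + g'); first exact: within_continuousD.
  by move=> x Ox; rewrite (partialsD oO df dg sl Ox) -ff'// -gg'.
- by rewrite (le_lt_trans (CnormD oO df dg))// lte_add_pinfty.
Qed.

Lemma Cs_onZ s Omega D c f : open Omega -> Cs_on s Omega D f ->
  Cs_on s Omega D (c *: f).
Proof.
move=> oO [df cf ef bf]; split.
- exact: Csder_Z.
- exact: within_continuousZ.
- move=> l sl; have [f' cf' ff'] := ef l sl.
  exists (c *: f'); first exact: within_continuousZ.
  by move=> x Ox; rewrite (partialsZ c oO df sl Ox) -ff'.
- by rewrite (le_lt_trans (CnormZ_le c oO df))// lte_mul_pinfty// ?Cnorm_ge0// lee_fin.
Qed.

Lemma partials0 l : partials l (0 : 'rV[R]_d -> V) = 0.
Proof.
elim: l => //= i l ->; apply/funext => x; exact: derive_cst.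
Qed.

Lemma Cs_on0 s Omega D : Cs_on s Omega D (0 : 'rV[R]_d -> V).
Proof.
split.
- by move=> l i x _ _; rewrite partials0; exact: derivable_cst.
- by move=> x; exact: cvg_cst.
- by move=> l _; exists 0; [move=> x; exact: cvg_cst|rewrite partials0].
- rewrite (@le_lt_trans _ _ 0%E)//; apply: sume_le0 => a _.
  by apply: esup_le => // x _; rewrite /pderiv partials0 normr0.
Qed.

Lemma Cnorm_eq0 s Omega f : Cnorm s Omega f = 0%E ->
  forall x, Omega x -> f x = 0.
Proof.
move=> f0 x Ox; pose a0 := [ffun=> ord0] : {ffun 'I_d -> 'I_s.+1}.
have sa0 : (\sum_i a0 i <= s)%N by rewrite big1// => i _; rewrite ffunE.
have w0 : flatten [seq nseq (a0 i) i | i <- enum 'I_d] = [::].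
  by apply: size0nil; rewrite size_multi big1// => i _; rewrite ffunE.
have : (`|f x|%:E <= Cnorm s Omega f)%E.
  rewrite /Cnorm (bigD1 a0)//= -[leLHS]adde0 leeD//; last first.
    by apply: sume_ge0 => a _; exact: esup_ge0.
  have := esup_ub (fun x => `|pderiv a0 f x|%:E) Ox.
  by rewrite /pderiv w0.
by rewrite f0 lee_fin normr_le0 => /eqP.
Qed.

End lemmas.

Definition dotp (R : realType) (d : nat) (x y : 'rV[R]_d) : R :=
  \sum_i x 0 i * y 0 i.

(* Near a boundary point, Omega is the strict epigraph, in the direction of the
   unit vector e, of a Lipschitz function gamma on the hyperplane orthogonal to
   e (a copy of R^(d-1)); x - dotp x e *: e is the projection onto it. *)
Definition lipschitz_boundary (R : realType) (d : nat)
    (Omega : set 'rV[R]_d) : Prop :=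
  forall x0, (closure Omega `\` Omega°) x0 ->
  exists (e : 'rV[R]_d) (gamma : 'rV[R]_d -> R) (M r : R),
    [/\ dotp e e = 1, 0 < r,
        M.-lipschitz_[set y | dotp y e = 0] gamma &
        forall x, `|x - x0| < r ->
          (Omega x <-> gamma (x - dotp x e *: e) < dotp x e)].

Record lipschitz_domain (R : realType) (d : nat) := LipschitzDomain {
  dom :> set 'rV[R]_d;
  dom_open : open dom;
  dom_connected : connected dom;
  dom_nonempty : dom !=set0;
  dom_bounded : bounded_set dom;
  dom_lipschitz : lipschitz_boundary dom
}.

(* The spaces C^s(Omega; V) (cl = false) and C^s(closure Omega; V) (cl = true),
   normed by Cnorm. Functions on the region are represented by total functions
   that vanish outside it, so that equality in the space is Leibniz equality. *)
Section cspace.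
Variables (cl : bool) (R : realType) (d s : nat).
Variables (Omega : lipschitz_domain R d) (V : normedModType R).

Definition region : set 'rV[R]_d := if cl then closure Omega else Omega.

Definition cspace_pred : {pred 'rV[R]_d -> V} := fun f =>
  `[< Cs_on s Omega region f /\ forall x, ~ region x -> f x = 0 >].

Record cspace := CSpace { cspace_val :> 'rV[R]_d -> V;
                          cspaceP : cspace_val \in cspace_pred }.

HB.instance Definition _ := [isSub for cspace_val].
HB.instance Definition _ := [Choice of cspace by <:].

Lemma cspace_submod_closed : submod_closed cspace_pred.
Proof.
split.
  by apply/asboolP; split; [exact: Cs_on0|].
move=> c f g /asboolP[Cf f0] /asboolP[Cg g0]; apply/asboolP; split.
  by apply: Cs_onD; [exact: dom_open|apply: Cs_onZ => //; exact: dom_open|].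
by move=> x nx; rewrite -[LHS]/(c *: f x + g x) f0// g0// scaler0 addr0.
Qed.

HB.instance Definition _ := GRing.isSubmodClosed.Build _ _ cspace_pred
  cspace_submod_closed.
HB.instance Definition _ := [SubChoice_isSubLmodule of cspace by <:].

Lemma cspace_Cs_on (f : cspace) : Cs_on s Omega region f.
Proof. by have /asboolP[] := cspaceP f. Qed.

Definition cspace_norm (f : cspace) : R := fine (Cnorm s Omega f).

Lemma cspace_normE (f : cspace) : (cspace_norm f)%:E = Cnorm s Omega f.
Proof.
rewrite fineK// ge0_fin_numE ?Cnorm_ge0//.
by have [] := cspace_Cs_on f.
Qed.

Let ler_cspace_normD f g : cspace_norm (f + g) <= cspace_norm f + cspace_norm g.
Proof.
rewrite -lee_fin EFinD !cspace_normE; apply: CnormD; first exact: dom_open.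
  by have [] := cspace_Cs_on f.
by have [] := cspace_Cs_on g.
Qed.

Let cspace_normZ_le c f : cspace_norm (c *: f) <= `|c| * cspace_norm f.
Proof.
rewrite -lee_fin EFinM !cspace_normE; apply: CnormZ_le; first exact: dom_open.
by have [] := cspace_Cs_on f.
Qed.

Let cspace_normZ c f : cspace_norm (c *: f) = `|c| * cspace_norm f.
Proof.
apply/eqP; rewrite eq_le cspace_normZ_le/=.
have [->|c0] := eqVneq c 0.
  by rewrite normr0 mul0r -lee_fin cspace_normE Cnorm_ge0.
rewrite -ler_pdivlMl ?normr_gt0// -normfV.
by rewrite -{1}[f](scalerK c0) cspace_normZ_le.
Qed.

Let cspace_norm_eq0 f : cspace_norm f = 0 -> f = 0.
Proof.
move=> f0; have {}f0 : Cnorm s Omega f = 0%E by rewrite -cspace_normE f0.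
apply/val_inj/funext => x /=.
have [Dx|] := pselect (region x); last by have /asboolP[_] := cspaceP f; exact.
have fO := Cnorm_eq0 f0.
case: (pselect (dom Omega x)) => [/fO//|nOx].
have [_ cf _ _] := cspace_Cs_on f.
move: Dx cf; rewrite /region; case: cl => // Dx cf.
apply/eqP/negPn/negP => fx0.
have /subspace_continuousP/(_ x Dx) cfx := cf.
have : \forall y \near within (closure Omega) (nbhs x), (f : _ -> V) y != 0.
  exact: (cvgr_neq0 _ cfx).
rewrite near_withinE => nf.
have [y [Oy /= fy]] := Dx _ nf.
by move: (fy (@subset_closure _ _ _ Oy)); rewrite (fO _ Oy) eqxx.
Qed.

HB.instance Definition _ := Lmodule_isNormed.Build R cspace
  ler_cspace_normD cspace_normZ cspace_norm_eq0.

End cspace.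

Notation Copen := (cspace false).
Notation Cclosed := (cspace true).

Lemma Cs_on_restrict (R : realType) (d s : nat) (V : normedModType R)
    (Omega D : set 'rV[R]_d) (f g : 'rV[R]_d -> V) :
  open Omega -> Omega `<=` D -> (forall x, Omega x -> g x = f x) ->
  Cs_on s Omega D f -> Cs_on s Omega Omega g.
Proof.
move=> oO OD gf [df cf ef bf]; split.
- move=> l i x sl Ox; apply: (near_eq_derivable _ (df l i x sl Ox)).
  near=> y; apply/esym/(eq_partials l oO gf).
  by near: y; exact: open_nbhs_nbhs.
- have := continuous_subspaceW OD cf.
  by apply: subspace_eq_continuous => x; rewrite inE => Ox; exact/esym/gf.
- move=> l sl; have [h ch hf] := ef l sl; exists h.
    exact: continuous_subspaceW ch.
  by move=> x Ox; rewrite hf// (eq_partials l oO gf).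
- by rewrite (eq_Cnorm s oO gf).
Unshelve. all: by end_near. Qed.

Definition restr_fun (R : realType) (d : nat) (V : normedModType R)
    (Omega : set 'rV[R]_d) (f : 'rV[R]_d -> V) : 'rV[R]_d -> V :=
  fun x => if `[< Omega x >] then f x else 0.

Lemma restr_cspace (R : realType) (d s : nat) (Omega : lipschitz_domain R d)
    (V : normedModType R) (f : Cclosed s Omega V) :
  restr_fun Omega f \in @cspace_pred false R d s Omega V.
Proof.
apply/asboolP; split; last by move=> x /asboolPn/negbTE nx; rewrite /restr_fun nx.
apply: (@Cs_on_restrict _ _ _ _ _ (closure Omega) (f : _ -> _)).
- exact: dom_open.
- exact: subset_closure.
- by move=> x Ox; rewrite /restr_fun asboolT.
- exact: cspace_Cs_on f.
Qed.

(* The inclusion of C^s(closure Omega; V) into C^s(Omega; V). *)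
Definition restr (R : realType) (d s : nat) (Omega : lipschitz_domain R d)
    (V : normedModType R) (f : Cclosed s Omega V) : Copen s Omega V :=
  CSpace (restr_cspace f).

Section networks.
Variable R : realType.

(* Vectors are rows, so z |-> A z + b is written z *m A + b. A network has at
   least one hidden layer: with purely affine networks allowed, the identity
   would be a network and sigma_identity below would be void. *)
Inductive ffnn (dy : nat) : nat -> Type :=
| ShallowNet (dx w : nat) (A1 : 'M[R]_(dx, w)) (b1 : 'rV[R]_w)
    (A2 : 'M[R]_(w, dy)) (b2 : 'rV[R]_dy) : ffnn dy dx
| DeepNet (dx w : nat) (A1 : 'M[R]_(dx, w)) (b1 : 'rV[R]_w)
    (G : ffnn dy w) : ffnn dy dx.

Fixpoint ffnn_eval (sigma : R -> R) (dy dx : nat) (G : ffnn dy dx) :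
    'rV[R]_dx -> 'rV[R]_dy :=
  match G with
  | ShallowNet _ _ A1 b1 A2 b2 =>
      fun x => map_mx sigma (x *m A1 + b1) *m A2 + b2
  | DeepNet _ _ A1 b1 G' =>
      fun x => ffnn_eval sigma G' (map_mx sigma (x *m A1 + b1))
  end.

Record activation_assumption (s : nat) (sigma : R -> R) : Prop := {
  sigma_smooth : forall n x, derivable (sigma^`(n))%classic x 1;
  sigma_nonpolynomial : ~ exists p : {poly R}, forall x, sigma x = p.[x];
  sigma0 : sigma 0 = 0;
  sigma_identity : forall (n : nat) (eps : R) (c : 'rV[R]_n) (r : R),
    0 < eps -> 0 < r -> exists G : ffnn n n,
      ffnn_eval sigma G 0 = 0 /\
      (Cnorm s (closed_ball c r) (fun x => ffnn_eval sigma G x - x)%R < eps%:E)%E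
}.

Variable d : nat.

Definition inner_L2 (n : nat) (B : set 'rV[R]_d) (v : 'rV[R]_d -> 'rV[R]_n)
    (eta : 'rV[R]_d -> R) : 'rV[R]_n :=
  \row_i \int[lebesgue_rV R d]_(y in B) (v y 0 i * eta y).

Record nno_layer (dc M : nat) := NnoLayer {
  layer_W : 'M[R]_dc;
  layer_b : 'rV[R]_dc;
  layer_T : 'I_M -> 'M[R]_dc;
  layer_psi : 'I_M -> 'rV[R]_d -> R;
  layer_phi : 'I_M -> 'rV[R]_d -> R
}.

Definition layer_eval (sigma : R -> R) (Omega : set 'rV[R]_d) (dc M : nat)
    (l : nno_layer dc M) (v : 'rV[R]_d -> 'rV[R]_dc) : 'rV[R]_d -> 'rV[R]_dc :=
  fun x => map_mx sigma (v x *m layer_W l + layer_b l +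
    \sum_(m < M) layer_phi l m x *:
      (inner_L2 Omega v (layer_psi l m) *m layer_T l m)).

Record nno (k k' dc L M : nat) := Nno {
  nno_R : ffnn dc (k + d);
  nno_layers : L.-tuple (nno_layer dc M);
  nno_Q : ffnn k' dc
}.

Definition nno_eval (sigma : R -> R) (Omega : set 'rV[R]_d)
    (k k' dc L M : nat) (Psi : nno k k' dc L M) (a : 'rV[R]_d -> 'rV[R]_k) :
    'rV[R]_d -> 'rV[R]_k' :=
  let lift x := ffnn_eval sigma (nno_R Psi) (row_mx (a x) x) in
  let hidden := foldl (fun v l => layer_eval sigma Omega l v) lift
                      (nno_layers Psi) in
  fun x => ffnn_eval sigma (nno_Q Psi) (hidden x).

End networks.

(* fB delta w is the extension of f delta w to B, on which the functions eta j
   are also given. *)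
Record smoothed_approximation_by (R : realType) (d s k' : nat)
    (Omega : lipschitz_domain R d)
    (K' : set (Copen s Omega 'rV[R]_k')) (eta : nat -> 'rV[R]_d -> R)
    (B : set 'rV[R]_d)
    (f : R -> {linear (Copen s Omega 'rV[R]_k') -> (Copen s Omega 'rV[R]_k')})
    (fB : R -> Copen s Omega 'rV[R]_k' -> 'rV[R]_d -> 'rV[R]_k') : Prop := {
  sa_superset : Omega `<=` B;
  sa_extends : forall delta w x, 0 < delta -> dom Omega x ->
    fB delta w x = (f delta w : Copen s Omega _) x;
  sa_measurable : measurable (B : set (lebesgueT R d));
  sa_integrable : forall delta w j i, 0 < delta ->
    (lebesgue_rV R d).-integrable B (fun y => (fB delta w y 0 i * eta j y)%:E);
  sa_S1 : esup K' (fun w => `|f delta w - w|%:E) @[delta --> 0^'+] --> 0%E;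
  sa_S2 : forall delta, 0 < delta ->
    esup K' (fun w => Cnorm s Omega (fun x => (f delta w : Copen s Omega _) x -
      \sum_(j < J) eta j x *: inner_L2 B (fB delta w) (eta j))%R)
    @[J --> \oo] --> 0%E;
  sa_S3 : forall delta j, 0 < delta ->
    continuous (fun w : Copen s Omega 'rV[R]_k' =>
      inner_L2 B (fB delta w) (eta j))
}.

Definition smoothed_approximation (R : realType) (d s k' : nat)
    (Omega : lipschitz_domain R d) (K' : set (Copen s Omega 'rV[R]_k'))
    (eta : nat -> 'rV[R]_d -> R) : Prop :=
  exists B f fB, @smoothed_approximation_by R d s k' Omega K' eta B f fB.

(* Main.v *)
Require Import Defs.
From HB Require Import structures.
From mathcomp Require Import all_boot all_order all_algebra.
From mathcomp Require Import all_classical all_reals all_analysis.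
From mathcomp Require Import ring lra.

(** Fix [u] in [K] and [x] in Omega and look at everything as functions of the
    pair [(u, x)], with the norm sup over [u] of the C^m norm in [x], where
    m = s'.

    Smoothed approximation replaces Psi^dagger by a finite sum
    [\sum_j alpha_j(u) xi_j(x)], where the [alpha_j] are continuous on [K] and
    the [xi_j] are C^m up to the boundary; so only products
    [alpha(u) xi(x)] have to be approximated. A single layer with the pair
    [(eta1, eta2)] can compute, before the activation, every
    [r(x) + eta2(x) * \int g(u(y), y) eta1(y) dy] where [r] and [g] are
    networks. These preactivations form a vector space [V] ([preact]), and the
    layer followed by an affine map yields the span of the [sigma(v)], [v] in
    [V].

    The closure of that span contains a closed algebra that contains [V]
    ([net_algebra]). Indeed, rescaling Taylor's formula,
    [h^-n (sigma(b + h v) - lower order terms)] tends to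
    [sigma^(n)(b) / n! * v^n], so by induction on [n] all powers of [v] are
    limits of networks ([pow_net]); by Weierstrass so is [exp v], and the span
    of the exponentials is stable under products.

    It remains to find the factors in the closed algebra [A] generated by [V]
    ([target_algebra]).
    - Functions of [x]: [A] contains the coordinates, and polynomials are dense
      in C^m of a bounded Lipschitz domain ([density]). On a ball of small
      radius [h], a C^m function is approximated by its Taylor polynomial at a
      point of the domain from which the ball is visible; such a point exists
      at distance O(h) because the boundary is a Lipschitz graph
      ([lipschitz_visible]). The local polynomials are blended with a partition
      of unity of scale [h], itself in [A] as its members are C^m functions of
      the coordinates.
    - Functions of [u]: since 1 / eta2 is a C^m function of [x], the
      functionals [\int g(u(y), y) eta1(y) dy] are in [A]. They separate the
      points of [K] ([weighted_int_separates]): if [u] and [v] differ in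
      coordinate [i], let [w = u_i - v_i]; the functional given by
      [g(a, y) = a_i w(y)] takes values at [u] and [v] that differ by
      [\int w^2 eta1 > 0], and [g] can be approximated by networks.
      Stone-Weierstrass then gives all continuous functions on [K].

    Finally the operator must end with a network, not with the identity: the
    outer affine map is composed with the nearly linear function
    [t |-> (sigma(b + h t) - sigma(b)) / (h sigma'(b))], with [h] small
    ([identity_approx]), and the matrices are assembled in
    [nno_realization]. *)

Set Implicit Arguments.
Unset Strict Implicit.
Unset Printing Implicit Defensive.

Import Order.TTheory GRing.Theory Num.Theory.
Import numFieldNormedType.Exports.

Local Open Scope classical_set_scope.
Local Open Scope ring_scope.

(** * Functions of class C^m up to the boundary of an open set *)

Section Directional.
Variables (R : realType) (V : normedModType R).
Implicit Types f : V -> R.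

(** Directional derivatives are derivatives along a line, which brings the
    chain rule of one-variable calculus to bear on them. *)
Lemma derive_line f x v :
  'D_v f x = 'D_1 (fun h : R => f (h *: v + x)) 0.
Proof.
rewrite /derive; set g1 := fun h => h^-1 *: _; set g2 := fun h => h^-1 *: _.
suff -> : g1 = g2 by [].
by rewrite funeqE /g1 /g2 => h /=; rewrite addr0 scale0r add0r [_%:A]mulr1.
Qed.

Lemma is_derive_line f x v df :
  is_derive x v f df <-> is_derive (0 : R) 1 (fun h : R => f (h *: v + x)) df.
Proof.
split=> -[dv dE].
  by apply: DeriveDef; [exact: (derivable1P _ _ _).1|rewrite -derive_line].
by apply: DeriveDef; [exact: (derivable1P _ _ _).2|rewrite derive_line].
Qed.

Lemma is_derive_scalar_comp (phi : R -> R) (f : V -> R) x v df dphi :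
  is_derive (f x) 1 phi dphi -> is_derive x v f df ->
  is_derive x v (phi \o f) (dphi * df).
Proof.
move=> hphi /is_derive_line hf; apply/is_derive_line.
have h : is_derive ((fun h : R => f (h *: v + x)) 0) 1 phi dphi.
  by rewrite scale0r add0r.
have := @is_derive1_comp _ phi (fun h : R => f (h *: v + x)) 0 _ _ h hf.
by rewrite mulrC.
Qed.

End Directional.

Section Calculus.
Variables (R : realType) (d : nat) (Om : set 'rV[R]_d).
Hypothesis oOm : open Om.
Implicit Types f g : 'rV[R]_d -> R.
Local Notation ax := (axis R).

Definition extends f := exists2 g : 'rV[R]_d -> R,
  {within closure Om, continuous g} & forall x, Om x -> g x = f x.

(** C^m up to the boundary, by recursion on first-order partial derivatives: a
    proof about order [m] is then an induction with one differentiation at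
    each step, and no multi-indices. *)
Fixpoint smooth (m : nat) (f : 'rV[R]_d -> R) : Prop := extends f /\
  if m is m'.+1 then
    forall i, (forall x, Om x -> derivable f x (ax i)) /\ smooth m' ('D_(ax i) f)
  else True.

(** All partial derivatives of order [j <= m] are at most [e * r ^+ j] on [D].
    The scale [r] records that functions living on balls of radius [r^-1] lose
    one factor [r] with each derivative. *)
Fixpoint bnd (D : set 'rV[R]_d) (r : R) (m : nat) (e : R) (f : 'rV[R]_d -> R) : Prop :=
  (forall x, D x -> `|f x| <= e) /\
  if m is m'.+1 then forall i, bnd D r m' (e * r) ('D_(ax i) f) else True.

Lemma eq_near f g x : (forall y, Om y -> f y = g y) -> Om x ->
  \near x, f x = g x.
Proof. by move=> fg Ox; near=> y; apply: fg; near: y; exact: open_nbhs_nbhs.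
Unshelve. all: by end_near. Qed.

Lemma eq_derive_on f g v : (forall y, Om y -> f y = g y) ->
  forall x, Om x -> 'D_v f x = 'D_v g x.
Proof. by move=> fg x Ox; apply: near_eq_derive; exact: eq_near. Qed.

Lemma extends_eq f g : (forall y, Om y -> f y = g y) -> extends f -> extends g.
Proof. by move=> fg [h ch hf]; exists h => // x Ox; rewrite hf// fg. Qed.

Lemma smooth_eq m f g : (forall y, Om y -> f y = g y) -> smooth m f -> smooth m g.
Proof.
elim: m f g => [|m IH] f g fg [ef sf].
  by split=> //; exact: extends_eq ef.
split=> [|i]; first exact: extends_eq ef.
have [df sf'] := sf i; split.
  by move=> x Ox; apply: near_eq_derivable (df x Ox); exact: eq_near.
by apply: IH sf' => x Ox; exact: eq_derive_on.
Qed.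

Lemma bnd_eq D r m e f g : D `<=` Om -> (forall y, Om y -> f y = g y) ->
  bnd D r m e f -> bnd D r m e g.
Proof.
move=> DO; elim: m e f g => [|m IH] e f g fg [bf sf].
  by split=> // x Dx; rewrite -fg; [exact: bf|exact: DO].
split=> [x Dx|i]; first by rewrite -fg; [exact: bf|exact: DO].
by apply: IH (sf i) => x Ox; exact: eq_derive_on.
Qed.

Lemma smooth_ext m f : smooth m f -> extends f.
Proof. by case: m => [|m] []. Qed.

Lemma smooth_le m n f : (m <= n)%N -> smooth n f -> smooth m f.
Proof.
elim: m n f => [|m IH] [|n] f //=; first by move=> _ [].
by move=> mn [ef sf]; split=> // i; have [df s] := sf i; split=> //; exact: IH s.
Qed.

Lemma bnd0 D r m e f : bnd D r m e f -> forall x, D x -> `|f x| <= e.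
Proof. by case: m => [|m] []. Qed.

Lemma bnd_le D r m n e f : (m <= n)%N -> bnd D r n e f -> bnd D r m e f.
Proof.
elim: m n e f => [|m IH] [|n] e f //=; first by move=> _ [].
by move=> mn [ef sf]; split=> // i; exact: (IH n).
Qed.

Lemma bnd_sub D D' r m e f : D `<=` D' -> bnd D' r m e f -> bnd D r m e f.
Proof.
move=> DD; elim: m e f => [|m IH] e f [bf sf].
  by split=> // x /DD; exact: bf.
by split=> [x /DD|i]; [exact: bf|exact: (IH _ _ (sf i))].
Qed.

Lemma bnd_mono D r m e e' f : 0 <= r -> e <= e' -> bnd D r m e f -> bnd D r m e' f.
Proof.
move=> r0; elim: m e e' f => [|m IH] e e' f ee [bf sf].
  by split=> // x Dx; exact: le_trans (bf x Dx) ee.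
split=> [x Dx|i]; first exact: le_trans (bf x Dx) ee.
by apply: IH (sf i); rewrite ler_wpM2r.
Qed.

Lemma extends_comp (phi : R -> R) f : continuous phi -> extends f ->
  extends (phi \o f).
Proof.
move=> cphi [g cg gf]; exists (phi \o g); last by move=> x Ox /=; rewrite gf.
by move=> x; exact: (continuous_comp (cg x) (cphi _)).
Qed.

Lemma extends_cst c : extends (fun=> c).
Proof. by exists (fun=> c) => // x; exact: cvg_cst. Qed.

Lemma extendsD f g : extends f -> extends g -> extends (fun x => f x + g x).
Proof.
move=> [f' cf ff] [g' cg gg]; exists (f' + g').
  exact: within_continuousD.
by move=> x Ox; rewrite -ff// -gg.
Qed.

Lemma extendsM f g : extends f -> extends g -> extends (fun x => f x * g x).
Proof.
move=> [f' cf ff] [g' cg gg]; exists (f' * g').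
  by move=> x; exact: (cvgM (cf x) (cg x)).
by move=> x Ox; rewrite -ff// -gg.
Qed.

Lemma extends_coord i : extends (fun x => x 0 i).
Proof.
exists (fun x => x 0 i) => //; apply: continuous_subspaceT => x.
exact: coord_continuous.
Qed.

Lemma derive_const (c : R) (v : 'rV[R]_d) :
  'D_v (fun=> c) = (fun=> 0) :> ('rV[R]_d -> R).
Proof. by apply/funext => x; rewrite -(derive_cst c x v). Qed.

Lemma smoothC m c : smooth m (fun=> c).
Proof.
elim: m c => [|m IH] c; split=> //; [exact: extends_cst..|].
move=> i; split; first by move=> x _; exact: derivable_cst.
by rewrite derive_const.
Qed.

Lemma smoothD m f g : smooth m f -> smooth m g -> smooth m (fun x => f x + g x).
Proof.
elim: m f g => [|m IH] f g [ef sf] [eg sg].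
  by split=> //; exact: extendsD.
split=> [|i]; first exact: extendsD.
have [df sf'] := sf i; have [dg sg'] := sg i.
split; first by move=> x Ox; apply: derivableD; [exact: df|exact: dg].
apply: (smooth_eq _ (IH _ _ sf' sg')) => x Ox.
by apply/esym/deriveD; [exact: df|exact: dg].
Qed.

Lemma bndD D r m a b f g : D `<=` Om -> smooth m f -> smooth m g ->
  bnd D r m a f -> bnd D r m b g -> bnd D r m (a + b) (fun x => f x + g x).
Proof.
move=> DO; elim: m a b f g => [|m IH] a b f g [ef sf] [eg sg] [bf cf] [bg cg].
  split=> // x Dx; rewrite (le_trans (ler_normD _ _))// lerD//; [exact: bf|exact: bg].
split=> [x Dx|i].
  by rewrite (le_trans (ler_normD _ _))// lerD//; [exact: bf|exact: bg].
have [df sf'] := sf i; have [dg sg'] := sg i.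
rewrite mulrDl; apply: (bnd_eq DO _ (IH _ _ _ _ sf' sg' (cf i) (cg i))) => x Ox.
by apply/esym/deriveD; [exact: df|exact: dg].
Qed.

Lemma smoothM m f g : smooth m f -> smooth m g -> smooth m (fun x => f x * g x).
Proof.
elim: m f g => [|m IH] f g sf sg.
  by split=> //; apply: extendsM; [exact: smooth_ext sf|exact: smooth_ext sg].
split=> [|i]; first by apply: extendsM; [exact: smooth_ext sf|exact: smooth_ext sg].
have [df sf'] := sf.2 i; have [dg sg'] := sg.2 i.
split; first by move=> x Ox; apply: derivableM; [exact: df|exact: dg].
have sf0 := smooth_le (leqnSn m) sf; have sg0 := smooth_le (leqnSn m) sg.
apply: (smooth_eq _ (smoothD (IH _ _ sf0 sg') (IH _ _ sg0 sf'))) => x Ox.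
by apply/esym/deriveM; [exact: df|exact: dg].
Qed.

(** The Leibniz rule doubles the number of terms with each derivative, hence
    the factor [2 ^+ m]. *)
Lemma bndM D r m a b f g : D `<=` Om -> 0 <= r -> 0 <= a -> 0 <= b ->
  smooth m f -> smooth m g -> bnd D r m a f -> bnd D r m b g ->
  bnd D r m (2 ^+ m * (a * b)) (fun x => f x * g x).
Proof.
move=> DO r0; elim: m a b f g => [|m IH] a b f g a0 b0 sf sg bf bg.
  split=> // x Dx; rewrite expr0 mul1r normrM ler_pM//.
    exact: bnd0 bf _ Dx.
  exact: bnd0 bg _ Dx.
split=> [x Dx|i].
  rewrite normrM (@le_trans _ _ (a * b))//.
    by rewrite ler_pM//; [exact: bnd0 bf _ Dx|exact: bnd0 bg _ Dx].
  by rewrite ler_peMl ?mulr_ge0// exprn_ege1// ler1n.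
have [df sf'] := sf.2 i; have [dg sg'] := sg.2 i.
have sf0 := smooth_le (leqnSn m) sf; have sg0 := smooth_le (leqnSn m) sg.
have bf0 := bnd_le (leqnSn m) bf; have bg0 := bnd_le (leqnSn m) bg.
have ar0 : 0 <= a * r by rewrite mulr_ge0.
have br0 : 0 <= b * r by rewrite mulr_ge0.
have -> : 2 ^+ m.+1 * (a * b) * r = 2 ^+ m * (a * (b * r)) + 2 ^+ m * (b * (a * r)).
  by rewrite exprS; ring.
apply: (bnd_eq DO _ (bndD DO _ _ (IH _ _ _ _ a0 br0 sf0 sg' bf0 (bg.2 i))
                            (IH _ _ _ _ b0 ar0 sg0 sf' bg0 (bf.2 i)))).
- by move=> x Ox; apply/esym/deriveM; [exact: df|exact: dg].
- exact: smoothM.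
- exact: smoothM.
Qed.

Lemma bndZ D r m a c f : D `<=` Om -> smooth m f ->
  bnd D r m a f -> bnd D r m (`|c| * a) (fun x => c * f x).
Proof.
move=> DO; elim: m a f => [|m IH] a f sf bf.
  by split=> // x Dx; rewrite normrM ler_wpM2l//; exact: bnd0 bf _ Dx.
split=> [x Dx|i].
  by rewrite normrM ler_wpM2l//; exact: bnd0 bf _ Dx.
have [df sf'] := sf.2 i.
rewrite -mulrA; apply: (bnd_eq DO _ (IH _ _ sf' (bf.2 i))) => x Ox.
by apply/esym/deriveZ; exact: df.
Qed.

Lemma smoothZ m c f : smooth m f -> smooth m (fun x => c * f x).
Proof. by move=> sf; apply: smoothM => //; exact: smoothC. Qed.

Lemma smoothN m f : smooth m f -> smooth m (fun x => - f x).
Proof. by move=> /(smoothZ (-1)); apply: smooth_eq => x _; rewrite mulN1r. Qed.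

Lemma smoothB m f g : smooth m f -> smooth m g -> smooth m (fun x => f x - g x).
Proof. by move=> sf /smoothN; exact: smoothD. Qed.

Lemma bndN D r m a f : D `<=` Om -> smooth m f ->
  bnd D r m a f -> bnd D r m a (fun x => - f x).
Proof.
move=> DO sf /(bndZ (-1) DO sf); rewrite normrN1 mul1r.
by apply: bnd_eq => // x _; rewrite mulN1r.
Qed.

Lemma bndB D r m a b f g : D `<=` Om -> smooth m f -> smooth m g ->
  bnd D r m a f -> bnd D r m b g -> bnd D r m (a + b) (fun x => f x - g x).
Proof.
by move=> DO sf sg bf /(bndN DO sg); apply: bndD => //; exact: smoothN.
Qed.

Lemma bndC D r m e c : 0 <= r -> `|c| <= e -> bnd D r m e (fun=> c).
Proof.
move=> r0; elim: m e c => [|m IH] e c ce; split=> // i.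
by rewrite derive_const; apply: IH; rewrite normr0 mulr_ge0// (le_trans _ ce).
Qed.

Lemma smooth_sum m (I : Type) (s : seq I) (F : I -> 'rV[R]_d -> R) :
  (forall i, smooth m (F i)) -> smooth m (fun x => \sum_(i <- s) F i x).
Proof.
move=> sF; elim: s => [|i s IH].
  by apply: (smooth_eq _ (smoothC m 0)) => x _; rewrite big_nil.
by apply: (smooth_eq _ (smoothD (sF i) IH)) => x _; rewrite big_cons.
Qed.

Lemma bnd_sum D r m (I : Type) (s : seq I) (F : I -> 'rV[R]_d -> R) (b : I -> R) :
  D `<=` Om -> 0 <= r ->
  (forall i, smooth m (F i)) -> (forall i, bnd D r m (b i) (F i)) ->
  bnd D r m (\sum_(i <- s) b i) (fun x => \sum_(i <- s) F i x).
Proof.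
move=> DO r0 sF bF; elim: s => [|i s IH].
  rewrite big_nil; apply: (bnd_eq DO _ (@bndC D r m 0 0 r0 _)); last by rewrite normr0.
  by move=> x _; rewrite big_nil.
rewrite big_cons; apply: (bnd_eq DO _ (bndD DO (sF i) (smooth_sum s sF) (bF i) IH)).
by move=> x _; rewrite big_cons.
Qed.

Lemma derive_coord (i j : 'I_d) :
  'D_(ax j) (fun x : 'rV[R]_d => x 0 i) = fun=> (i == j)%:R.
Proof.
apply/funext => x; rewrite derive_line.
have -> : (fun h : R => (h *: ax j + x) 0 i) = (fun h => (i == j)%:R * h + x 0 i).
  by apply/funext => h; rewrite !mxE/= mulrC.
rewrite deriveD; [|by apply: derivableM; [exact: derivable_cst|exact: derivable_id]|exact: derivable_cst].
rewrite derive_cst addr0 deriveZ; last exact: derivable_id.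
by rewrite derive_id [_ *: _]mulr1.
Qed.

Lemma derivable_coord (i j : 'I_d) (x : 'rV[R]_d) :
  derivable (fun x : 'rV[R]_d => x 0 i) x (ax j).
Proof. by apply: diff_derivable; exact: differentiable_coord. Qed.

Lemma smooth_coord m i : smooth m (fun x => x 0 i).
Proof.
case: m => [|m]; split=> //; [exact: extends_coord..|].
move=> j; split; first by move=> x _; exact: derivable_coord.
by rewrite derive_coord; exact: smoothC.
Qed.

End Calculus.

(** * Composition with functions of one variable *)

Lemma compact_norm_ub (R : realType) (V : normedModType R) (A : set V) :
  compact A -> exists2 M, 0 <= M & forall x, A x -> `|x| <= M.
Proof.
move=> /compact_bounded[M [_ HM]]; exists (`|M| + 1); first by rewrite addr_ge0.
by move=> x Ax; apply: HM => //; rewrite (le_lt_trans (ler_norm M))// ltrDl.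
Qed.

Section Composition.
Variables (R : realType) (d : nat) (Om : set 'rV[R]_d).
Hypothesis oOm : open Om.
Hypothesis cOm : compact (closure Om).
Implicit Types f g w : 'rV[R]_d -> R.
Local Notation ax := (axis R).

(** A function of one variable together with its derivatives; the [phi j] with
    [j > m] are arbitrary. *)
Definition jet (m : nat) (phi : nat -> R -> R) :=
  (forall j (t : R), (j < m)%N -> is_derive t (1 : R) (phi j) (phi j.+1 t)) /\
  (forall j, (j <= m)%N -> continuous (phi j)).

Lemma jet_shift m phi : jet m.+1 phi -> jet m (phi \o succn).
Proof. by case=> dphi cphi; split=> [j t jm|j jm]; [exact: dphi|exact: cphi]. Qed.

Lemma jet_bounded m phi M : jet m phi -> exists2 N, 0 <= N &
  forall j t, (j <= m)%N -> `|t| <= M -> `|phi j t| <= N.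
Proof.
move=> jphi; have Hb j : (j <= m)%N -> exists2 N, 0 <= N & forall t, `|t| <= M -> `|phi j t| <= N.
  move=> jm; have /compact_norm_ub[N N0 HN] : compact (phi j @` `[- M, M]).
    by apply: continuous_compact; [apply: continuous_subspaceT; exact: jphi.2|exact: segment_compact].
  by exists N => // t tM; apply: HN; exists t => //=; rewrite in_itv/= -ler_norml.
have /choice[N HN] : forall j, exists N, 0 <= N /\
    ((j <= m)%N -> forall t, `|t| <= M -> `|phi j t| <= N).
  move=> j; have [/Hb[N N0 HN]|] := leqP j m; first by exists N.
  by exists 0; split.
exists (\sum_(j < m.+1) N j); first by apply: sumr_ge0 => j _; case: (HN j).
move=> j t jm tM; rewrite (le_trans ((HN j).2 jm t tM))//.
rewrite (bigD1 (Ordinal (jm : (j < m.+1)%N)))//= lerDl sumr_ge0// => i _.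
by case: (HN i).
Qed.

Lemma is_derive_comp_on m phi w v x : jet m.+1 phi -> derivable w x v ->
  is_derive x v (phi 0 \o w) (phi 1 (w x) * 'D_v w x).
Proof.
by move=> [dphi _] dw; apply: is_derive_scalar_comp; [exact: dphi|exact: derivableP].
Qed.

Lemma smooth_comp m phi w : jet m phi -> smooth Om m w -> smooth Om m (phi 0 \o w).
Proof.
elim: m phi w => [|m IH] phi w jphi sw.
  by split=> //; apply: extends_comp (smooth_ext sw); exact: jphi.2.
split=> [|i]; first by apply: extends_comp (smooth_ext sw); exact: jphi.2.
have [dw sw'] := sw.2 i.
have dc x : Om x -> is_derive x (ax i) (phi 0 \o w) (phi 1 (w x) * 'D_(ax i) w x).
  by move=> Ox; apply: is_derive_comp_on jphi _; exact: dw.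
split; first by move=> x Ox; case: (dc x Ox).
apply: (smooth_eq oOm _ (smoothM oOm (IH _ _ (jet_shift jphi) (smooth_le (leqnSn m) sw)) sw')).
by move=> x Ox /=; rewrite (@derive_val _ _ _ _ _ _ _ (dc x Ox)).
Qed.

(** [C] depends on [w] only through its bound [M]. So if [phi] is small in C^m
    on [-M, M] then [phi \o w] is small uniformly over a bounded family of
    functions [w]. *)
Lemma bnd_comp m M : 0 <= M -> exists2 C, 0 <= C &
  forall D phi c w, D `<=` Om -> jet m phi -> 0 <= c ->
    (forall j t, (j <= m)%N -> `|t| <= M -> `|phi j t| <= c) ->
    smooth Om m w -> bnd D 1 m M w -> bnd D 1 m (C * c) (phi 0 \o w).
Proof.
move=> M0; elim: m => [|m [C C0 IH]].
  exists 1 => // D phi c w _ _ _ phic _ bw; split=> // x Dx.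
  by rewrite mul1r /= phic//; exact: bnd0 bw _ Dx.
exists (1 + 2 ^+ m * (C * M)).
  by rewrite addr_ge0// mulr_ge0// ?exprn_ge0// mulr_ge0.
move=> D phi c w DO jphi c0 phic sw bw; split=> [x Dx|i].
  rewrite (@le_trans _ _ c)//; first by rewrite /= phic//; exact: bnd0 bw _ Dx.
  by rewrite ler_peMl// lerDl mulr_ge0// ?exprn_ge0// mulr_ge0.
have [dw sw'] := sw.2 i.
have dc x : Om x -> is_derive x (ax i) (phi 0 \o w) (phi 1 (w x) * 'D_(ax i) w x).
  by move=> Ox; apply: is_derive_comp_on jphi _; exact: dw.
have sw0 := smooth_le (leqnSn m) sw; have bw0 := bnd_le (leqnSn m) bw.
have jS := jet_shift jphi.
have H : bnd D 1 m (C * c) ((phi \o succn) 0 \o w).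
  by apply: IH => // j t jm; exact: phic.
have bw' := bw.2 i; rewrite mulr1 in bw'.
apply: (bnd_mono (e := 2 ^+ m * (C * c * M))) => //.
  have -> : (1 + 2 ^+ m * (C * M)) * c * 1 = c + 2 ^+ m * (C * c * M) by ring.
  by rewrite lerDr.
apply: (bnd_eq oOm DO _ (bndM oOm DO _ _ _ (smooth_comp jS sw0) sw' H bw')) => //.
- by move=> x Ox /=; rewrite (@derive_val _ _ _ _ _ _ _ (dc x Ox)).
- exact: mulr_ge0.
Qed.

(** Differentiating [phi \o w] with [w] affine yields [phi'] times a slope, so
    that nothing is lost beyond the factor [r] that [bnd] allows. *)
Lemma bnd_comp_affine D r m phi c w (a : 'I_d -> R) : D `<=` Om -> jet m phi ->
  0 <= r -> 0 <= c ->
  smooth Om m w -> (forall i x, Om x -> 'D_(ax i) w x = a i) ->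
  (forall i, `|a i| <= r) ->
  (forall j x, (j <= m)%N -> D x -> `|phi j (w x)| <= c) ->
  bnd D r m c (phi 0 \o w).
Proof.
move=> DO; elim: m phi => [|m IH] phi jphi r0 c0 sw wa ar phic.
  by split=> // x Dx; exact: phic.
split=> [x Dx|i]; first exact: phic.
have [dw sw'] := sw.2 i.
have dc x : Om x -> is_derive x (ax i) (phi 0 \o w) (phi 1 (w x) * 'D_(ax i) w x).
  by move=> Ox; apply: is_derive_comp_on jphi _; exact: dw.
have sw0 := smooth_le (leqnSn m) sw.
have jS := jet_shift jphi.
apply: (bnd_mono (e := `|a i| * c)) => //.
  by rewrite mulrC ler_wpM2l.
have H : bnd D r m c ((phi \o succn) 0 \o w).
  by apply: IH => // j x jm; exact: phic.
apply: (bnd_eq oOm DO _ (bndZ oOm (a i) DO (smooth_comp jS sw0) H)).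
by move=> x Ox /=; rewrite (@derive_val _ _ _ _ _ _ _ (dc x Ox)) wa// mulrC.
Qed.

Lemma extends_bounded f : extends Om f -> exists2 M, 0 <= M & forall x, Om x -> `|f x| <= M.
Proof.
move=> [g cg gf].
have [M M0 gM] := compact_norm_ub (continuous_compact cg cOm).
exists M => // x Ox; rewrite -gf//; apply: gM.
by exists x => //; exact: subset_closure.
Qed.

Lemma smooth_bounded m f r : 0 < r -> smooth Om m f ->
  exists2 M, 0 <= M & bnd Om r m M f.
Proof.
move=> r0; elim: m f => [|m IH] f sf.
  by have [M M0 fM] := extends_bounded (smooth_ext sf); exists M.
have [M M0 fM] := extends_bounded (smooth_ext sf).
have /choice[N HN] : forall i : 'I_d, exists N, 0 <= N /\ bnd Om r m N ('D_(ax i) f).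
  by move=> i; have [N N0 fN] := IH _ (sf.2 i).2; exists N.
have Nr i : 0 <= N i / r by apply: divr_ge0; [case: (HN i)|exact: ltW].
exists (M + \sum_i N i / r); first by rewrite addr_ge0// sumr_ge0.
split=> [x Ox|i]; first by rewrite (le_trans (fM x Ox))// lerDl sumr_ge0.
apply: bnd_mono (HN i).2; first exact: ltW.
by rewrite -ler_pdivrMr// (bigD1 i)//= addrCA lerDl addr_ge0// sumr_ge0.
Qed.

End Composition.

(** * Families of functions and closed algebras *)

Section Families.
Variables (R : realType) (d : nat) (Om : set 'rV[R]_d).
Hypothesis oOm : open Om.
Variables (m : nat) (U : Type) (K : set U).
Implicit Types (F G H : U -> 'rV[R]_d -> R) (S A : set (U -> 'rV[R]_d -> R)).

(** From here on the objects are functions [F u x], measured by the supremum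
    over [u] in [K] of the C^m norm in [x]: [fam] says that this norm is
    finite, [close e] that a difference has norm at most [e], and [clos] is
    the closure. *)
Definition fam F := (forall u, K u -> smooth Om m (F u)) /\
  exists2 M, 0 <= M & forall u, K u -> bnd Om 1 m M (F u).

Definition close e F G := forall u, K u -> bnd Om 1 m e (fun x => F u x - G u x).

Definition clos S : set (U -> 'rV[R]_d -> R) :=
  [set F | fam F /\ forall e, 0 < e -> exists2 G, S G & close e F G].

Record linear_fam S := LinearFam {
  lin_fam : S `<=` fam;
  lin_cst : forall c, S (fun _ _ => c);
  lin_add : forall F G, S F -> S G -> S (fun u x => F u x + G u x);
  lin_scale : forall c F, S F -> S (fun u x => c * F u x) }.

Record closed_algebra A := ClosedAlgebra {
  alg_lin : linear_fam A;
  alg_mul : forall F G, A F -> A G -> A (fun u x => F u x * G u x);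
  alg_clos : clos A `<=` A }.

Lemma famC c : fam (fun _ _ => c).
Proof.
split; first by move=> *; exact: smoothC.
by exists `|c| => // u _; exact: bndC.
Qed.

Lemma famD F G : fam F -> fam G -> fam (fun u x => F u x + G u x).
Proof.
move=> [sF [M M0 bF]] [sG [N N0 bG]]; split=> [u Ku|].
  exact: (smoothD oOm (sF u Ku) (sG u Ku)).
exists (M + N) => [|u Ku]; first exact: addr_ge0.
by apply: (bndD oOm (@subset_refl _ Om)); [exact: sF|exact: sG|exact: bF|exact: bG].
Qed.

Lemma famM F G : fam F -> fam G -> fam (fun u x => F u x * G u x).
Proof.
move=> [sF [M M0 bF]] [sG [N N0 bG]]; split=> [u Ku|].
  exact: (smoothM oOm (sF u Ku) (sG u Ku)).
exists (2 ^+ m * (M * N)) => [|u Ku]; first by rewrite !mulr_ge0// exprn_ge0.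
by apply: (bndM oOm (@subset_refl _ Om)) => //; [exact: sF|exact: sG|exact: bF|exact: bG].
Qed.

Lemma famZ c F : fam F -> fam (fun u x => c * F u x).
Proof. by move=> fF; apply: famM => //; exact: famC. Qed.

Lemma fam_comp phi F : jet m phi -> fam F -> fam (fun u x => phi 0 (F u x)).
Proof.
move=> jphi [sF [M M0 bF]]; split=> [u Ku|].
  exact: (smooth_comp oOm jphi (sF u Ku)).
have [C C0 HC] := bnd_comp oOm m M0.
have [N N0 HN] := jet_bounded M jphi.
exists (C * N) => [|u Ku]; first exact: mulr_ge0.
by apply: HC => //; [exact: sF|exact: bF].
Qed.

Lemma fam_smooth F u : fam F -> K u -> smooth Om m (F u).
Proof. by case=> sF _; exact: sF. Qed.

Lemma close_trans e e' F G H : fam F -> fam G -> fam H ->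
  close e F G -> close e' G H -> close (e + e') F H.
Proof.
move=> fF fG fH FG GH u Ku.
have := bndD oOm (@subset_refl _ Om) (smoothB oOm (fam_smooth fF Ku) (fam_smooth fG Ku))
  (smoothB oOm (fam_smooth fG Ku) (fam_smooth fH Ku)) (FG u Ku) (GH u Ku).
by apply: (bnd_eq oOm (@subset_refl _ Om)) => x _; rewrite addrA subrK.
Qed.

Lemma closeD e e' F F' G G' : fam F -> fam F' -> fam G -> fam G' ->
  close e F G -> close e' F' G' ->
  close (e + e') (fun u x => F u x + F' u x) (fun u x => G u x + G' u x).
Proof.
move=> fF fF' fG fG' FG FG' u Ku.
have := bndD oOm (@subset_refl _ Om) (smoothB oOm (fam_smooth fF Ku) (fam_smooth fG Ku))
  (smoothB oOm (fam_smooth fF' Ku) (fam_smooth fG' Ku)) (FG u Ku) (FG' u Ku).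
by apply: (bnd_eq oOm (@subset_refl _ Om)) => x _; rewrite opprD addrACA.
Qed.

Lemma closeZ e c F G : fam F -> fam G -> close e F G ->
  close (`|c| * e) (fun u x => c * F u x) (fun u x => c * G u x).
Proof.
move=> fF fG FG u Ku.
have := bndZ oOm c (@subset_refl _ Om) (smoothB oOm (fam_smooth fF Ku) (fam_smooth fG Ku)) (FG u Ku).
by apply: (bnd_eq oOm (@subset_refl _ Om)) => x _; rewrite mulrBr.
Qed.

Lemma close_eq e F F' G G' : (forall u x, K u -> Om x -> F u x = F' u x) ->
  (forall u x, K u -> Om x -> G u x = G' u x) -> close e F G -> close e F' G'.
Proof.
by move=> FF GG FG u Ku; apply: (bnd_eq oOm (@subset_refl _ Om) _ (FG u Ku)) => x Ox; rewrite FF// GG.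
Qed.

Lemma close_refl e F : 0 <= e -> close e F F.
Proof.
move=> e0 u Ku; apply: (bnd_eq oOm (@subset_refl _ Om) _ (@bndC _ _ Om 1 m e 0 _ _)) => //.
  by move=> x _; rewrite subrr.
by rewrite normr0.
Qed.

Lemma fam_eq F F' : (forall u x, K u -> Om x -> F u x = F' u x) -> fam F -> fam F'.
Proof.
move=> FF [sF [M M0 bF]]; split=> [u Ku|].
  by apply: smooth_eq (sF u Ku) => // x Ox; exact: FF.
by exists M => // u Ku; apply: (bnd_eq oOm (@subset_refl _ Om) _ (bF u Ku)) => x Ox; exact: FF.
Qed.

Lemma sub_clos S : S `<=` fam -> S `<=` clos S.
Proof.
move=> Sf F SF; split; first exact: Sf.
by move=> e e0; exists F => //; exact/close_refl/ltW.
Qed.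

Lemma clos_idem S : S `<=` fam -> clos (clos S) `<=` clos S.
Proof.
move=> Sf F [fF FS]; split=> // e e0.
have e20 : 0 < e / 2 by rewrite divr_gt0.
have [G [fG GS] FG] := FS _ e20; have [H SH GH] := GS _ e20.
exists H => //; rewrite (splitr e); apply: (close_trans _ fG) => //.
exact: Sf.
Qed.

Lemma clos_linear S : linear_fam S -> linear_fam (clos S).
Proof.
move=> lS; have Sf := lin_fam lS; split.
- by move=> F [].
- by move=> c; apply: sub_clos => //; exact: lin_cst.
- move=> F G [fF FS] [fG GS]; split; first exact: famD.
  move=> e e0; have e20 : 0 < e / 2 by rewrite divr_gt0.
  have [F' SF' FF] := FS _ e20; have [G' SG' GG] := GS _ e20.
  exists (fun u x => F' u x + G' u x); first exact: lin_add.
  by rewrite (splitr e); apply: closeD => //; exact: Sf.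
- move=> c F [fF FS]; split; first exact: famZ.
  move=> e e0; have c0 : 0 < `|c| + 1 by rewrite ltr_wpDl.
  have [F' SF' FF] := FS (e / (`|c| + 1)) (divr_gt0 e0 c0).
  exists (fun u x => c * F' u x); first exact: lin_scale.
  have := closeZ c fF (Sf _ SF') FF.
  move=> H u Ku; apply: bnd_mono (H u Ku) => //.
  by rewrite mulrCA ler_piMr ?(ltW e0)// ler_pdivrMr// mul1r lerDl.
Qed.

Lemma lin_sum S (I : Type) (s : seq I) (F : I -> U -> 'rV[R]_d -> R) :
  linear_fam S -> (forall i, S (F i)) -> S (fun u x => \sum_(i <- s) F i u x).
Proof.
move=> lS SF; elim: s => [|i s IH].
  have -> : (fun u x => \sum_(i <- [::]) F i u x) = (fun _ _ => 0).
    by apply/funext => u; apply/funext => x; rewrite big_nil.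
  exact: lin_cst.
have -> : (fun u x => \sum_(j <- i :: s) F j u x) =
    (fun u x => F i u x + \sum_(j <- s) F j u x).
  by apply/funext => u; apply/funext => x; rewrite big_cons.
exact: lin_add.
Qed.

(** Multiplication is continuous for the C^m norm, so the closure inherits
    stability under products. *)
Lemma clos_algebra S : linear_fam S ->
  (forall F G, S F -> S G -> S (fun u x => F u x * G u x)) ->
  closed_algebra (clos S).
Proof.
move=> lS mS; have Sf := lin_fam lS; split.
- exact: clos_linear.
- move=> F G [fF FS] [fG GS]; split; first exact: famM.
  move=> e e0.
  have [sF [M M0 bF]] := fF; have [sG [N N0 bG]] := fG.
  pose c : R := 2 ^+ m * (M + N + 1).
  have c0 : 0 < c by rewrite mulr_gt0// ?exprn_gt0// ltr_wpDl// addr_ge0.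
  pose e1 := Num.min 1 (e / c).
  have e10 : 0 < e1 by rewrite lt_min ltr01 divr_gt0.
  have [F' SF' FF] := FS _ e10; have [G' SG' GG] := GS _ e10.
  exists (fun u x => F' u x * G' u x); first exact: mS.
  move=> u Ku.
  have sFu := sF u Ku; have sGu := sG u Ku.
  have sF' := (Sf _ SF').1 u Ku; have sG' := (Sf _ SG').1 u Ku.
  have TO := @subset_refl _ Om.
  (* [F G - F' G' = F' (G - G') + (F - F') G], and [F'] is bounded by
     [M + e1]. *)
  have bF' : bnd Om 1 m (M + e1) (F' u).
    apply: (bnd_eq oOm TO _ (bndB oOm TO sFu (smoothB oOm sFu sF') (bF u Ku) (FF u Ku))).
    by move=> x _; rewrite subKr.
  have b1 := bndM oOm TO ler01 (addr_ge0 M0 (ltW e10)) (ltW e10) sF' (smoothB oOm sGu sG') bF' (GG u Ku).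
  have b2 := bndM oOm TO ler01 (ltW e10) N0 (smoothB oOm sFu sF') sGu (FF u Ku) (bG u Ku).
  have b3 := bndD oOm TO (smoothM oOm sF' (smoothB oOm sGu sG')) (smoothM oOm (smoothB oOm sFu sF') sGu) b1 b2.
  apply: (bnd_mono (e := 2 ^+ m * ((M + e1) * e1) + 2 ^+ m * (e1 * N))) => //.
    apply: (@le_trans _ _ (c * e1)).
      rewrite /c -mulrDr -mulrA ler_wpM2l ?exprn_ge0//.
      rewrite [e1 * N]mulrC -mulrDl ler_wpM2r ?(ltW e10)//.
      by rewrite addrAC lerD2l ge_min lexx.
    by rewrite mulrC -ler_pdivlMr// ge_min lexx orbT.
  by apply: (bnd_eq oOm TO _ b3) => x _; ring.
- exact: clos_idem.
Qed.

End Families.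

(** * The Stone-Weierstrass theorem *)

Section Stone.
Variables (R : realType) (X : topologicalType) (K : set X).
Hypothesis cK : compact K.
Implicit Types f g h : X -> R.

Record subalgebra (A : set (X -> R)) := Subalgebra {
  sub_cont : forall f, A f -> {within K, continuous f};
  sub_cst : forall c, A (fun=> c);
  sub_add : forall f g, A f -> A g -> A (fun x => f x + g x);
  sub_mul : forall f g, A f -> A g -> A (fun x => f x * g x) }.

Definition uclos (A : set (X -> R)) : set (X -> R) := [set f |
  {within K, continuous f} /\
  forall e, 0 < e -> exists2 g, A g & forall x, K x -> `|f x - g x| <= e].
Variable A : set (X -> R).
Hypothesis sA : subalgebra A.

Lemma cont_bounded f : {within K, continuous f} ->
  exists2 M, 0 < M & forall x, K x -> `|f x| <= M.
Proof.
move=> cf; have [M M0 fM] := compact_norm_ub (continuous_compact cf cK).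
exists (M + 1) => [|x Kx]; first by rewrite ltr_wpDl.
by rewrite (le_trans (fM _ _)) ?lerDl//; exists x.
Qed.

Lemma uclos_sub : A `<=` uclos A.
Proof.
move=> f Af; split; first exact: sub_cont sA _ Af.
by move=> e e0; exists f => // x _; rewrite subrr normr0 ltW.
Qed.

Lemma uclos_algebra : subalgebra (uclos A).
Proof.
split.
- by move=> f [].
- by move=> c; apply: uclos_sub; exact: sub_cst.
- move=> f g [cf fA] [cg gA]; split.
    by move=> x; exact: (cvgD (cf x) (cg x)).
  move=> e e0; have e20 : 0 < e / 2 by rewrite divr_gt0.
  have [f' Af ff] := fA _ e20; have [g' Ag gg] := gA _ e20.
  exists (fun x => f' x + g' x); first exact: sub_add.
  move=> x Kx; rewrite opprD addrACA (le_trans (ler_normD _ _))// [leRHS]splitr.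
  by rewrite lerD ?ff ?gg.
- move=> f g [cf fA] [cg gA]; split.
    by move=> x; exact: (cvgM (cf x) (cg x)).
  move=> e e0; have [M M0 fM] := cont_bounded cf; have [N N0 gN] := cont_bounded cg.
  have c0 : 0 < M + N + 1 by rewrite !addr_gt0.
  pose e1 := Num.min 1 (e / (M + N + 1)).
  have e10 : 0 < e1 by rewrite lt_min ltr01 divr_gt0.
  have [f' Af ff] := fA _ e10; have [g' Ag gg] := gA _ e10.
  exists (fun x => f' x * g' x); first exact: sub_mul.
  move=> x Kx; have -> : f x * g x - f' x * g' x =
      f x * (g x - g' x) + (f x - f' x) * (g x - (g x - g' x)) by ring.
  have e1e : e1 * (M + N + 1) <= e by rewrite -ler_pdivlMr// ge_min lexx orbT.
  have e11 : e1 <= 1 by rewrite ge_min lexx.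
  apply: (le_trans _ e1e); rewrite (le_trans (ler_normD _ _))// !normrM.
  apply: (@le_trans _ _ (M * e1 + e1 * (N + e1))).
    rewrite lerD// ler_pM//; [exact: fM|exact: gg|exact: ff|].
    by rewrite (le_trans (ler_normB _ _))// lerD//; [exact: gN|exact: gg].
  by rewrite [M * e1]mulrC -mulrDr ler_wpM2l ?(ltW e10)// addrA lerD2l.
Qed.

Lemma uclos_idem f : {within K, continuous f} ->
  (forall e, 0 < e -> exists2 g, uclos A g & forall x, K x -> `|f x - g x| <= e) ->
  uclos A f.
Proof.
move=> cf fA; split=> // e e0; have e20 : 0 < e / 2 by rewrite divr_gt0.
have [g [cg gA] fg] := fA _ e20; have [h Ah gh] := gA _ e20.
exists h => // x Kx; rewrite -(subrKA (g x)) (le_trans (ler_normD _ _))//.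
by rewrite [leRHS]splitr lerD ?fg ?gh.
Qed.

(** Picard iteration for the square root of [t ^+ 2]: these polynomials in
    [t ^+ 2] increase to [`|t|] when [`|t| <= 1]. *)
Fixpoint absq n (t : R) : R :=
  if n is n'.+1 then absq n' t + (t ^+ 2 - absq n' t ^+ 2) / 2 else 0.

(** With [e] the current error and [s = `|t|], one step gives
    [e - e * (2 * s - e) / 2]. As [e <= s], this is at most [e - e ^+ 2 / 2],
    a decreasing recursion that is dominated by [2 / n.+2]. *)
Lemma absq_bound n t : `|t| <= 1 -> 0 <= `|t| - absq n t <= 2 / n.+2%:R /\ 0 <= absq n t.
Proof.
move=> t1; elim: n => [|n [/andP[IH0 IH1] IH2]] /=.
  by rewrite subr0 normr_ge0 divff ?pnatr_eq0.
set a := absq n t in IH0 IH1 IH2 *; rewrite -(real_normK (num_real t)).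
set s := `|t| in t1 IH0 IH1 *.
have s0 : 0 <= s by exact: normr_ge0.
have n2 : 0 < n.+2%:R :> R by rewrite ltr0n.
have n3 : 0 < n.+3%:R :> R by rewrite ltr0n.
split; last by nra.
apply/andP; split; first by nra.
set e := s - a in IH0 IH1.
have -> : s - (a + (s ^+ 2 - a ^+ 2) / 2) = e - e * (2 * s - e) / 2 by rewrite /e; field.
set b := 2 / n.+2%:R in IH1.
have b1 : b <= 1 by rewrite /b ler_pdivrMr// mul1r ler_nat.
have : e - e * (2 * s - e) / 2 <= b - b ^+ 2 / 2.
  have es : e <= s by rewrite /e lerBlDr lerDl.
  have : 0 <= (b - e) * (1 - (b + e) / 2) by apply: mulr_ge0; lra.
  have : 0 <= e * (s - e) by apply: mulr_ge0; lra.
  nra.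
move/le_trans; apply; rewrite /b ler_pdivlMr//.
have -> : n.+3%:R = n.+2%:R + 1 :> R by rewrite -[in LHS]addn1 natrD.
set p := n.+2%:R; have -> : (2 / p - (2 / p) ^+ 2 / 2) * (p + 1) = 2 - 2 / p ^+ 2.
  by field; rewrite gt_eqF.
by rewrite gerBl divr_ge0// exprn_ge0// ltW.
Qed.

Lemma uclos_scale c f : uclos A f -> uclos A (fun x => c * f x).
Proof. by move=> Af; apply: (sub_mul uclos_algebra) => //; apply: (sub_cst uclos_algebra). Qed.

(** Absolute values are uniform limits of polynomials, which makes the closure
    a lattice. *)
Lemma uclos_abs f : uclos A f -> uclos A (fun x => `|f x|).
Proof.
move=> Af; have [cf _] := Af; apply: uclos_idem.
  by move=> x; exact: (cvg_norm (cf x)).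
move=> e e0; have [M M0 fM] := cont_bounded cf.
have [n en] : exists n, M * (2 / n.+2%:R) <= e.
  exists (Num.truncn (M * 2 / e)); rewrite mulrA ler_pdivrMr ?ltr0n// [e * _]mulrC.
  rewrite -ler_pdivrMr// (le_trans (ltW (truncnS_gt _)))// ler_nat.
  exact: leqnSn.
exists (fun x => M * absq n (M^-1 * f x)).
  apply: uclos_scale; elim: n {en} => [|n IH] /=; first exact: (sub_cst uclos_algebra).
  have sq g : uclos A g -> uclos A (fun x => g x ^+ 2).
    by move=> Ag; apply: (sub_mul uclos_algebra Ag Ag).
  have Af' := uclos_scale M^-1 Af.
  apply: (sub_add uclos_algebra IH).
  have -> : (fun x => ((M^-1 * f x) ^+ 2 - absq n (M^-1 * f x) ^+ 2) / 2) =
     (fun x => 2^-1 * ((M^-1 * f x) ^+ 2 + (-1) * absq n (M^-1 * f x) ^+ 2)).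
    by apply/funext => x; rewrite mulN1r mulrC.
  apply: uclos_scale; apply: (sub_add uclos_algebra); first exact: (sq _ Af').
  by apply: uclos_scale; exact: (sq _ IH).
move=> x Kx; have fx1 : `|M^-1 * f x| <= 1.
  by rewrite normrM gtr0_norm ?invr_gt0// ler_pdivrMl// mulr1 fM.
have [/andP[h0 h1] _] := absq_bound n fx1.
have -> : `|f x| = M * `|M^-1 * f x|.
  by rewrite normrM gtr0_norm ?invr_gt0// mulVKf// gt_eqF.
rewrite -mulrBr normrM gtr0_norm// ger0_norm//.
by apply: le_trans en; rewrite ler_pM2l.
Qed.

Lemma uclos_max f g : uclos A f -> uclos A g -> uclos A (fun x => Num.max (f x) (g x)).
Proof.
move=> Af Ag.
have -> : (fun x => Num.max (f x) (g x)) =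
    (fun x => 2^-1 * (f x + g x + `|f x + -1 * g x|)).
  by apply/funext => x; rewrite mulN1r maxr_absE mulrC.
apply: uclos_scale; apply: (sub_add uclos_algebra); first exact: (sub_add uclos_algebra).
by apply: uclos_abs; apply: (sub_add uclos_algebra) => //; exact: uclos_scale.
Qed.

Lemma uclos_min f g : uclos A f -> uclos A g -> uclos A (fun x => Num.min (f x) (g x)).
Proof.
move=> Af Ag.
have -> : (fun x => Num.min (f x) (g x)) =
    (fun x => 2^-1 * (f x + g x + -1 * `|f x + -1 * g x|)).
  by apply/funext => x; rewrite !mulN1r minr_absE mulrC.
apply: uclos_scale; apply: (sub_add uclos_algebra); first exact: (sub_add uclos_algebra).
by apply: uclos_scale; apply: uclos_abs; apply: (sub_add uclos_algebra) => //; exact: uclos_scale.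
Qed.

(** Two values can be interpolated by an element of [A]. A maximum of finitely
    many interpolants exceeds [f - e] on [K] while agreeing with [f] at a
    given point; a minimum of finitely many such maxima is also below
    [f + e]. *)
Theorem stone_weierstrass f :
  (forall x y, K x -> K y -> x <> y -> exists2 g, A g & g x <> g y) ->
  {within K, continuous f} ->
  forall e, 0 < e -> exists2 g, A g & forall x, K x -> `|f x - g x| <= e.
Proof.
move=> sep cf; suff : uclos A f by case.
have inter x y : K x -> K y -> exists g, [/\ uclos A g, g x = f x & g y = f y].
  move=> Kx Ky; have [->|xy] := pselect (x = y).
    by exists (fun=> f y); split=> //; exact: (sub_cst uclos_algebra).
  have [g Ag /eqP gxy] := sep _ _ Kx Ky xy.
  pose c := (f x - f y) / (g x - g y).
  exists (fun z => c * g z + (f y - c * g y)); split.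
  - apply: (sub_add uclos_algebra); last exact: (sub_cst uclos_algebra).
    by apply: uclos_scale; exact: uclos_sub.
  - rewrite addrCA -mulrBr /c divfK ?subr_eq0//; ring.
  - by rewrite addrCA subrr addr0.
have nbh (g : X -> R) y : uclos A g -> K y -> forall c, g y < f y + c ->
    \forall z \near y, K z -> g z < f z + c.
  move=> [cg _] Ky c gfc.
  have /subspace_continuousP/(_ y Ky) h :
    {within K, continuous (f - g)} by move=> z; exact: (cvgB (cf z) (cg z)).
  have : \forall z \near within K (nbhs y), - c < (f - g) z.
    by apply: (cvgr_gt _ h); rewrite -[ltRHS]/(f y - g y); lra.
  rewrite near_withinE; apply: filterS => z H Kz; have := H Kz.
  by rewrite -[X in _ < X -> _]/(f z - g z); lra.
have nbh' (g : X -> R) y : uclos A g -> K y -> forall c, f y - c < g y ->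
    \forall z \near y, K z -> f z - c < g z.
  move=> [cg _] Ky c gfc.
  have /subspace_continuousP/(_ y Ky) h :
    {within K, continuous (g - f)} by move=> z; exact: (cvgB (cg z) (cf z)).
  have : \forall z \near within K (nbhs y), - c < (g - f) z.
    by apply: (cvgr_gt _ h); rewrite -[ltRHS]/(g y - f y); lra.
  rewrite near_withinE; apply: filterS => z H Kz; have := H Kz.
  by rewrite -[X in _ < X -> _]/(g z - f z); lra.
apply: uclos_idem => // e e0.
have below x : K x -> exists g, [/\ uclos A g, g x = f x & forall y, K y -> f y - e < g y].
  move=> Kx; pose B := [set g | uclos A g /\ g x = f x].
  (* The filter of the functions that eventually dominate each element of [B]
     turns the covering of [K] into an instance of near covering, in place of
     an explicit finite subcover. *)
  pose F : set_system (X -> R) := filter_from B (fun g0 => [set g | B g /\ forall y, g0 y <= g y]).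
  have FF : Filter F.
    apply: filter_from_filter.
      by have [g [Ag gx _]] := inter x x Kx Kx; exists g.
    move=> g h [Ag gx] [Ah hx]; exists (fun y => Num.max (g y) (h y)).
      by split; [exact: uclos_max|rewrite gx hx maxxx].
    move=> k [Bk gk]; split; split=> // y; rewrite (le_trans _ (gk y))// le_max lexx ?orbT//.
  have /near_covering_withinP : near_covering K by apply/compact_near_coveringP.
  move=> /(_ _ F (fun g y => f y - e < g y) FF) [|g0 Bg0 H].
    move=> y Ky; have [g [Ag gx gy]] := inter x y Kx Ky.
    have hz := nbh' g y Ag Ky e.
    exists ([set z | K z -> f z - e < g z], [set h | B h /\ forall y, g y <= h y]).
      split => /=; first by apply: hz; rewrite gy ltrBlDr ltrDl.
      by exists g.
    move=> [z h] /= [Hz [_ gh]] Kz; exact: lt_le_trans (Hz Kz) (gh z).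
  exists g0; split; [by case: Bg0|by case: Bg0|].
  by move=> y Ky; apply: H.
pose B := [set g | uclos A g /\ forall y, K y -> f y - e < g y].
have [[x0 Kx0]|K0] := pselect (exists x, K x); last first.
  exists (fun=> 0); first exact: (sub_cst uclos_algebra).
  by move=> x Kx; case: K0; exists x.
pose F : set_system (X -> R) := filter_from B (fun g0 => [set g | B g /\ forall y, g y <= g0 y]).
have FF : Filter F.
  apply: filter_from_filter.
    by have [g [Ag _ gx]] := below x0 Kx0; exists g.
  move=> g h [Ag gx] [Ah hx]; exists (fun y => Num.min (g y) (h y)).
    split; first exact: uclos_min.
    by move=> y Ky; rewrite lt_min gx ?hx.
  move=> k [Bk gk]; split; split=> // y; rewrite (le_trans (gk y))// ge_min lexx ?orbT//.
have /near_covering_withinP : near_covering K by apply/compact_near_coveringP.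
move=> /(_ _ F (fun g y => g y < f y + e) FF) [|g0 Bg0 H].
  move=> y Ky; have [g [Ag gy gx]] := below y Ky.
  have hz := nbh g y Ag Ky e.
  exists ([set z | K z -> g z < f z + e], [set h | B h /\ forall y, h y <= g y]).
    split => /=; first by apply: hz; rewrite gy ltrDl.
    by exists g.
  move=> [z h] /= [Hz [_ gh]] Kz; exact: le_lt_trans (gh z) (Hz Kz).
exists g0; first by case: Bg0.
move=> x Kx; have h1 := Bg0.2 x Kx.
have h2 : g0 x < f x + e by apply: H.
by rewrite ler_norml; apply/andP; split; lra.
Qed.

End Stone.

(** * Approximation on a segment and rescaled Taylor remainders *)

Section Univariate.
Variable R : realType.
Implicit Types (p q : {poly R}) (phi : nat -> R -> R).

Lemma jetB m phi psi : jet m phi -> jet m psi -> jet m (fun j t => phi j t - psi j t).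
Proof.
move=> [dphi cphi] [dpsi cpsi]; split=> [j t jm|j jm t].
  by apply: is_deriveB; [exact: dphi|exact: dpsi].
by apply: cvgB; [exact: cphi|exact: cpsi].
Qed.

Lemma jet_poly m p : jet m (fun j t => p^`(j).[t]).
Proof.
split=> [j t _|j _]; last exact: continuous_horner.
by rewrite derivnS; exact: is_derive_poly.
Qed.

Lemma is_derive_mvt (f df : R -> R) M c : (forall t : R, is_derive t (1 : R) f (df t)) ->
  (forall t, `|t| <= M -> `|df t| <= c) ->
  forall t, `|t| <= M -> `|f t - f 0| <= M * c.
Proof.
move=> dfE dfc t tM; have M0 := le_trans (normr_ge0 t) tM.
have c0 : 0 <= c by apply: le_trans (normr_ge0 _) (dfc 0 _); rewrite normr0.
have cf : continuous f.
  by move=> x; apply/differentiable_continuous/derivable1_diffP; case: (dfE x).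
have key a b : a <= b -> `|a| <= M -> `|b| <= M -> `|f b - f a| <= `|b - a| * c.
  move=> ab aM bM.
  have [|y yab ->] := @MVT_segment R f df a b ab (fun x _ => dfE x).
    exact: continuous_subspaceT.
  rewrite normrM mulrC ler_wpM2l// dfc// ler_norml.
  move: yab aM bM; rewrite in_itv/= !ler_norml => /andP[? ?] /andP[? ?] /andP[? ?].
  by apply/andP; split; lra.
have m0 : `|0 : R| <= M by rewrite normr0.
have [t0|t0] := leP 0 t.
  apply: le_trans (key 0 t t0 m0 tM) _.
  by rewrite subr0 ler_wpM2r.
rewrite distrC; apply: le_trans (key t 0 (ltW t0) tM m0) _.
by rewrite sub0r normrN ler_wpM2r.
Qed.

Lemma weierstrass (f : R -> R) M : continuous f ->
  forall e, 0 < e -> exists p, forall t, `|t| <= M -> `|f t - p.[t]| <= e.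
Proof.
move=> cf e e0; pose A := [set g : R -> R | exists p, g = horner p].
have sA : @subalgebra R R `[- M, M] A.
  split.
  - by move=> g [p ->]; apply: continuous_subspaceT; exact: continuous_horner.
  - by move=> c; exists c%:P; apply/funext => x; rewrite hornerC.
  - by move=> g h [p ->] [q ->]; exists (p + q); apply/funext => x; rewrite hornerD.
  - by move=> g h [p ->] [q ->]; exists (p * q); apply/funext => x; rewrite hornerM.
have [|g [p ->] H] := stone_weierstrass (@segment_compact R (- M) M) sA _ (continuous_subspaceT cf) e0.
  by move=> x y _ _ xy; exists (horner 'X); [exists 'X|rewrite !hornerX].
by exists p => t tM; apply: H => /=; rewrite in_itv/= -ler_norml.
Qed.

Lemma primitive_poly q : exists p, p^`() = q.
Proof.
exists (\poly_(i < (size q).+1) (q`_(i.-1) / i%:R)); apply/polyP => i.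
rewrite coef_deriv coef_poly ltnS; case: ltnP => [iq|qi] /=.
  by rewrite -[LHS]mulr_natr divfK// pnatr_eq0.
by rewrite mul0rn nth_default.
Qed.

(** Approximate the last derivative and integrate: on [-M, M] each integration
    multiplies the error by at most [M]. *)
Lemma weierstrass_jet m phi M : jet m phi -> forall e, 0 < e -> exists p,
  forall j t, (j <= m)%N -> `|t| <= M -> `|phi j t - p^`(j).[t]| <= e.
Proof.
elim: m phi => [|m IH] phi jphi e e0.
  have [p Hp] := weierstrass M (jphi.2 0%N (leqnn _)) e0.
  by exists p => j t; rewrite leqn0 => /eqP ->; exact: Hp.
have c0 : 0 < `|M| + 1 by rewrite ltr_wpDl.
(* [e1] is small enough both for the derivative itself and for its integral. *)
pose e1 := Num.min e (e / (`|M| + 1)).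
have e10 : 0 < e1 by rewrite lt_min e0 divr_gt0.
have [q Hq] := IH _ (jet_shift jphi) _ e10.
have [p0 pq] := primitive_poly q.
pose p := p0 + (phi 0 0 - p0.[0])%:P.
have p'q : p^`() = q by rewrite derivD derivC addr0.
have jp := jetB jphi (jet_poly m.+1 p).
exists p => -[|j] t jm tM; last first.
  by rewrite derivSn p'q; apply: le_trans (Hq j t jm tM) _; rewrite ge_min lexx.
have H : forall t : R, is_derive t (1 : R) (fun t => phi 0 t - p^`(0).[t]) (phi 1 t - q.[t]).
  by move=> s; have := jp.1 0%N s isT; rewrite derivn1 p'q.
have /= := @is_derive_mvt _ _ M e1 H (fun s => Hq 0 s isT) t tM.
have -> : phi 0 0 - p.[0] = 0 by rewrite hornerD hornerC; ring.
rewrite subr0 => /le_trans; apply.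
have Me : M * e1 <= (`|M| + 1) * e1.
  by rewrite ler_pM2r// (le_trans (ler_norm M))// lerDl.
by apply: le_trans Me _; rewrite mulrC -ler_pdivlMr// ge_min lexx orbT.
Qed.

Definition smooth_jet phi := forall m, jet m phi.

Lemma smooth_jet_shift phi : smooth_jet phi -> smooth_jet (phi \o succn).
Proof. by move=> s m; exact: jet_shift. Qed.

Definition taylor phi b n : {poly R} := \sum_(i < n) (phi i b / i`!%:R) *: 'X^i.

Lemma deriv_taylor phi b n : (taylor phi b n.+1)^`() = taylor (phi \o succn) b n.
Proof.
rewrite /taylor big_ord_recl derivD /= expr0 alg_polyC derivC add0r linear_sum.
apply: eq_bigr => i _; rewrite /= derivZ derivXn /= /bump leq0n add1n /=.
rewrite add0n -['X^i *+ _]scaler_nat scalerA; congr (_ *: _).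
rewrite factS natrM; field.
by rewrite pnatr_eq0 -lt0n fact_gt0 addrC natr1 pnatr_eq0.
Qed.

(** The function [h^-n (phi (b + h t) - Taylor polynomial of degree n - 1) -
    phi^(n) b / n! * t ^+ n] and its derivatives in [t]. Its derivative is the
    same expression for [phi'] and [n - 1], which is what the recursion
    follows; for [n = 0] it is [phi (b + h t) - phi b]. *)
Fixpoint rescaled phi (b : R) n (h : R) (j : nat) (t : R) : R :=
  match n, j with
  | 0%N, _ => h ^+ j * phi j (b + h * t) - (j == 0%N)%:R * phi 0 b
  | n'.+1, j'.+1 => rescaled (phi \o succn) b n' h j' t
  | n'.+1, 0%N => h ^- n'.+1 * (phi 0 (b + h * t) - (taylor phi b n'.+1).[h * t])
                  - phi n'.+1 b / n'.+1`!%:R * t ^+ n'.+1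
  end.

Lemma is_derive_affine (f : R -> R) (b h t df : R) :
  is_derive (b + h * t) (1 : R) f df ->
  is_derive t (1 : R) (fun t => f (b + h * t)) (h * df).
Proof.
move=> Hf; have H1 : is_derive t (1 : R) (fun t : R => b + h * t) h.
  have H2 := is_deriveD (is_derive_cst b t 1) (is_deriveZ h (is_derive_id t (1 : R))).
  by apply: is_derive_eq H2 _; rewrite add0r [_ *: _]mulr1.
by rewrite mulrC; exact: (@is_derive1_comp _ f (fun t : R => b + h * t) t _ _ Hf H1).
Qed.

Lemma rescaled_derive phi b n h j (t : R) : smooth_jet phi -> h != 0 ->
  is_derive t (1 : R) (rescaled phi b n h j) (rescaled phi b n h j.+1 t).
Proof.
move=> sphi h0; elim: n phi j sphi => [|n IH] phi [|j] sphi //=.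
- have H := is_derive_affine (b := b) ((sphi 1%N).1 0%N (b + h * t) isT).
  have H2 := is_deriveB (is_deriveZ (h ^+ 0) H) (is_derive_cst (1 * phi 0 b) t (1 : R)).
  by apply: is_derive_eq H2 _; rewrite subr0 !mul0r subr0 expr0 expr1 scale1r.
- have H := is_derive_affine (b := b) ((sphi j.+2).1 j.+1 (b + h * t) (ltnSn _)).
  have H2 := is_deriveB (is_deriveZ (h ^+ j.+1) H) (is_derive_cst (0 * phi 0 b) t (1 : R)).
  by apply: is_derive_eq H2 _; rewrite subr0 !mul0r subr0 [in RHS]exprSr -mulrA.
- have H := is_derive_affine (b := b) ((sphi 1%N).1 0%N (b + h * t) isT).
  have H3 : is_derive t (1 : R) (fun t => (taylor phi b n.+1).[h * t])
      (h * (taylor (phi \o succn) b n).[h * t]).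
    have := is_derive_affine (b := 0) (is_derive_poly (taylor phi b n.+1) (0 + h * t)).
    rewrite add0r deriv_taylor.
    by under [X in is_derive _ _ X _ -> _]eq_fun do rewrite add0r.
  have H4 := is_deriveX n.+1 (is_derive_id t (1 : R)).
  have H2 := is_deriveB (is_deriveZ (h ^- n.+1) (is_deriveB H H3))
     (is_deriveZ (phi n.+1 b / n.+1`!%:R) H4).
  have -> : (fun t0 : R => h ^- n.+1 * (phi 0 (b + h * t0) - (taylor phi b n.+1).[h * t0]) -
     phi n.+1 b / (n.+1)`!%:R * t0 ^+ n.+1) = 
   (h ^- n.+1 \*: ((fun t => phi 0 (b + h * t)) - (fun t => (taylor phi b n.+1).[h * t])) -
     (phi n.+1 b / n.+1`!%:R) \*: (id ^+ n.+1)).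
    by apply/funext => s; rewrite !fctE.
  apply: is_derive_eq H2 _.
  rewrite [_ *: (1 : R)]mulr1.
  transitivity (h ^- n.+1 * (h * phi 1%N (b + h * t) - h * (taylor (phi \o succn) b n).[h * t])
     - phi n.+1 b / n.+1`!%:R * (n.+1%:R * t ^+ n)); first by [].
  case: n {IH H3 H4} => [|n] /=.
    rewrite /taylor big_ord0 horner0 expr1 expr0 divr1 !mulr1.
    by rewrite mulr0 subr0 mulKf// !mul1r.
  rewrite [n.+2`!]factS natrM.
  set x := phi 1 _; set y := _.[_]; set z := phi n.+2 b.
  have f0 : n.+1`!%:R != 0 :> R by rewrite pnatr_eq0 -lt0n fact_gt0.
  have n0 : n.+2%:R != 0 :> R by rewrite pnatr_eq0.
  have -> : z / (n.+2%:R * n.+1`!%:R) * (n.+2%:R * t ^+ n.+1) = z / n.+1`!%:R * t ^+ n.+1.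
    by move: n0 f0; move: n.+2%:R n.+1`!%:R => k l ? ?; field; apply/andP.
  by rewrite -mulrBr mulrA; congr (_ * _ - _); rewrite exprS invfM mulrAC mulVf// mul1r.
- exact: IH (smooth_jet_shift sphi).
Qed.

End Univariate.

(** * Powers as limits of networks *)

Section Nets.
Variable R : realType.
Implicit Types (p q : {poly R}) (phi : nat -> R -> R).

Lemma rescaled0 phi b n h : rescaled phi b n h 0 0 = 0.
Proof.
case: n => [|n] /=; first by rewrite mulr0 addr0 expr0 subrr.
rewrite !mulr0 addr0 expr0n mulr0 subr0 /taylor big_ord_recl hornerD hornerZ.
rewrite expr0 hornerC mulr1 divr1 horner_sum big1 ?addr0 ?subrr ?mulr0//.
by move=> i _; rewrite hornerZ hornerXn expr0n mulr0.
Qed.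

(** By induction on [n]: the function vanishes at 0 and its derivative is the
    remainder of order [n - 1] of [phi'], so the mean value theorem applies. *)
Lemma rescaled_small phi b n m M e : smooth_jet phi -> 0 <= M -> 0 < e ->
  exists2 delta, 0 < delta & forall h, 0 < h -> h <= delta ->
    forall j t, (j <= m)%N -> `|t| <= M -> `|rescaled phi b n h j t| <= e.
Proof.
move=> sphi M0; elim: n phi m e sphi => [|n IH] phi m e sphi e0.
  have [C C0 HC] := jet_bounded (`|b| + M) (sphi m.+1).
  have c0 : 0 < (M + 1) * C + 1 by rewrite ltr_wpDl// mulr_ge0// addr_ge0.
  exists (Num.min 1 (e / ((M + 1) * C + 1))); first by rewrite lt_min ltr01 divr_gt0.
  move=> h h0; rewrite le_min => /andP[h1]; rewrite ler_pdivlMr// => he.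
  have argM t : `|t| <= M -> `|b + h * t| <= `|b| + M.
    move=> tM; rewrite (le_trans (ler_normD _ _))// lerD2l normrM gtr0_norm//.
    by rewrite (le_trans _ tM)// ler_piMl.
  have HCh : h * C <= e by nra.
  have HCM : M * (h * C) <= e by nra.
  move=> [|j] t jm tM.
    have := is_derive_mvt (fun t => rescaled_derive b 0 0 t sphi (lt0r_neq0 h0)) _ tM.
    rewrite rescaled0 subr0 => /(_ (h * C)); move=> H; apply: le_trans HCM; apply: H.
    move=> s sM /=; rewrite expr1 mul0r subr0 normrM gtr0_norm// ler_pM2l//.
    by apply: HC => //; exact: argM.
  rewrite /= mul0r subr0 normrM normrX gtr0_norm//; apply: le_trans HCh.
  apply: ler_pM => //; first exact/exprn_ge0/ltW.
    by rewrite exprS ler_piMr ?exprn_ile1// ltW.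
  by apply: HC; [exact: ltnW|exact: argM].
have e1 : 0 < e / (M + 1) by rewrite divr_gt0// ltr_wpDl.
have [delta d0 H] := IH _ m _ (smooth_jet_shift sphi) e1.
exists delta => // h h0 hd [|j] t jm tM; last first.
  apply: le_trans (H h h0 hd j t (ltnW jm) tM) _.
  by rewrite ler_pdivrMr ?ltr_wpDl// ler_peMr ?(ltW e0)// lerDr.
have := is_derive_mvt (fun t => rescaled_derive b n.+1 0 t sphi (lt0r_neq0 h0)) (c := e / (M + 1)) _ tM.
rewrite rescaled0 subr0 => /(_ _)/le_trans; apply.
  by move=> s sM; exact: (H h h0 hd 0%N s isT sM).
by rewrite mulrCA ler_piMr ?(ltW e0)// ler_pdivrMr ?ltr_wpDl// mul1r lerDl.
Qed.

Lemma jet_rescaled phi b n h m : smooth_jet phi -> h != 0 -> jet m (rescaled phi b n h).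
Proof.
move=> sphi h0; split=> [j t _|j _ t]; first exact: rescaled_derive.
apply/differentiable_continuous/derivable1_diffP.
by case: (rescaled_derive b n j t sphi h0).
Qed.

Variables (d : nat) (Om : set 'rV[R]_d).
Hypothesis oOm : open Om.
Variables (m : nat) (U : Type) (K : set U).
Implicit Types (F G w : U -> 'rV[R]_d -> R) (S N A V : set (U -> 'rV[R]_d -> R)).
Local Notation fam := (fam Om m K).
Local Notation close := (close Om m K).
Local Notation clos := (clos Om m K).
Local Notation linear_fam := (linear_fam Om m K).
Local Notation closed_algebra := (closed_algebra Om m K).

Lemma lin_eq N F G : N F -> (forall u x, F u x = G u x) -> N G.
Proof. by move=> NF FG; suff <- : F = G by []; apply/funext => u; apply/funext => x. Qed.

Lemma lin_poly N w p : linear_fam N -> (forall i, (i < size p)%N -> N (fun u x => w u x ^+ i)) ->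
  N (fun u x => p.[w u x]).
Proof.
move=> lN Np.
have : N (fun u x => \sum_(i < size p) p`_i * w u x ^+ i).
  apply: (lin_sum _ lN) => i; apply: (lin_scale lN); exact: Np.
by move/lin_eq; apply => u x; rewrite horner_coef.
Qed.

Lemma close_comp w M : 0 <= M -> fam w -> (forall u, K u -> bnd Om 1 m M (w u)) ->
  forall e, 0 < e -> exists2 c, 0 < c & forall phi psi, jet m phi -> jet m psi ->
    (forall j t, (j <= m)%N -> `|t| <= M -> `|phi j t - psi j t| <= c) ->
    close e (fun u x => phi 0%N (w u x)) (fun u x => psi 0%N (w u x)).
Proof.
move=> M0 fw bw e e0; have [C C0 HC] := bnd_comp oOm m M0.
exists (e / (C + 1)) => [|f g jf jg fg u Ku]; first by rewrite divr_gt0// ltr_wpDl.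
have c0 : 0 <= e / (C + 1) by rewrite divr_ge0 ?(ltW e0)// addr_ge0.
have := HC _ _ _ (w u) (@subset_refl _ Om) (jetB jf jg) c0 fg (fw.1 u Ku) (bw u Ku).
apply: bnd_mono => //.
by rewrite mulrCA ler_piMr ?(ltW e0)// ler_pdivrMr ?ltr_wpDl// mul1r lerDl.
Qed.

(** On the bounded range of [w], a C^m function is a limit in C^m of
    polynomials. *)
Lemma lin_comp N w phi : linear_fam N -> clos N `<=` N -> fam w ->
  (forall n, N (fun u x => w u x ^+ n)) -> jet m phi -> N (fun u x => phi 0%N (w u x)).
Proof.
move=> lN cN fw Nw jphi; apply: cN; split; first exact: (fam_comp oOm jphi fw).
have [_ [M M0 bw]] := fw; move=> e e0.
have [c c0 Hc] := close_comp M0 fw bw e0.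
have [p Hp] := weierstrass_jet M jphi c0.
exists (fun u x => p.[w u x]); first by apply: (lin_poly lN) => i _.
exact: (Hc _ _ jphi (jet_poly m p) Hp).
Qed.

(** [h^-n (phi (b + h w) - Taylor polynomial of degree n - 1)] converges to
    [phi^(n) b / n! * w ^+ n] in C^m, and the Taylor polynomial only involves
    lower powers of [w]. The point [b] is chosen anew for each [n]. *)
Lemma pow_net N w phi : linear_fam N -> clos N `<=` N -> fam w ->
  smooth_jet phi -> (forall h b, N (fun u x => phi 0%N (b + h * w u x))) ->
  (forall n, exists b, phi n b != 0) -> forall n, N (fun u x => w u x ^+ n).
Proof.
move=> lN cN fw sphi Nphi nz n.
have [_ [M M0 bw]] := fw.
elim/ltn_ind: n => n IH; have [b phib] := nz n.
pose a := phi n b / n`!%:R.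
have a0 : a != 0 by rewrite mulf_neq0// invr_neq0// pnatr_eq0 -lt0n fact_gt0.
have fpow i : fam (fun u x => w u x ^+ i).
  have := fam_comp oOm (jet_poly m ('X^i : {poly R})) fw.
  by apply: fam_eq => // u x _ _; rewrite derivn0 hornerXn.
suff : N (fun u x => a * w u x ^+ n).
  move=> H; have := lin_scale lN a^-1 H.
  by move/lin_eq; apply => u x; rewrite mulKf.
apply: cN; split; first exact: famZ.
move=> e e0.
have [c c0 Hc] := close_comp M0 fw bw e0.
have [delta d0 Hd] := rescaled_small b n m sphi M0 c0.
pose r := rescaled phi b n delta.
have jr : jet m r by apply: jet_rescaled; rewrite ?gt_eqF.
have jap : jet m (fun j t => (a *: 'X^n)^`(j).[t]) by exact: jet_poly.
have japr : jet m (fun j t => (a *: 'X^n)^`(j).[t] - (- r j t)).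
  have j0 := jetB (jet_poly m (0 : {poly R})) jr.
  have -> : (fun j t => (a *: 'X^n)^`(j).[t] - (- r j t)) =
     (fun j t => (a *: 'X^n)^`(j).[t] - ((0 : {poly R})^`(j).[t] - r j t)).
    by apply/funext => j; apply/funext => t; rewrite linear0 horner0 sub0r.
  exact: jetB.
exists (fun u x => a * w u x ^+ n + r 0%N (w u x)); last first.
  apply: (close_eq oOm _ _ (Hc _ _ jap japr _)).
  - by move=> u x _ _; rewrite derivn0 hornerZ hornerXn.
  - by move=> u x _ _; rewrite derivn0 hornerZ hornerXn opprK.
  - move=> j t jm tM; have -> : (a *: 'X^n)^`(j).[t] - ((a *: 'X^n)^`(j).[t] - - r j t) = - r j t by ring.
    by rewrite normrN; exact: Hd.
(* Unfolding the rescaled remainder shows that this is a combination of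
   [phi 0 (b + delta w)] and of powers of [w] of degree less than [n]. *)
rewrite /r; case: n IH {phib r jr jap japr Hd} @a a0 fpow => [|n] IH a a0 fpow.
  have := lin_add lN (Nphi delta b) (lin_cst lN (a - phi 0%N b)).
  move/lin_eq; apply => u x /=; rewrite expr0 mul1r mul1r mulr1; ring.
have H1 : N (fun u x => (taylor phi b n.+1 \Po (delta *: 'X)).[w u x]).
  apply: lin_poly => // i; rewrite size_comp_poly2 ?size_scale ?size_polyX ?gt_eqF// => Hi.
  apply: IH; apply: leq_trans Hi _; rewrite /taylor.
  apply: (leq_trans (size_sum _ _ _)); apply/bigmax_leqP => k _.
  by apply: (leq_trans (size_scale_leq _ _)); rewrite size_polyXn.
have := lin_scale lN (delta ^- n.+1) (lin_add lN (Nphi delta b) (lin_scale lN (-1) H1)).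
move/lin_eq; apply => u x /=.
by rewrite horner_comp hornerZ hornerX mulN1r [RHS]addrC /a subrK.
Qed.

End Nets.

(** * The closed algebra generated by the preactivations *)

Section Activation.
Variable R : realType.

Lemma jet_vanish_poly (phi : nat -> R -> R) n : smooth_jet phi -> (forall b, phi n b = 0) ->
  exists p : {poly R}, forall x, phi 0%N x = p.[x].
Proof.
elim: n phi => [|n IH] phi sphi phi0; first by exists 0 => x; rewrite horner0.
have [q Hq] := IH _ (smooth_jet_shift sphi) phi0.
have [p pq] := primitive_poly q.
exists (p + (phi 0%N 0 - p.[0])%:P) => x; rewrite hornerD hornerC.
have H : forall y : R, is_derive y (1 : R) (phi 0%N - horner p) 0.
  move=> y; have H := is_deriveB ((sphi 1%N).1 0%N y isT) (is_derive_poly p y).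
  by apply: is_derive_eq H _; rewrite pq -Hq subrr.
have E : phi 0%N x - p.[x] = phi 0%N 0 - p.[0] := is_derive_0_is_cst x 0 H.
by rewrite -[LHS](subrK p.[x]) E addrC.
Qed.

(** If some derivative of sigma vanished identically, sigma would be a
    polynomial. *)
Lemma activation_jet s (sigma : R -> R) : activation_assumption s sigma ->
  smooth_jet (fun n => (sigma^`(n))%classic) /\
  forall n, exists b, (sigma^`(n))%classic b != 0.
Proof.
move=> [sm np _ _].
have sj : smooth_jet (fun n => (sigma^`(n))%classic).
  move=> m; split=> [j t _|j _ x].
    by rewrite derive1nS derive1E; exact/derivableP.
  exact/differentiable_continuous/derivable1_diffP.
split=> // n; apply: contrapT => nb; apply: np.
apply: (jet_vanish_poly (n := n) sj) => b.
by apply: contrapT => /eqP nz; apply: nb; exists b.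
Qed.

Lemma jet_exp : smooth_jet (fun _ => @expR R).
Proof.
move=> m; split=> [j t _|j _]; last exact: continuous_expR.
exact: is_derive_expR.
Qed.

End Activation.

Section SigmaSpan.
Variables (R : realType) (A B : Type).
Implicit Types (F G w : A -> B -> R) (V : set (A -> B -> R)).

(** Scalar networks with one hidden layer and activation [f], whose
    preactivations are taken in [V] instead of the affine functions of the
    input. *)
Inductive sspan (f : R -> R) V : (A -> B -> R) -> Prop :=
| SpanC c : sspan f V (fun _ _ => c)
| SpanS c w F : V w -> sspan f V F -> sspan f V (fun u x => c * f (w u x) + F u x).

Lemma sspan_eq f V F G : (forall u x, F u x = G u x) -> sspan f V F -> sspan f V G.
Proof. by move=> FG; suff <- : F = G by []; apply/funext => u; apply/funext => x. Qed.

Lemma sspanD f V F G : sspan f V F -> sspan f V G -> sspan f V (fun u x => F u x + G u x).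
Proof.
move=> sF sG; elim: sF => [c|c w F' Vw _ IH].
  elim: sG => [c'|c' w G' Vw _ IH]; first exact: SpanC.
  apply: sspan_eq (SpanS c' Vw IH) => u x; exact: addrCA.
by apply: sspan_eq (SpanS c Vw IH) => u x; rewrite addrA.
Qed.

Lemma sspanZ f V a F : sspan f V F -> sspan f V (fun u x => a * F u x).
Proof.
elim=> [c|c w F' Vw _ IH]; first exact: SpanC.
by apply: sspan_eq (SpanS (a * c) Vw IH) => u x; rewrite mulrDr mulrA.
Qed.

Lemma sspan1 f V w : V w -> sspan f V (fun u x => f (w u x)).
Proof.
by move=> Vw; apply: sspan_eq (SpanS 1 Vw (SpanC f V 0)) => u x; rewrite mul1r addr0.
Qed.

End SigmaSpan.

Section NetAlgebra.
Variables (R : realType) (d : nat) (Om : set 'rV[R]_d).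
Hypothesis oOm : open Om.
Variables (m : nat) (U : Type) (K : set U).
Implicit Types (F G w : U -> 'rV[R]_d -> R) (S N A V : set (U -> 'rV[R]_d -> R)).
Local Notation fam := (fam Om m K).
Local Notation clos := (clos Om m K).
Local Notation linear_fam := (linear_fam Om m K).
Local Notation closed_algebra := (closed_algebra Om m K).

Lemma sspan_fam (phi : nat -> R -> R) V : jet m phi -> V `<=` fam ->
  sspan (phi 0%N) V `<=` fam.
Proof.
move=> jphi Vf F; elim=> [c|c w G Vw _ IH]; first exact: famC.
apply: famD => //; apply: famZ => //; apply: (fam_comp oOm jphi); exact: Vf.
Qed.

Lemma sspan_linear (phi : nat -> R -> R) V : jet m phi -> V `<=` fam ->
  linear_fam (sspan (phi 0%N) V).
Proof.
move=> jphi Vf; split.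
- exact: sspan_fam.
- exact: SpanC.
- by move=> F G; exact: sspanD.
- by move=> c F; exact: sspanZ.
Qed.

Lemma alg_pow A w n : closed_algebra A -> A w -> A (fun u x => w u x ^+ n).
Proof.
move=> cA Aw; elim: n => [|n IH].
  by apply: lin_eq (lin_cst (alg_lin cA) 1) _ => u x; rewrite expr0.
by apply: lin_eq (alg_mul cA Aw IH) _ => u x; rewrite exprS.
Qed.

Lemma alg_comp A w phi : closed_algebra A -> A w -> jet m phi ->
  A (fun u x => phi 0%N (w u x)).
Proof.
move=> cA Aw jphi; have lA := alg_lin cA.
apply: (lin_comp oOm lA) => //; first exact: (alg_clos cA).
  exact: (lin_fam lA).
by move=> n; exact: alg_pow.
Qed.

(** The product of two exponentials of elements of [V] is the exponential of
    their sum, which is again in [V]. *)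
Lemma exp_span_algebra V : linear_fam V -> closed_algebra (clos (sspan expR V)).
Proof.
move=> lV; apply: clos_algebra => //.
  exact: (sspan_linear (jet_exp R m) (lin_fam lV)).
move=> F G sF sG; elim: sF => [c|c w F' Vw _ IH]; first exact: sspanZ.
have sE : sspan expR V (fun u x => expR (w u x) * G u x).
  elim: sG {IH} => [c'|c' w' G' Vw' _ IH].
    by apply: sspan_eq (sspanZ c' (sspan1 expR Vw)) => u x; rewrite mulrC.
  apply: sspan_eq (SpanS c' (lin_add lV Vw Vw') IH) => u x.
  by rewrite expRD; ring.
by apply: sspan_eq (sspanD (sspanZ c sE) IH) => u x; ring.
Qed.

(** The algebra is the closure of the span of the exponentials. It contains
    [V] because exp is itself an activation to which [pow_net] applies; and
    exponentials are limits of networks with activation [phi] because powers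
    are. *)
Theorem net_algebra (phi : nat -> R -> R) V : linear_fam V -> smooth_jet phi ->
  (forall n, exists b, phi n b != 0) ->
  exists A, [/\ closed_algebra A, V `<=` A & A `<=` clos (sspan (phi 0%N) V)].
Proof.
move=> lV sphi nz; exists (clos (sspan expR V)).
have cA := exp_span_algebra lV; have Vf := lin_fam lV.
have slin f : jet m f -> linear_fam (sspan (f 0%N) V) by move=> jf; exact: sspan_linear.
have Vaff w h b : V w -> V (fun u x => b + h * w u x).
  move=> Vw; exact: (lin_add lV (lin_cst lV b) (lin_scale lV h Vw)).
have pown f : smooth_jet f -> (forall n, exists b, f n b != 0) ->
    forall w, V w -> forall n, clos (sspan (f 0%N) V) (fun u x => w u x ^+ n).
  move=> sf nzf w Vw; apply: (pow_net oOm (phi := f)) => //.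
  - by apply: clos_linear => //; exact: slin.
  - by apply: clos_idem => //; exact: lin_fam (slin _ _).
  - exact: Vf.
  - move=> h b; apply: sub_clos => //; first exact: lin_fam (slin _ _).
    exact: (sspan1 (f 0%N) (Vaff w h b Vw)).
split=> //.
  move=> w Vw; have H := @pown _ (jet_exp R) _ w Vw 1%N.
  by apply: lin_eq (H _) _ => // n; exists 0; rewrite expR0 oner_neq0.
move=> F [fF FE].
apply: clos_idem => //; first exact: lin_fam (slin _ _).
split=> // e /FE[G sG FG]; exists G => //.
elim: sG {FG} => [c|c w G' Vw _ IH].
  by apply: sub_clos; [|exact: lin_fam (slin _ _)|exact: SpanC].
have lc := clos_linear oOm (slin _ (sphi m)).
apply: (lin_add lc) => //; apply: (lin_scale lc).
apply: (lin_comp (phi := fun=> expR) oOm lc) => //; [|exact: Vf|exact: pown|exact: jet_exp].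
by apply: clos_idem => //; exact: lin_fam (slin _ _).
Qed.

End NetAlgebra.

(** * Mean values and symmetry of second derivatives *)

Section RowNorm.
Variables (R : realType) (d : nat).
Implicit Types x y : 'rV[R]_d.

Lemma rV_coord_le x i : `|x 0 i| <= `|x|.
Proof.
rewrite [leRHS]/Num.norm/= mx_normrE.
by rewrite (le_bigmax _ (fun ij : 'I_1 * 'I_d => `|x ij.1 ij.2|) (0, i)).
Qed.

Lemma rV_norm_le x e : 0 <= e -> (forall i, `|x 0 i| <= e) -> `|x| <= e.
Proof.
move=> e0 xe; rewrite [leLHS]/Num.norm/= mx_normrE; apply/bigmax_leP; split=> //.
by move=> [i j] _ /=; rewrite ord1.
Qed.

End RowNorm.

Lemma near_forall (T : topologicalType) (x : T) n (P : 'I_n -> T -> Prop) :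
  (forall i, \forall w \near x, P i w) -> \forall w \near x, forall i, P i w.
Proof. exact: filter_forall. Qed.

Section Taylor.
Variables (R : realType) (d : nat) (Om : set 'rV[R]_d).
Hypothesis oOm : open Om.
Implicit Types (f g : 'rV[R]_d -> R) (x y z v : 'rV[R]_d).
Local Notation ax := (axis R).

Lemma extends_continuous g x : extends Om g -> Om x -> {for x, continuous g}.
Proof.
move=> [h ch hg] Ox.
have /subspace_continuousP/(_ x (@subset_closure _ _ _ Ox)) H := ch.
move=> B; rewrite -(hg x Ox) => /H HB.
have {}HB : \forall y \near within (closure Om) (nbhs x), B (h y) by exact: HB.
rewrite near_withinE in HB; change (\forall y \near x, B (g y)).
near=> y; rewrite /= -hg; last by near: y; exact: open_nbhs_nbhs.
have cy : closure Om y by apply: subset_closure; near: y; exact: open_nbhs_nbhs.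
by move: cy; near: y.
Unshelve. all: by end_near. Qed.

Lemma is_derive_seg g z v t : derivable g (z + t *: v) v ->
  is_derive t (1 : R) (fun t => g (z + t *: v)) ('D_v g (z + t *: v)).
Proof.
move=> /derivableP/is_derive_line H.
have H1 : is_derive t (1 : R) (fun s : R => s - t) 1.
  have H2 := is_deriveB (is_derive_id t (1 : R)) (is_derive_cst t t (1 : R)).
  by apply: is_derive_eq H2 _; rewrite subr0.
rewrite -(subrr t) in H.
have := @is_derive1_comp _ _ (fun s : R => s - t) t _ _ H H1.
rewrite mulr1; congr (is_derive _ _ _ _); apply/funext => s /=.
by congr g; rewrite addrCA -scalerDl subrK.
Qed.

Lemma mvt_seg g z v : (forall t : R, 0 <= t <= 1 -> derivable g (z + t *: v) v) ->
  exists2 t, 0 <= t <= 1 & g (z + v) - g z = 'D_v g (z + t *: v).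
Proof.
move=> dg; pose h t := g (z + t *: v).
have dh (t : R) : 0 <= t <= 1 -> is_derive t (1 : R) h ('D_v g (z + t *: v)).
  by move=> /dg; exact: is_derive_seg.
have [x x01||t] := @MVT_segment R h (fun t => 'D_v g (z + t *: v)) 0 1 ler01.
- by apply: dh; move: x01; rewrite in_itv/= => /andP[/ltW-> /ltW->].
- apply: derivable_within_continuous => x; rewrite in_itv/= => /dh.
  by case.
rewrite in_itv/= subr0 mulr1 => t01 E; exists t => //.
by rewrite -E /h scale1r scale0r addr0.
Qed.

Lemma derive_axisZ g i (a : R) x : derivable g x (ax i) ->
  is_derive x (a *: ax i) g (a * 'D_(ax i) g x).
Proof.
move=> /derivableP dg; apply/is_derive_line.
have /is_derive_line H := dg.
have H1 : is_derive (0 : R) (1 : R) (fun s : R => s * a) a.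
  have H2 := is_deriveZ a (is_derive_id (0 : R) (1 : R)).
  have -> : (fun s : R => s * a) = (a \*: id) by apply/funext => s; rewrite mulrC.
  by apply: is_derive_eq H2 _; exact: mulr1.
rewrite -(mul0r a) in H.
have := @is_derive1_comp _ _ (fun s : R => s * a) 0 _ _ H H1.
by rewrite mulrC; congr (is_derive _ _ _ _); apply/funext => s /=; rewrite scalerA.
Qed.

Lemma mvt_axis g i (a : R) z :
  (forall t : R, 0 <= t <= 1 -> derivable g (z + (t * a) *: ax i) (ax i)) ->
  exists2 t, 0 <= t <= 1 & g (z + a *: ax i) - g z = a * 'D_(ax i) g (z + (t * a) *: ax i).
Proof.
move=> dg; have [t t01|t t01 ->] := @mvt_seg g z (a *: ax i).
  by rewrite scalerA; case: (derive_axisZ a (dg t t01)).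
exists t => //; have H := derive_axisZ a (dg t t01).
by rewrite scalerA; case: H.
Qed.

(** The vertices of a path from [x] to [y] that moves one coordinate at a
    time. *)
Definition mixrow k x y : 'rV[R]_d := \row_j (if (j < k)%N then y 0 j else x 0 j).

Lemma mixrowS k x y (lt_kd : (k < d)%N) :
  mixrow k.+1 x y = mixrow k x y + (y 0 (Ordinal lt_kd) - x 0 (Ordinal lt_kd)) *: ax (Ordinal lt_kd).
Proof.
apply/rowP => j; rewrite !mxE eqxx /= -val_eqE /= ltnS leq_eqVlt.
have [jk|jk|jk] := ltngtP j k.
- by rewrite orbT mulr0 addr0.
- by rewrite mulr0 addr0.
- have -> : j = Ordinal lt_kd by apply: val_inj.
  by rewrite mulr1 addrC subrK.
Qed.

(** Partial derivatives control increments along a path parallel to the axes;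
    the path stays in the ball since the norm is the max norm. *)
Lemma box_mvt g c (r M : R) x y : 0 <= M ->
  (forall w i, `|w - c| < r -> derivable g w (ax i) /\ `|'D_(ax i) g w| <= M) ->
  `|x - c| < r -> `|y - c| < r -> `|g y - g x| <= M * \sum_i `|y 0 i - x 0 i|.
Proof.
move=> M0 dg xc yc.
(* Any point whose coordinates lie between those of [x] and [y] is in the
   ball. *)
have inbox (w : 'rV[R]_d) : (forall j, exists2 t : R, 0 <= t <= 1 & w 0 j = x 0 j + t * (y 0 j - x 0 j)) -> `|w - c| < r.
  move=> Hw; set e := Num.max `|x - c| `|y - c|.
  have er : e < r by rewrite gt_max xc yc.
  apply: le_lt_trans er; apply: rV_norm_le; first by rewrite le_max normr_ge0.
  move=> j; have [t /andP[t0 t1] E] := Hw j; rewrite !mxE E.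
  have hx : `|x 0 j - c 0 j| <= e.
    by rewrite le_max; apply/orP; left; have := rV_coord_le (x - c) j; rewrite !mxE.
  have hy : `|y 0 j - c 0 j| <= e.
    by rewrite le_max; apply/orP; right; have := rV_coord_le (y - c) j; rewrite !mxE.
  have -> : x 0 j + t * (y 0 j - x 0 j) - c 0 j =
    (1 - t) * (x 0 j - c 0 j) + t * (y 0 j - c 0 j) by ring.
  rewrite (le_trans (ler_normD _ _))// !normrM (ger0_norm t0) ger0_norm ?subr_ge0//.
  by move: hx hy; move: `|_| `|_| => p q; nra.
have key k (kd : (k <= d)%N) : `|g (mixrow k x y) - g x| <= M * \sum_(i < d | (i < k)%N) `|y 0 i - x 0 i|.
  elim: k kd => [|k IH] kd.
    have -> : mixrow 0 x y = x by apply/rowP => j; rewrite !mxE.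
    by rewrite subrr normr0 mulr_ge0// sumr_ge0.
  rewrite (bigD1 (Ordinal kd)) //= mulrDr.
  rewrite -(subrKA (g (mixrow k x y))) (le_trans (ler_normD _ _))// lerD//; last first.
    rewrite (le_trans (IH (ltnW kd)))// ler_wpM2l//.
    rewrite le_eqVlt; apply/orP; left; apply/eqP; apply: eq_bigl => i.
    by rewrite ltnS ltn_neqAle -val_eqE /= andbC.
  set i := Ordinal kd.
  have Hin (t : R) : 0 <= t <= 1 -> `|mixrow k x y + (t * (y 0 i - x 0 i)) *: ax i - c| < r.
    move=> t01; apply: inbox => j; rewrite !mxE eqxx /=.
    have [->|ji] := eqVneq j i; first by exists t => //; rewrite ltnn mulr1.
    rewrite mulr0 addr0; case: ifP => _; first by exists 1; rewrite ?ler01 ?lexx// mul1r addrC subrK.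
    by exists 0; rewrite ?lexx ?ler01// mul0r addr0.
  have [t t01|t t01] := @mvt_axis g i (y 0 i - x 0 i) (mixrow k x y).
    exact: (dg _ i (Hin t t01)).1.
  rewrite mixrowS -/i => ->; rewrite normrM mulrC ler_wpM2r//.
  exact: (dg _ i (Hin t t01)).2.
have := key d (leqnn d).
have -> : mixrow d x y = y by apply/rowP => j; rewrite !mxE ltn_ord.
by under eq_bigl do rewrite ltn_ord.
Qed.

Lemma is_derive_linear x i (c : 'I_d -> R) :
  is_derive x (ax i) (fun y => \sum_j c j * y 0 j) (c i).
Proof.
have -> : (fun y : 'rV[R]_d => \sum_j c j * y 0 j) =
    \sum_j (c j \*: (fun y : 'rV[R]_d => y 0 j)).
  by apply/funext => y; rewrite fct_sumE.
have H : is_derive x (ax i) (\sum_j (c j \*: (fun y : 'rV[R]_d => y 0 j)))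
    (\sum_j c j *: (j == i)%:R).
  apply: is_derive_sum => j; apply: is_deriveZ.
  by apply: DeriveDef; [exact: derivable_coord|exact: (congr1 (fun F : 'rV[R]_d -> R => F x) (derive_coord R j i))].
apply: is_derive_eq H _; rewrite (bigD1 i)//= eqxx big1 ?addr0 ?[_ *: _]mulr1//.
by move=> j /negbTE ->; exact: mulr0.
Qed.

(** Continuity of the partial derivatives gives all directional derivatives:
    after subtraction of the linear part, partial derivatives are small near
    [x] and [box_mvt] bounds the remainder. *)
Lemma smooth1_is_derive g x v : smooth Om 1 g -> Om x ->
  is_derive x v g (\sum_i v 0 i * 'D_(ax i) g x).
Proof.
move=> sg Ox; set L := \sum_i _.
suff H : (fun h => h^-1 *: ((g \o shift x) (h *: v) - g x)) @ 0^' --> (L : R^o).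
  by apply: DeriveDef; [apply/cvg_ex; exists L|apply/cvg_lim].
apply/cvgrPdist_le => /= e e0.
pose V := \sum_i `|v 0 i|; have V0 : 0 <= V by exact: sumr_ge0.
have e10 : 0 < e / (V + 1) by rewrite divr_gt0// ltr_wpDl.
have : \forall w \near x, Om w /\ forall i, `|'D_(ax i) g w - 'D_(ax i) g x| <= e / (V + 1).
  have Hi : \forall w \near x, forall i, `|'D_(ax i) g w - 'D_(ax i) g x| <= e / (V + 1).
    apply: near_forall => i.
    have /extends_continuous/(_ Ox)/cvgrPdist_le/(_ _ e10) := (sg.2 i).2.1.
    by apply: filterS => w /=; rewrite distrC.
  by apply: filterI Hi; exact: open_nbhs_nbhs.
move=> /nbhs_ballP[r /= r0 Hr].
pose g' y := g y - \sum_i 'D_(ax i) g x * y 0 i.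
have sg' : smooth Om 1 g'.
  by apply: smoothB => //; apply: smooth_sum => // i; apply: smoothZ => //; exact: smooth_coord.
have dg' w i : `|w - x| < r -> derivable g' w (ax i) /\ `|'D_(ax i) g' w| <= e / (V + 1).
  move=> wx; have [Ow Hw] : Om w /\ forall i, `|'D_(ax i) g w - 'D_(ax i) g x| <= e / (V + 1).
    by apply: Hr; rewrite -ball_normE /= distrC.
  split; first exact: (sg'.2 i).1.
  have -> : 'D_(ax i) g' w = 'D_(ax i) g w - 'D_(ax i) g x; last exact: Hw.
  rewrite -[LHS]/('D_(ax i) (g - _) w).
  have H := is_derive_linear w i (fun j => 'D_(ax j) g x).
  by rewrite deriveB ?derive_val//; exact: (sg.2 i).1.
near=> h.
have hn0 : h != 0 by near: h; exact: nbhs_dnbhs_neq.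
have hv : `|h *: v + x - x| < r.
  rewrite addrK normrZ; have v1 : 0 < `|v| + 1 by rewrite ltr_wpDl.
  have : `|h| < r / (`|v| + 1) by near: h; apply: dnbhs0_lt; rewrite divr_gt0.
  rewrite ltr_pdivlMr//; apply: le_lt_trans.
  by rewrite ler_wpM2l// lerDl.
have xx : `|x - x| < r by rewrite subrr normr0.
have := box_mvt (ltW e10) dg' xx hv.
have -> : \sum_i `|(h *: v + x) 0 i - x 0 i| = `|h| * V.
  by rewrite /V mulr_sumr; apply: eq_bigr => i _; rewrite !mxE addrK normrM.
have -> : g' (h *: v + x) - g' x = g (h *: v + x) - g x - h * L.
  rewrite /g' opprD addrACA opprK; congr (_ + _).
  rewrite -sumrN -big_split /= /L mulr_sumr -sumrN; apply: eq_bigr => i _.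
  by rewrite !mxE; ring.
move=> H; have -> : L - h^-1 *: ((g \o shift x) (h *: v) - g x) =
   - (h^-1 * (g (h *: v + x) - g x - h * L)).
  by rewrite mulrBr mulKf// opprB.
rewrite normrN normrM normfV ler_pdivrMl ?normr_gt0// (le_trans H)//.
by rewrite mulrCA ler_wpM2l// mulrAC ler_pdivrMr ?ltr_wpDl// ler_wpM2l ?lerDl// ltW.
Unshelve. all: by end_near. Qed.

Lemma seg_bound g z x M : smooth Om 1 g ->
  (forall t : R, 0 <= t <= 1 -> Om (z + t *: (x - z))) ->
  (forall (t : R) i, 0 <= t <= 1 -> `|'D_(ax i) g (z + t *: (x - z))| <= M) ->
  `|g x - g z| <= d%:R * `|x - z| * M.
Proof.
move=> sg seg HM.
have [t t01|t t01] := @mvt_seg g z (x - z).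
  by case: (smooth1_is_derive (x - z) sg (seg t t01)).
rewrite [z + _]addrC subrK => ->.
rewrite (@derive_val _ _ _ _ _ _ _ (smooth1_is_derive (x - z) sg (seg t t01))).
rewrite (le_trans (ler_norm_sum _ _ _))//.
rewrite -mulrA -[d in d%:R]card_ord mulr_natl -sumr_const.
apply: ler_sum => i _; rewrite normrM ler_pM//; first exact: rV_coord_le.
exact: HM.
Qed.

(** The left-hand side is symmetric in [i] and [j], whereas the right-hand
    side is a mixed derivative in a given order. *)
Lemma second_difference g i j x (h : R) : smooth Om 2 g ->
  (forall s t : R, 0 <= s <= 1 -> 0 <= t <= 1 -> Om (x + (s * h) *: ax i + (t * h) *: ax j)) ->
  exists s, exists2 t, 0 <= s <= 1 /\ 0 <= t <= 1 &
  g (x + h *: ax i + h *: ax j) - g (x + h *: ax i) - g (x + h *: ax j) + g x =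
  h ^+ 2 * 'D_(ax j) ('D_(ax i) g) (x + (s * h) *: ax i + (t * h) *: ax j).
Proof.
move=> sg Oh.
have O1 (s : R) : 0 <= s <= 1 -> Om (x + (s * h) *: ax i).
  by move=> s01; have := Oh s 0 s01; rewrite mul0r scale0r addr0 lexx ler01; exact.
have O2 (s : R) : 0 <= s <= 1 -> Om (x + (s * h) *: ax i + h *: ax j).
  by move=> s01; have := Oh s 1 s01; rewrite mul1r lexx ler01; exact.
pose k y := g (y + h *: ax j) - g y.
have dk y : Om y -> Om (y + h *: ax j) ->
    is_derive y (ax i) k ('D_(ax i) g (y + h *: ax j) - 'D_(ax i) g y).
  move=> Oy Oyh; have H1 := derivableP ((sg.2 i).1 y Oy).
  have H2 : is_derive y (ax i) (fun y => g (y + h *: ax j)) ('D_(ax i) g (y + h *: ax j)).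
    apply/is_derive_line; have /is_derive_line := derivableP ((sg.2 i).1 _ Oyh).
    by congr (is_derive _ _ _ _); apply/funext => t; rewrite addrA.
  exact: is_deriveB H2 H1.
have [s s01|s s01] := @mvt_axis k i h x.
  by case: (dk _ (O1 s s01) (O2 s s01)).
rewrite (@derive_val _ _ _ _ _ _ _ (dk _ (O1 s s01) (O2 s s01))) => E.
have [t t01|t t01 E2] := @mvt_axis ('D_(ax i) g) j h (x + (s * h) *: ax i).
  by apply: ((sg.2 i).2.2 j).1; exact: Oh.
exists s; exists t => //.
rewrite E2 mulrA -expr2 in E; rewrite -E /k addrAC; ring.
Qed.

Lemma eq_approx (u v : R) :
  (forall e : R, 0 < e -> exists q, `|u - q| <= e /\ `|v - q| <= e) -> u = v.
Proof.
move=> H; apply/eqP; rewrite -subr_eq0 -normr_le0.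
apply/ler_addgt0Pl => e e0; rewrite addr0.
have e20 : 0 < e / 2 by rewrite divr_gt0.
have [q [uq vq]] := H _ e20.
rewrite -(subrKA q) (le_trans (ler_normD _ _))//.
by rewrite [leRHS]splitr lerD// distrC.
Qed.

(** Both mixed derivatives are limits of the same symmetric second
    difference. *)
Lemma clairaut g i j x : smooth Om 2 g -> Om x ->
  'D_(ax i) ('D_(ax j) g) x = 'D_(ax j) ('D_(ax i) g) x.
Proof.
move=> sg Ox; apply: eq_approx => e e20.
have : \forall w \near x, Om w /\ forall i j, `|'D_(ax j) ('D_(ax i) g) x - 'D_(ax j) ('D_(ax i) g) w| <= e.
  have Hi : \forall w \near x, forall i j, `|'D_(ax j) ('D_(ax i) g) x - 'D_(ax j) ('D_(ax i) g) w| <= e.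
    apply: near_forall => k; apply: near_forall => l.
    by have /extends_continuous/(_ Ox)/cvgrPdist_le/(_ _ e20) := ((sg.2 k).2.2 l).2.1.
  by apply: filterI Hi; exact: open_nbhs_nbhs.
move=> /nbhs_ballP[r /= r0 Hr].
have [h h0 h3] : exists2 h : R, 0 < h & h + h < r by exists (r / 3); lra.
have near_h k l (s t : R) : 0 <= s <= 1 -> 0 <= t <= 1 -> ball x r (x + (s * h) *: ax k + (t * h) *: ax l).
  move=> /andP[s0 s1] /andP[t0 t1]; rewrite -ball_normE /= -addrA opprD addrA subrr add0r normrN.
  apply: (@le_lt_trans _ _ (h + h)); last exact: h3.
  rewrite (le_trans (ler_normD _ _))// [`|_ *: ax k|]normrZ [`|_ *: ax l|]normrZ.
  have ax1 m : `|ax m| <= 1.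
    apply: rV_norm_le => // n; rewrite !mxE eqxx /=.
    by case: (_ == _); rewrite ?normr1 ?normr0.
  have hm (u : R) m : 0 <= u -> u <= 1 -> `|u * h| * `|ax m| <= h.
    move=> u0 u1; rewrite ger0_norm ?mulr_ge0 ?(ltW h0)// -[leRHS]mulr1.
    by apply: ler_pM => //; [exact/mulr_ge0/ltW|rewrite ler_piMl// ltW].
  by apply: lerD; exact: hm.
have Oh k l (s t : R) : 0 <= s <= 1 -> 0 <= t <= 1 -> Om (x + (s * h) *: ax k + (t * h) *: ax l).
  by move=> s01 t01; have [] := Hr _ (near_h k l s t s01 t01).
have [s [t [s01 t01] E1]] := second_difference sg (Oh i j).
have [s' [t' [s01' t01'] E2]] := second_difference sg (Oh j i).
have H1 := (Hr _ (near_h i j s t s01 t01)).2 i j.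
have H2 := (Hr _ (near_h j i s' t' s01' t01')).2 j i.
have E : x + h *: ax j + h *: ax i = x + h *: ax i + h *: ax j by exact: addrAC.
rewrite E in E2; move: E1 E2 H1 H2.
move: ('D_(ax j) _ (_ + _ + _)) ('D_(ax i) _ (_ + _ + _)) => p q.
move=> E1 E2 H1 H2.
have pq : p = q.
  apply: (mulfI (lt0r_neq0 (exprn_gt0 2 h0))).
  exact: etrans (esym E1) (etrans (congr1 (fun u => u + g x) (addrAC _ _ _)) E2).
by exists q; split; [exact: H2|move: H1; rewrite pq; exact].
Qed.

End Taylor.

(** * Taylor polynomials in several variables *)

Section TaylorPoly.
Variables (R : realType) (d : nat) (Om : set 'rV[R]_d).
Hypothesis oOm : open Om.
Variable z : 'rV[R]_d.
Hypothesis Oz : Om z.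
Implicit Types (f g : 'rV[R]_d -> R) (x y v : 'rV[R]_d).
Local Notation ax := (axis R).

(** The homogeneous part of degree [n] of the Taylor expansion at [z], written
    without multi-indices: by Euler's identity, [n] times it is the sum of
    [(y_i - z_i)] times the part of degree [n - 1] of [d_i g]. *)
Fixpoint homog n (g : 'rV[R]_d -> R) (y : 'rV[R]_d) : R :=
  if n is n'.+1
  then n%:R^-1 * \sum_i (y 0 i - z 0 i) * homog n' ('D_(ax i) g) y
  else g z.

Definition tpoly n g y := \sum_(j < n.+1) homog j g y.

Lemma homog_eq n f g y : (forall x, Om x -> f x = g x) -> homog n f y = homog n g y.
Proof.
elim: n f g => [|n IH] f g fg /=; first exact: fg.
congr (_ * _); apply: eq_bigr => i _; congr (_ * _); apply: IH.
by move=> x Ox; exact: (eq_derive_on oOm _ fg).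
Qed.

Lemma smooth_homog p n g : smooth Om p (homog n g).
Proof.
elim: n g => [|n IH] g /=; first exact: smoothC.
apply: smoothZ => //; apply: smooth_sum => // i; apply: smoothM => //.
by apply: smoothB => //; [exact: smooth_coord|exact: smoothC].
Qed.

Lemma is_derive_homogS n g k y : Om y ->
  is_derive y (ax k) (homog n.+1 g)
    (n.+1%:R^-1 * (homog n ('D_(ax k) g) y +
      \sum_i (y 0 i - z 0 i) * 'D_(ax k) (homog n ('D_(ax i) g)) y)).
Proof.
move=> Oy.
have H i : is_derive y (ax k) (fun y => (y 0 i - z 0 i) * homog n ('D_(ax i) g) y)
    ((y 0 i - z 0 i) * 'D_(ax k) (homog n ('D_(ax i) g)) y +
     (i == k)%:R * homog n ('D_(ax i) g) y).
  have H1 : is_derive y (ax k) (fun y : 'rV[R]_d => y 0 i - z 0 i) (i == k)%:R.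
    have H2 : is_derive y (ax k) (fun y : 'rV[R]_d => y 0 i) (i == k)%:R.
      by apply: DeriveDef; [exact: derivable_coord|exact: (congr1 (fun F : 'rV[R]_d -> R => F y) (derive_coord R i k))].
    by have := is_deriveB H2 (is_derive_cst (z 0 i) y (ax k)); rewrite subr0.
  have H2 : is_derive y (ax k) (homog n ('D_(ax i) g)) ('D_(ax k) (homog n ('D_(ax i) g)) y).
    by apply: derivableP; exact: ((smooth_homog 1 n ('D_(ax i) g)).2 k).1.
  have := is_deriveM H1 H2; move/is_derive_eq; apply.
  by congr (_ + _); exact: mulrC.
have -> : homog n.+1 g = n.+1%:R^-1 \*: (\sum_i (fun y => (y 0 i - z 0 i) * homog n ('D_(ax i) g) y)).
  apply/funext => x.
  transitivity (n.+1%:R^-1 * (\sum_i (fun y => (y 0 i - z 0 i) * homog n ('D_(ax i) g) y)) x).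
    by rewrite fct_sumE.
  by [].
have := is_deriveZ n.+1%:R^-1 (is_derive_sum H); move/is_derive_eq; apply.
congr (_ * _); rewrite big_split /= addrC; congr (_ + _).
rewrite (bigD1 k)//= eqxx mul1r big1 ?addr0// => i /negbTE ->.
by rewrite mul0r.
Qed.

(** Symmetry of second derivatives is what makes differentiation commute with
    taking homogeneous parts. *)
Lemma derive_homog n g k y : smooth Om n.+1 g -> Om y ->
  'D_(ax k) (homog n.+1 g) y = homog n ('D_(ax k) g) y.
Proof.
elim: n g y => [|n IH] g y sg Oy;
  rewrite (@derive_val _ _ _ _ _ _ _ (is_derive_homogS _ _ _ Oy)).
  rewrite invr1 mul1r big1 ?addr0// => i _.
  have -> : 'D_(ax k) (homog 0 ('D_(ax i) g)) y = 0 by exact: derive_cst.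
  by rewrite mulr0.
have E i : 'D_(ax k) (homog n.+1 ('D_(ax i) g)) y = homog n ('D_(ax i) ('D_(ax k) g)) y.
  rewrite (IH _ _ (sg.2 i).2 Oy).
  by apply: homog_eq => x Ox; apply: (clairaut oOm _ _ _ Ox); exact: smooth_le sg.
under eq_bigr do rewrite E.
have n0 : n.+1%:R != 0 :> R by rewrite pnatr_eq0.
have -> : \sum_i (y 0 i - z 0 i) * homog n ('D_(ax i) ('D_(ax k) g)) y =
   n.+1%:R * homog n.+1 ('D_(ax k) g) y by rewrite /= mulVKf.
by rewrite -{1}[homog n.+1 _ y]mul1r -mulrDl -nat1r mulKf// nat1r pnatr_eq0.
Qed.

Lemma homogS0 n g : homog n.+1 g z = 0.
Proof. by rewrite /= big1 ?mulr0// => i _; rewrite subrr mul0r. Qed.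

Lemma smooth_tpoly p n g : smooth Om p (tpoly n g).
Proof. by apply: smooth_sum => // i; exact: smooth_homog. Qed.

Definition trem n g y := g y - tpoly n g y.

Lemma smooth_trem n g : smooth Om n g -> smooth Om n (trem n g).
Proof. by move=> sg; apply: smoothB => //; exact: smooth_tpoly. Qed.

Lemma trem0 n g : trem n g z = 0.
Proof.
rewrite /trem /tpoly big_ord_recl big1 ?addr0 ?subrr// => i _; exact: homogS0.
Qed.

Lemma derive_trem n g k y : smooth Om n.+1 g -> Om y ->
  'D_(ax k) (trem n.+1 g) y = trem n ('D_(ax k) g) y.
Proof.
move=> sg Oy.
have -> : trem n.+1 g = g - ((fun=> g z) + \sum_(j < n.+1) homog j.+1 g).
  apply/funext => x; rewrite /trem /tpoly big_ord_recl !fctE fct_sumE.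
  by [].
have H1 : is_derive y (ax k) g ('D_(ax k) g y).
  by apply: derivableP; exact: (sg.2 k).1.
have H2 (j : 'I_n.+1) : is_derive y (ax k) (homog j.+1 g) (homog j ('D_(ax k) g) y).
  apply: DeriveDef; first exact: ((smooth_homog 1 j.+1 g).2 k).1.
  by apply: derive_homog => //; apply: smooth_le sg.
have := is_deriveB H1 (is_deriveD (is_derive_cst (g z) y (ax k)) (is_derive_sum H2)).
by move/(@derive_val _ _ _ _ _ _ _) ->; rewrite add0r.
Qed.

(** Each partial derivative of order exactly [n] varies by at most [om]
    between points at distance at most [rho]. *)
Fixpoint osc (rho om : R) n (g : 'rV[R]_d -> R) : Prop :=
  if n is n'.+1 then forall i, osc rho om n' ('D_(ax i) g)
  else forall x y, Om x -> Om y -> `|x - y| <= rho -> `|g x - g y| <= om.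

(** The gradient of the remainder consists of the remainders of order [n - 1]
    of the partial derivatives; integrate it along the segment from [z]. *)
Lemma trem_bound rho om n g x : smooth Om n g -> osc rho om n g ->
  0 <= om ->
  (forall t : R, 0 <= t <= 1 -> Om (z + t *: (x - z))) -> `|x - z| <= rho ->
  `|trem n g x| <= (d.+1%:R * rho) ^+ n * om.
Proof.
move=> + + om0; elim: n g x => [|n IH] g x sg og seg xrho.
  rewrite expr0 mul1r /trem /tpoly big_ord1; apply: og => //.
  by have := seg 1; rewrite scale1r addrC subrK; apply; rewrite ler01 lexx.
have rho0 : 0 <= rho by exact: le_trans (normr_ge0 _) xrho.
rewrite -[trem _ _ x]subr0 -(trem0 n.+1 g).
have := seg_bound oOm (smooth_le _ (smooth_trem sg)) seg.
move=> /(_ ((d.+1%:R * rho) ^+ n * om) isT) H.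
apply: le_trans (H _) _.
  move=> t i t01; rewrite derive_trem//; last exact: seg.
  have [t0 t1] := andP t01.
  apply: IH; [exact: (sg.2 i).2|exact: og| |].
    move=> s /andP[s0 s1]; rewrite addrAC subrr add0r scalerA; apply: seg.
    by rewrite mulr_ge0//= mulr_ile1.
  rewrite addrAC subrr add0r normrZ ger0_norm// (le_trans _ xrho)//.
  by rewrite ler_piMl.
rewrite exprS -[X in _ <= X]mulrA ler_wpM2r//.
  by rewrite mulr_ge0// exprn_ge0// mulr_ge0.
by apply: ler_pM => //; rewrite ler_nat.
Qed.

(** The derivatives of order [j] of the remainder are at most
    [(d.+1%:R * rho) ^+ (n - j) * om]. The hypothesis on [r] turns this into a
    bound in the sense of [bnd]. *)
Lemma bnd_trem rho om r n g x : smooth Om n g -> osc rho om n g ->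
  0 <= om -> 0 <= r -> 1 <= d.+1%:R * rho * r ->
  (forall t : R, 0 <= t <= 1 -> Om (z + t *: (x - z))) -> `|x - z| <= rho ->
  bnd [set x] r n ((d.+1%:R * rho) ^+ n * om) (trem n g).
Proof.
move=> sg og om0 r0 r1 seg xrho.
have Ox : Om x by have := seg 1; rewrite scale1r addrC subrK; apply; rewrite ler01 lexx.
elim: n g sg og => [|n IH] g sg og.
  by split=> // _ ->; exact: trem_bound.
split=> [_ ->|i]; first exact: trem_bound.
have rho0 : 0 <= rho by exact: le_trans (normr_ge0 _) xrho.
apply: (bnd_mono (e := (d.+1%:R * rho) ^+ n * om)) => //.
  have -> : (d.+1%:R * rho) ^+ n.+1 * om * r =
      d.+1%:R * rho * r * ((d.+1%:R * rho) ^+ n * om) by rewrite exprS; ring.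
  rewrite ler_peMl//.
  by rewrite mulr_ge0// exprn_ge0// mulr_ge0.
apply: (bnd_eq oOm _ _ (IH _ (sg.2 i).2 (og i))).
  by move=> _ ->.
by move=> y Oy; rewrite derive_trem.
Qed.

End TaylorPoly.

Section Oscillation.
Variables (R : realType) (d : nat) (Om : set 'rV[R]_d).
Hypothesis oOm : open Om.
Hypothesis cOm : compact (closure Om).
Implicit Types (f g : 'rV[R]_d -> R) (x y v : 'rV[R]_d).

(** Uniform continuity on the compact closure. *)
Lemma extends_unif g om : extends Om g -> 0 < om ->
  exists2 rho, 0 < rho & forall x y, Om x -> Om y -> `|x - y| <= rho -> `|g x - g y| <= om.
Proof.
move=> [h ch hg] om0; have om20 : 0 < om / 2 by rewrite divr_gt0.
have /near_covering_withinP : near_covering (closure Om) by apply/compact_near_coveringP.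
move=> /(_ R (0^'+) (fun rho x => forall y, closure Om y -> `|x - y| <= rho -> `|h x - h y| <= om) _).
case=> [x cx|rho0 /= rho00 H].
  have /subspace_continuousP/(_ x cx)/cvgrPdist_le/(_ _ om20) := ch.
  rewrite near_withinE => /nbhs_ballP[r /= r0 Hr].
  have r20 : 0 < r / 2 by rewrite divr_gt0.
  exists (ball x (r / 2), [set rho : R | rho < r / 2]).
    by split; [exact: nbhsx_ballx|exact: nbhs_right_lt].
  move=> [x' rho] /= [xx' rr] cx' y cy x'y.
  have bx' : ball x r x' by apply: le_ball xx'; lra.
  have by_ : ball x r y.
    rewrite -ball_normE /= in xx' *.
    rewrite -(subrKA x') (le_lt_trans (ler_normD _ _))//; lra.
  have := Hr _ bx' cx'; have := Hr _ by_ cy => /= h1 h2.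
  rewrite -(subrKA (h x)) (le_trans (ler_normD _ _))// [leRHS]splitr.
  by rewrite lerD// distrC.
exists (rho0 / 2); first by rewrite divr_gt0.
move=> x y Ox Oy xy; rewrite -!hg//.
apply: (H (rho0 / 2)) => //=.
- by rewrite sub0r normrN gtr0_norm ?divr_gt0//; lra.
- by rewrite divr_gt0.
- exact: subset_closure.
- exact: subset_closure.
Qed.

Lemma osc_le rho rho' om n g : rho' <= rho -> osc Om rho om n g -> osc Om rho' om n g.
Proof.
move=> rr; elim: n g => [|n IH] g /= H; last by move=> i; exact: IH.
by move=> x y Ox Oy xy; apply: H => //; exact: le_trans rr.
Qed.

Lemma smooth_osc n g om : smooth Om n g -> 0 < om ->
  exists2 rho, 0 < rho & osc Om rho om n g.
Proof.
move=> + om0; elim: n g => [|n IH] g sg; first exact: extends_unif (smooth_ext sg) om0.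
have /choice[rho Hrho] : forall i : 'I_d, exists rho, 0 < rho /\ osc Om rho om n ('D_(axis R i) g).
  by move=> i; have [r r0 Hr] := IH _ (sg.2 i).2; exists r.
have [r [r0 Hr]] : exists r, 0 < r /\ forall i, r <= rho i.
  exists (\big[Num.min/1]_i rho i); split.
    by elim/big_ind: _ => // [x y x0 y0|i _]; [rewrite lt_min x0|case: (Hrho i)].
  by move=> i; exact: bigmin_le_cond.
by exists r => // i; apply: osc_le (Hrho i).2.
Qed.

End Oscillation.

(** * Smooth partitions of unity on the line *)

Section SmoothStep.
Variable R : realType.
Implicit Types (p q r : {poly R}).

Lemma derivn_root (a : R) k j r : (j < k)%N -> ((('X - a%:P) ^+ k * r)^`(j)).[a] = 0.
Proof.
elim: j k r => [|j IH] [|k] r // jk.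
  by rewrite derivn0 exprS !hornerE subrr !mul0r.
rewrite derivSn.
have -> : (('X - a%:P) ^+ k.+1 * r)^`() =
   ('X - a%:P) ^+ k * (k.+1%:R * r + ('X - a%:P) * r^`()).
  rewrite derivM deriv_exp derivB derivX derivC subr0 mul1r /= exprS.
  by rewrite mulr_natl -mulr_natr; ring.
exact: IH.
Qed.

(** The substitution [p := p^2 (3 - 2 p)] raises the order of vanishing of [p]
    at 0 and of [1 - p] at 1. *)
Lemma step_poly m : exists p : {poly R}, [/\ p.[0] = 0, p.[1] = 1 &
  forall j, (0 < j <= m)%N -> p^`(j).[0] = 0 /\ p^`(j).[1] = 0].
Proof.
suff [p [r [s [p0 p1]]]] : exists p r s, p = ('X - 0%:P) ^+ m.+1 * r /\ 1 - p = ('X - 1%:P) ^+ m.+1 * s.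
  exists p; split.
  - by have := derivn_root 0 r (ltn0Sn m); rewrite -p0 derivn0.
  - have /eqP := derivn_root 1 s (ltn0Sn m); rewrite -p1 derivn0 !hornerE subr_eq0.
    by move/eqP.
  - move=> [//|j] /andP[_ jm]; split; first by rewrite p0 derivn_root.
    have := derivn_root 1 s (jm : (j.+1 < m.+1)%N); rewrite -p1 derivnB.
    rewrite -{1}polyC1 derivnC sub0r hornerN => /eqP.
    by rewrite oppr_eq0 => /eqP.
elim: m => [|m [p [r [s [p0 p1]]]]].
  by exists 'X, 1, (-1); rewrite subr0 !expr1 mulr1; split=> //; ring.
exists (p ^+ 2 * (3%:R - 2%:R * p)).
exists (('X - 0%:P) ^+ m * r ^+ 2 * (3%:R - 2%:R * p)).
exists (('X - 1%:P) ^+ m * s ^+ 2 * (1 + 2%:R * p)); split.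
  by rewrite {1}p0; move: ('X - 0%:P) => y; rewrite !exprS; ring.
have -> : 1 - p ^+ 2 * (3%:R - 2%:R * p) = (1 - p) ^+ 2 * (1 + 2%:R * p) by ring.
by rewrite {1}p1; move: ('X - 1%:P) => y; rewrite !exprS; ring.
Qed.

Definition clamp (t : R) := Num.max 0 (Num.min 1 t).

Lemma clamp_bound t : 0 <= clamp t <= 1.
Proof. by rewrite le_max lexx /= ge_max ler01 ge_min lexx. Qed.

Lemma clamp_le0 t : t <= 0 -> clamp t = 0.
Proof. by move=> t0; rewrite /clamp; apply/max_idPl; rewrite ge_min t0 orbT. Qed.

Lemma clamp_ge1 t : 1 <= t -> clamp t = 1.
Proof. by move=> t1; rewrite /clamp (min_idPl t1); apply/max_idPr. Qed.

Lemma clamp_id t : 0 <= t <= 1 -> clamp t = t.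
Proof. by move=> /andP[t0 t1]; rewrite /clamp (min_idPr t1); apply/max_idPr. Qed.

Lemma clamp_lip s t : `|clamp s - clamp t| <= `|s - t|.
Proof.
wlog st : s t / s <= t => [H|].
  by have [/H//|/ltW/H] := leP s t; rewrite distrC [leRHS]distrC.
have [s0|s0] := leP s 0.
  rewrite (clamp_le0 s0) sub0r normrN.
  have [t0|t0] := leP t 0; first by rewrite clamp_le0// normr0.
  have [t1|t1] := leP t 1.
    by rewrite clamp_id ?(ltW t0)// ger0_norm ?(ltW t0)// ler0_norm; lra.
  by rewrite clamp_ge1 ?(ltW t1)// normr1 ler0_norm; lra.
have [t1|t1] := leP t 1; first by rewrite !clamp_id// ?(ltW s0) ?(le_trans st)// (le_trans (ltW s0)).
rewrite (clamp_ge1 (ltW t1)); have [s1|s1] := leP s 1.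
  by rewrite clamp_id ?(ltW s0)// !ler0_norm; lra.
by rewrite clamp_ge1 ?(ltW s1)// subrr normr0.
Qed.

Lemma continuous_clamp : continuous clamp.
Proof.
move=> t; apply/cvgrPdist_le => /= e e0; near=> s.
by rewrite (le_trans (clamp_lip _ _))//; near: s; exact: cvgr_dist_le.
Unshelve. all: by end_near. Qed.

(** [clamp] is 1-Lipschitz and [q] is stationary at [a], so the missing
    derivative of [clamp] at [a] is harmless. *)
Lemma is_derive_kink q a : clamp a = a -> q^`().[a] = 0 ->
  is_derive a (1 : R) (fun t => q.[clamp t]) 0.
Proof.
move=> ca qa.
suff H : (fun h => h^-1 *: (((fun t => q.[clamp t]) \o shift a) (h *: (1 : R)) - q.[clamp a])) @ 0^' --> (0 : R^o).
  by apply: DeriveDef; [apply/cvg_ex; exists 0|apply/cvg_lim].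
apply/cvgrPdist_le => /= e e0.
have cq : {for a, continuous (horner q^`())} by exact: continuous_horner.
have /cvgrPdist_le/(_ _ e0)/nbhs_ballP[r /= r0 Hr] := cq.
near=> h.
have h0 : h != 0 by near: h; exact: nbhs_dnbhs_neq.
have hr : `|h| < r by near: h; exact: dnbhs0_lt.
rewrite sub0r normrN normrM normfV ler_pdivrMl ?normr_gt0//.
set y := clamp _; have yh : `|y - a| <= `|h|.
  by rewrite -ca (le_trans (clamp_lip _ _))// [h *: _]mulr1 addrK.
have D t : is_derive t (1 : R) (fun t => q.[a + 1 * t]) (q^`().[a + 1 * t]).
  by have := is_derive_affine (is_derive_poly q (a + 1 * t)); rewrite [X in is_derive _ _ _ X -> _]mul1r.
have := @is_derive_mvt _ _ _ `|y - a| e D _ (y - a) (lexx _).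
rewrite mulr0 addr0 mul1r [a + (y - a)]addrC subrK => H.
rewrite ca; apply: le_trans (H _) _; last by rewrite ler_wpM2r// ltW.
move=> t ty; have := Hr (a + 1 * t); rewrite qa sub0r normrN; apply.
rewrite -ball_normE /= mul1r opprD addrA subrr add0r normrN.
by rewrite (le_lt_trans ty)// (le_lt_trans yh).
Unshelve. all: by end_near. Qed.

Lemma is_derive_clamp q t : q^`().[0] = 0 -> q^`().[1] = 0 ->
  is_derive t (1 : R) (fun t => q.[clamp t]) (q^`().[clamp t]).
Proof.
move=> q0 q1.
have [t0|t0|->] := ltgtP t 0; last 1 first.
- by rewrite clamp_le0// q0; apply: is_derive_kink => //; rewrite clamp_le0.
- rewrite clamp_le0 ?(ltW t0)// q0.
  apply: near_eq_is_derive (is_derive_cst q.[0] t (1 : R)).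
  near=> s; rewrite clamp_le0//; apply/ltW; near: s; exact: lt_nbhsl.
have [t1|t1|->] := ltgtP t 1; last 1 first.
- by rewrite clamp_ge1// q1; apply: is_derive_kink => //; rewrite clamp_ge1.
- rewrite clamp_id ?(ltW t0) ?(ltW t1)//.
  apply: near_eq_is_derive (is_derive_poly q t).
  near=> s; rewrite clamp_id//; apply/andP; split; apply/ltW; near: s; [exact: lt_nbhsr|exact: lt_nbhsl].
- rewrite clamp_ge1 ?(ltW t1)// q1.
  apply: near_eq_is_derive (is_derive_cst q.[1] t (1 : R)).
  near=> s; rewrite clamp_ge1//; apply/ltW; near: s; exact: lt_nbhsr.
Unshelve. all: by end_near. Qed.

(** A step that is C^m: clamping glues a polynomial to constants with which it
    has contact of order [m]. *)
Lemma step_jet m : exists phi : nat -> R -> R, [/\ jet m phi,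
  (forall t, t <= 0 -> phi 0%N t = 0), (forall t, 1 <= t -> phi 0%N t = 1),
  (forall j t, (0 < j <= m)%N -> ~~ (0 < t < 1) -> phi j t = 0) &
  exists2 C, 0 <= C & forall j t, (j <= m)%N -> `|phi j t| <= C].
Proof.
have [p [p0 p1 pj]] := step_poly m.
exists (fun j t => p^`(j).[clamp t]); split.
- split=> [j t jm|j _ t].
    have [d0 d1] := pj j.+1 jm; rewrite derivnS in d0 d1 *.
    exact: is_derive_clamp.
  by apply: continuous_comp; [exact: continuous_clamp|exact: continuous_horner].
- by move=> t t0; rewrite clamp_le0// derivn0.
- by move=> t t0; rewrite clamp_ge1// derivn0.
- move=> j t /pj[d0 d1]; have [t0 _|t0] := leP t 0; first by rewrite clamp_le0.
  by have [t1 _|t1 //] := leP 1 t; rewrite clamp_ge1.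
have [C C0 HC] := jet_bounded 1 (jet_poly m p).
exists C => // j t jm; apply: HC => //; have /andP[c0 c1] := clamp_bound t.
by rewrite ger0_norm.
Qed.

(** The difference of two consecutive translates of a step; the sum over
    integer translates telescopes. *)
Lemma bump_jet m : exists b : nat -> R -> R, [/\ jet m b,
  (forall j t, (j <= m)%N -> 1 <= `|t| -> b j t = 0),
  (forall n t, 0 <= t -> t + 1 <= n%:R -> \sum_(k < n) b 0%N (t - k%:R) = 1) &
  exists2 C, 0 <= C & forall j t, (j <= m)%N -> `|b j t| <= C].
Proof.
have [phi [jp p0 p1 pj [C C0 HC]]] := step_jet m.
exists (fun j t => phi j (1 + 1 * t) - phi j t); split.
- apply: jetB => //; split=> [j t jm|j jm t].
    by have := is_derive_affine (jp.1 j (1 + 1 * t) jm); rewrite [X in is_derive _ _ _ X -> _]mul1r.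
  apply: (@continuous_comp _ _ _ (fun t : R => 1 + 1 * t)); last exact: jp.2.
  by apply: cvgD; [exact: cvg_cst|apply: cvgM; [exact: cvg_cst|exact: cvg_id]].
- move=> j t jm; rewrite mul1r ler_normr => /orP[t1|t1].
    case: j jm => [|j] jm; first by rewrite !p1 ?subrr//; lra.
    by rewrite !pj ?subrr//; apply/negP => /andP[]; lra.
  case: j jm => [|j] jm; first by rewrite !p0 ?subrr//; lra.
  by rewrite !pj ?subrr//; apply/negP => /andP[]; lra.
- move=> n t t0 tn.
  have E k : (k <= n)%N -> \sum_(i < k) (phi 0%N (1 + 1 * (t - i%:R)) - phi 0%N (t - i%:R)) =
     phi 0%N (t + 1) - phi 0%N (t + 1 - k%:R).
    elim: k => [|k IH] kn; first by rewrite big_ord0 subr0 subrr.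
    rewrite big_ord_recr /= (IH (ltnW kn)) mul1r.
    have -> : 1 + (t - k%:R) = t + 1 - k%:R by ring.
    have -> : t + 1 - k.+1%:R = t - k%:R by rewrite -natr1; ring.
    ring.
  rewrite E// p1 ?p0 ?subr0//; lra.
- exists (C + C); first exact: addr_ge0.
  by move=> j t jm; rewrite (le_trans (ler_normB _ _))// lerD// HC.
Qed.

Lemma overlap_count n (t : R) : 0 <= t ->
  \sum_(k < n) ((`|t - k%:R| < 1)%R%:R : R) <= 2.
Proof.
move=> t0; pose k0 := Num.truncn t.
have /andP[k0t tk0] : k0%:R <= t < k0.+1%:R by exact: truncn_itv.
apply: (@le_trans _ _ (\sum_(k < n) ((k == k0 :> nat)%:R + (k == k0.+1 :> nat)%:R))).
  apply: ler_sum => k _; case: ltrP => [|_]; last by rewrite addr_ge0.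
  rewrite ltr_norml => /andP[h1 h2].
  have k1 : (k0 <= k)%N.
    by rewrite -ltnS -(ltr_nat R) -natr1; lra.
  have k2 : (k < k0.+2)%N.
    by rewrite -(ltr_nat R) -natr1; lra.
  have [->|kk] := eqVneq (k : nat) k0; first by rewrite lerDl.
  have -> : (k : nat) = k0.+1 by apply/eqP; rewrite eqn_leq -ltnS k2 ltn_neqAle eq_sym kk.
  by rewrite eqxx add0r.
rewrite big_split /=.
have H c : \sum_(k < n) ((k == c :> nat)%:R : R) <= 1.
  have [cn|cn] := ltnP c n.
    rewrite (bigD1 (Ordinal cn))//= eqxx big1 ?addr0// => i ic.
    by case: eqP => // ik; case/negP: ic; apply/eqP/val_inj.
  rewrite big1// => i _; rewrite (_ : _ == c = false)//.
  by apply/negP => /eqP ic; move: (ltn_ord i); rewrite ic ltnNge cn.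
by apply: le_trans (lerD (H _) (H _)) _.
Qed.

End SmoothStep.

(** * Density of polynomials in C^m *)

Section Density.
Variables (R : realType) (d : nat) (Om : set 'rV[R]_d).
Hypothesis oOm : open Om.
Hypothesis cOm : compact (closure Om).
Implicit Types (f g q : 'rV[R]_d -> R) (x y v c : 'rV[R]_d).
Local Notation ax := (axis R).

Lemma bnd_pointwise D r m e f : (forall x, D x -> bnd [set x] r m e f) -> bnd D r m e f.
Proof.
elim: m e f => [|m IH] e f H.
  by split=> // x Dx; exact: (bnd0 (H x Dx)).
split=> [x Dx|i]; first exact: (bnd0 (H x Dx)).
by apply: IH => x Dx; exact: (H x Dx).2.
Qed.

Lemma bnd_rescale D r m e f : 1 <= r -> 0 <= e -> bnd D r m e f -> bnd D 1 m (e * r ^+ m) f.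
Proof.
move=> r1; elim: m e f => [|m IH] e f e0 [bf df].
  by split=> // x Dx; rewrite expr0 mulr1; exact: bf.
split=> [x Dx|i].
  by rewrite (le_trans (bf x Dx))// ler_peMr// exprn_ege1.
have := IH _ _ (mulr_ge0 e0 (le_trans ler01 r1)) (df i).
by rewrite mulr1 exprS mulrA.
Qed.

Lemma smooth_prod m (I : Type) (s : seq I) (F : I -> 'rV[R]_d -> R) :
  (forall i, smooth Om m (F i)) -> smooth Om m (fun x => \prod_(i <- s) F i x).
Proof.
move=> sF; elim: s => [|i s IH].
  by apply: (smooth_eq oOm _ (smoothC Om m 1)) => x _; rewrite big_nil.
by apply: (smooth_eq oOm _ (smoothM oOm (sF i) IH)) => x _; rewrite big_cons.
Qed.

Lemma bnd_prod D r m (I : Type) (s : seq I) (F : I -> 'rV[R]_d -> R) (a : I -> R) :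
  D `<=` Om -> 0 <= r -> (forall i, 0 <= a i) ->
  (forall i, smooth Om m (F i)) -> (forall i, bnd D r m (a i) (F i)) ->
  bnd D r m (\prod_(i <- s) (2 ^+ m * a i)) (fun x => \prod_(i <- s) F i x).
Proof.
move=> DO r0 a0 sF bF; elim: s => [|i s IH].
  rewrite big_nil; apply: (bnd_eq oOm DO _ (@bndC _ _ D r m 1 1 r0 _)); last by rewrite normr1.
  by move=> x _; rewrite big_nil.
have p0 : 0 <= \prod_(j <- s) (2 ^+ m * a j).
  by apply: prodr_ge0 => j _; rewrite mulr_ge0// exprn_ge0.
rewrite big_cons -mulrA.
apply: (bnd_eq oOm DO _ (bndM oOm DO r0 (a0 i) p0 (sF i) (smooth_prod _ sF) (bF i) IH)).
by move=> x _; rewrite big_cons.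
Qed.

(** Every ball of small radius [h] that meets [Om] has a point [c + h v] of
    [Om] at distance O(h) from which the whole trace of the ball on [Om] can
    be seen. It is at this point that Taylor expansions are centred. *)
Definition visible := exists V : R, 0 < V /\ forall (h : R) c, 0 < h -> h * V < 1 ->
  (exists2 y, Om y & `|y - c| <= h) ->
  exists v, `|v| <= V /\ forall x, Om x -> `|x - c| <= h ->
    forall t : R, 0 <= t <= 1 -> Om (x + t *: (c + h *: v - x)).
Variables (m : nat) (U : Type) (K : set U).
Variable A : set (U -> 'rV[R]_d -> R).
Hypothesis cA : closed_algebra Om m K A.
Hypothesis Acoord : forall i, A (fun _ x => x 0 i).

Lemma alg_prod (I : Type) (s : seq I) (F : I -> U -> 'rV[R]_d -> R) :
  (forall i, A (F i)) -> A (fun u x => \prod_(i <- s) F i u x).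
Proof.
move=> AF; elim: s => [|i s IH].
  by apply: lin_eq (lin_cst (alg_lin cA) 1) _ => u x; rewrite big_nil.
by apply: lin_eq (alg_mul cA (AF i) IH) _ => u x; rewrite big_cons.
Qed.

Lemma alg_homog z n g : A (fun _ => homog z n g).
Proof.
have lA := alg_lin cA; elim: n g => [|n IH] g /=; first exact: (lin_cst lA).
apply: (lin_scale lA); apply: (lin_sum _ lA) => i; apply: (alg_mul cA); last exact: IH.
exact: (lin_add lA (Acoord i) (lin_cst lA _)).
Qed.

(** On the trace of a ball of radius [h], the Taylor polynomial at the point
    given by visibility has an error that is small at scale [h] in all
    derivatives. *)
Lemma local_approx f V rho om h c : smooth Om m f -> osc Om rho om m f ->
  0 < V -> 0 <= om -> 0 < h -> (1 + V) * h <= rho ->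
  ((exists2 y, Om y & `|y - c| <= h) ->
    exists v, `|v| <= V /\ forall x, Om x -> `|x - c| <= h ->
    forall t : R, 0 <= t <= 1 -> Om (x + t *: (c + h *: v - x))) ->
  exists q, [/\ smooth Om m q, A (fun _ => q) &
    forall x, Om x -> `|x - c| <= h ->
      bnd [set x] h^-1 m ((d.+1%:R * ((1 + V) * h)) ^+ m * om) (fun y => f y - q y)].
Proof.
move=> sf of_ V0 om0 h0 hrho Hv.
have [Hc|Hc] := pselect (exists2 y, Om y & `|y - c| <= h); last first.
  exists (fun=> 0); split; [exact: smoothC|exact: (lin_cst (alg_lin cA))|].
  by move=> x Ox xc; case: Hc; exists x.
have [v [vV seg]] := Hv Hc; have [y Oy yc] := Hc.
set z := c + h *: v in seg.
have Oz : Om z by have := seg y Oy yc 1; rewrite scale1r addrC subrK lexx ler01; exact.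
exists (tpoly z m f); split; first exact: smooth_tpoly.
  by apply: (lin_sum _ (alg_lin cA)) => i; exact: alg_homog.
move=> x Ox xc.
apply: (bnd_trem oOm Oz sf _ om0).
- exact: osc_le of_.
- by rewrite invr_ge0 ltW.
- rewrite -!mulrA divff ?gt_eqF// mulr1 -[leLHS]mulr1.
  by apply: ler_pM => //; [rewrite ler1n|rewrite lerDl ltW].
- move=> t /andP[t0 t1]; have := seg x Ox xc (1 - t).
  have -> : x + (1 - t) *: (z - x) = z + t *: (x - z).
    by apply/rowP => j; rewrite !mxE; ring.
  by apply; lra.
- rewrite /z opprD addrA (le_trans (ler_normB _ _))// mulrDl mul1r lerD//.
  by rewrite normrZ gtr0_norm// mulrC ler_wpM2r// ltW.
Qed.

(** Blend the local Taylor polynomials with a product partition of unity on a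
    grid of mesh [h]. Derivatives of order [j] of the partition cost [h^-j],
    whereas the local error has order [h^(m-j)] times the oscillation [om] of
    the top derivatives; at most [2 ^ d] members overlap, so the total error
    is a constant times [om]. *)
Theorem density f : visible -> smooth Om m f -> A (fun _ => f).
Proof.
move=> [V [V0 vis]] sf; have lA := alg_lin cA.
apply: (alg_clos cA); split.
  split=> [u _|]; first exact: sf.
  by have [M M0 bf] := smooth_bounded cOm ltr01 sf; exists M.
move=> e e0.
have [b [jb b0 bsum [C C0 bC]]] := bump_jet R m.
have [L L0 HL] : exists2 L, 0 <= L & forall x, Om x -> `|x| <= L.
  have [L L0 HL] := compact_norm_ub cOm.
  by exists L => // x Ox; apply: HL; exact: subset_closure.
have xL x i : Om x -> 0 <= x 0 i + L <= 2 * L.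
  move=> Ox; have := le_trans (rV_coord_le x i) (HL x Ox).
  by rewrite ler_norml => /andP[h1 h2]; apply/andP; split; lra.
(* [S] bounds the sum of the bounds of the members of the partition of unity
   that do not vanish at a given point: in each direction at most two
   translates of the bump do. *)
pose S : R := (2 ^+ m * C * 2) ^+ d.
have S0 : 0 <= S by rewrite exprn_ge0// !mulr_ge0// exprn_ge0.
pose D1 : R := (d.+1%:R * (1 + V)) ^+ m.
have D10 : 0 <= D1 by rewrite exprn_ge0// mulr_ge0// addr_ge0// ltW.
pose T := 2 ^+ m * S * D1.
have T0 : 0 <= T by rewrite !mulr_ge0// exprn_ge0.
pose om := e / (T + 1).
have om0 : 0 < om by rewrite divr_gt0// ltr_wpDl.
have [rho rho0 fosc] := smooth_osc cOm sf om0.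
have V10 : 0 < 1 + V by rewrite addr_gt0.
(* A mesh for which visibility applies and on which the oscillation of the
   derivatives of order [m] is at most [om]. *)
have [h [h0 h1 hV hrho]] : exists h : R, [/\ 0 < h, h <= 1, h * V < 1 & (1 + V) * h <= rho].
  exists (Num.min (1 + V)^-1 (rho / (1 + V))).
  have hm : Num.min (1 + V)^-1 (rho / (1 + V)) <= (1 + V)^-1 by rewrite ge_min lexx.
  split.
  - by rewrite lt_min invr_gt0 V10 divr_gt0.
  - by apply: (le_trans hm); rewrite invf_le1// lerDl ltW.
  - apply: (@le_lt_trans _ _ ((1 + V)^-1 * V)); first by rewrite ler_wpM2r// ltW.
    by rewrite ltr_pdivrMl// mulr1 ltrDr.
  - by rewrite mulrC -ler_pdivlMr// ge_min lexx orbT.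
have hi0 : 0 < h^-1 by rewrite invr_gt0.
pose n := (Num.truncn (2 * L / h + 1)).+1.
have nL : 2 * L / h + 1 <= n%:R by apply/ltW; rewrite truncnS_gt.
pose cen (k : {ffun 'I_d -> 'I_n}) : 'rV[R]_d := \row_i ((k i)%:R * h - L).
pose G := (d.+1%:R * ((1 + V) * h)) ^+ m * om.
have G0 : 0 <= G.
  by rewrite mulr_ge0 ?(ltW om0)// exprn_ge0// mulr_ge0// mulr_ge0 ?ltW.
have /choice[q Hq] : forall k : {ffun 'I_d -> 'I_n}, exists q, [/\ smooth Om m q, A (fun _ => q) &
    forall x, Om x -> `|x - cen k| <= h -> bnd [set x] h^-1 m G (fun y => f y - q y)].
  move=> k; apply: (local_approx sf fosc V0 (ltW om0) h0 hrho).
  exact: vis h0 hV.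
pose w (i : 'I_d) (j : nat) (x : 'rV[R]_d) : R := h^-1 * (x 0 i + L) - j%:R.
have sw i j : smooth Om m (w i j).
  apply: smoothB => //; last exact: smoothC.
  by apply: smoothZ => //; apply: smoothD => //; [exact: smooth_coord|exact: smoothC].
have dw i j l x : Om x -> 'D_(ax l) (w i j) x = h^-1 * (i == l)%:R.
  move=> Ox.
  have H2 : is_derive x (ax l) (fun y : 'rV[R]_d => y 0 i) (i == l)%:R.
    by apply: DeriveDef; [exact: derivable_coord|exact: (congr1 (fun F : 'rV[R]_d -> R => F x) (derive_coord R i l))].
  have H3 := is_deriveB (is_deriveZ h^-1 (is_deriveD H2 (is_derive_cst L x (ax l)))) (is_derive_cst (j%:R : R) x (ax l)).
  by rewrite (@derive_val _ _ _ _ _ _ _ H3) subr0 addr0.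
pose beta (k : {ffun 'I_d -> 'I_n}) (x : 'rV[R]_d) := \prod_i b 0%N (w i (k i) x).
have sbw i j : smooth Om m (b 0%N \o w i j) by exact: smooth_comp.
have sbeta k : smooth Om m (beta k).
  exact: (smooth_prod _ (fun i => sbw i (k i))).
have beta1 x : Om x -> \sum_k beta k x = 1.
  move=> Ox; rewrite /beta -(bigA_distr_bigA (fun i (j : 'I_n) => b 0%N (w i j x))).
  rewrite big1// => i _; have /andP[xL0 xL2] := xL x i Ox; apply: bsum.
    by apply: mulr_ge0 => //; exact: ltW.
  apply: le_trans nL; rewrite lerD2r mulrC ler_wpM2r//; exact: ltW.
exists (fun _ x => \sum_k beta k x * q k x).
  apply: (lin_sum _ lA) => k; apply: (alg_mul cA); last by case: (Hq k).
  apply: alg_prod => i; apply: (alg_comp oOm cA _ jb).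
  have H := lin_add lA (lin_scale lA h^-1 (lin_add lA (Acoord i) (lin_cst lA L))) (lin_cst lA (- (k i)%:R)).
  exact: H.
move=> u Ku.
have -> : e = e * 1 by rewrite mulr1.
have key : bnd Om h^-1 m (2 ^+ m * S * G) (fun x => f x - \sum_k beta k x * q k x).
  apply: bnd_pointwise => x Ox.
  have xO : [set x] `<=` Om by move=> _ ->.
  (* [chi] detects the translates of the bump that do not vanish at [x]. *)
  pose chi (i : 'I_d) (j : 'I_n) : R := (`|w i j x| < 1)%R%:R.
  pose P (k : {ffun 'I_d -> 'I_n}) := \prod_i (2 ^+ m * (C * chi i (k i))).
  have chi0 i j : 0 <= C * chi i j by rewrite mulr_ge0.
  have bb i j : bnd [set x] h^-1 m (C * chi i j) (b 0%N \o w i j).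
    apply: (bnd_comp_affine oOm xO jb (ltW hi0) (chi0 i j) (sw i j) (dw i j)).
      move=> l; rewrite normrM (gtr0_norm hi0) ler_piMr ?(ltW hi0)//.
      by case: (i == l); rewrite ?normr1 ?normr0.
    move=> l _ lm ->; rewrite /chi; case: ltP => [_|w1]; first by rewrite mulr1 bC.
    by rewrite b0// normr0 mulr0.
  have bbeta k : bnd [set x] h^-1 m (P k) (beta k).
    by apply: (bnd_prod _ xO (ltW hi0) _ (fun i => sbw i (k i)) (fun i => bb i (k i))) => i.
  have P0 k : 0 <= P k by apply: prodr_ge0 => i _; rewrite mulr_ge0// exprn_ge0.
  have sfq k : smooth Om m (fun y => f y - q k y).
    by apply: smoothB => //; case: (Hq k).
  have bterm k : bnd [set x] h^-1 m (2 ^+ m * (P k * G)) (fun y => beta k y * (f y - q k y)).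
    have [/existsP[i /eqP Hi]|Hk] := boolP [exists i, chi i (k i) == 0].
      have PE : P k = 0 by rewrite /P (bigD1 i)//= Hi !mulr0 mul0r.
      have [N N0 bN] := smooth_bounded cOm hi0 (sfq k).
      have := bndM oOm xO (ltW hi0) (P0 k) N0 (sbeta k) (sfq k) (bbeta k) (bnd_sub xO bN).
      by rewrite PE !mul0r.
    apply: (bndM oOm xO (ltW hi0) (P0 k) G0 (sbeta k) (sfq k) (bbeta k)).
    have [_ _ H] := Hq k; apply: H => //.
    apply: rV_norm_le => [|i]; first exact: ltW.
    move: Hk; rewrite negb_exists => /forallP/(_ i); rewrite /chi pnatr_eq0 eqb0 negbK => wi.
    rewrite !mxE; have -> : x 0 i - ((k i)%:R * h - L) = h * w i (k i) x.
      by rewrite /w mulrBr mulVKf ?gt_eqF//; ring.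
    by rewrite normrM (gtr0_norm h0) ler_piMr ?ltW.
  have := bnd_sum oOm (index_enum {ffun 'I_d -> 'I_n}) xO (ltW hi0)
     (fun k => smoothM oOm (sbeta k) (sfq k)) bterm.
  move=> H.
  have {}H : bnd [set x] h^-1 m (\sum_k 2 ^+ m * (P k * G)) (fun x => f x - \sum_k beta k x * q k x).
    apply: (bnd_eq oOm xO _ H) => y Oy.
    under eq_bigr do rewrite mulrBr.
    by rewrite sumrB -mulr_suml beta1// mul1r.
  apply: bnd_mono H; first exact: ltW.
  rewrite -mulr_sumr -mulr_suml -mulrA ler_wpM2l ?exprn_ge0// ler_wpM2r//.
  rewrite /P -(bigA_distr_bigA (fun i (j : 'I_n) => 2 ^+ m * (C * chi i j))) /S.
  rewrite -[X in _ <= _ ^+ X]card_ord -prodr_const; apply: ler_prod => i _.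
  rewrite sumr_ge0/= => [|j _]; last by rewrite mulr_ge0// exprn_ge0.
  rewrite -mulr_sumr -mulr_sumr mulrA ler_wpM2l ?mulr_ge0 ?exprn_ge0//.
  apply: overlap_count; have /andP[xL0 _] := xL x i Ox.
  by apply: mulr_ge0 => //; exact: ltW.
have r1 : 1 <= h^-1 by rewrite invf_ge1.
have SG0 : 0 <= 2 ^+ m * S * G by do 2![apply: mulr_ge0 => //]; exact: exprn_ge0.
apply: bnd_mono (bnd_rescale r1 SG0 key) => //.
have -> : 2 ^+ m * S * G * h^-1 ^+ m = T * om.
  rewrite /G /T /D1 mulrA exprMn [((1 + V) * h) ^+ m]exprMn exprMn.
  have : h ^+ m * h^-1 ^+ m = 1 by rewrite -exprMn divff ?expr1n// gt_eqF.
  move: (h ^+ m) (h^-1 ^+ m) => hm him E.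
  have -> : forall a1 a2 a3 a4 : R, a1 * a2 * (a3 * (a4 * hm)) * om * him = a1 * a2 * (a3 * a4) * om * (hm * him).
    by move=> *; ring.
  by rewrite E mulr1.
by rewrite mulr1 /om mulrCA ler_piMr ?(ltW e0)// ler_pdivrMr ?ltr_wpDl// mul1r lerDl.
Qed.

End Density.

(** * Visibility in Lipschitz domains *)

Section Lipschitz.
Variables (R : realType) (d : nat).
Implicit Types (u v e x y : 'rV[R]_d).

Lemma dotpDl u v e : dotp (u + v) e = dotp u e + dotp v e.
Proof. by rewrite /dotp -big_split; apply: eq_bigr => i _; rewrite mxE mulrDl. Qed.

Lemma dotpZl a u e : dotp (a *: u) e = a * dotp u e.
Proof. by rewrite /dotp mulr_sumr; apply: eq_bigr => i _; rewrite mxE mulrA. Qed.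

Lemma dotpBl u v e : dotp (u - v) e = dotp u e - dotp v e.
Proof. by rewrite dotpDl -scaleN1r dotpZl mulN1r. Qed.

Lemma unit_norm e : dotp e e = 1 -> `|e| <= 1.
Proof.
move=> ee; apply: rV_norm_le => // i.
rewrite -(@ler_pXn2r _ 2) ?nnegrE// expr1n -ee /dotp (bigD1 i)//= real_normK ?num_real//.
by rewrite -expr2 lerDl sumr_ge0// => j _; rewrite -expr2 sqr_ge0.
Qed.

Lemma dotp_le u e : dotp e e = 1 -> `|dotp u e| <= d%:R * `|u|.
Proof.
move=> /unit_norm e1; rewrite (le_trans (ler_norm_sum _ _ _))//.
rewrite -[d in d%:R]card_ord mulr_natl -sumr_const; apply: ler_sum => i _.
rewrite normrM -[leRHS]mulr1 ler_pM//; first exact: rV_coord_le.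
exact: le_trans (rV_coord_le e i) e1.
Qed.

Lemma bounded_closure_compact (A : set 'rV[R]_d) : bounded_set A -> compact (closure A).
Proof.
move=> [M [Mr HM]]; apply: bounded_closed_compact; last exact: closed_closure.
exists (M + 1); split; first exact: num_real.
move=> N MN x cx.
have [y [Ay xy]] := cx _ (nbhsx_ballx x ((N - (M + 1)) / 2) ltac:(by rewrite divr_gt0// subr_gt0)).
have yM : `|y| <= M + 1 by apply: HM; rewrite ?ltrDl.
rewrite -ball_normE /= in xy.
have := ler_normD (x - y) y; rewrite subrK => /le_trans; apply; lra.
Qed.

(** Near a boundary point, moving from [c] by a large enough multiple [C h] of
    the inner direction [e] leads to a point whose segments to the ball climb
    more steeply than the boundary graph. Compactness of the closure makes the
    constant uniform. *)
Lemma lipschitz_visible (Omega : lipschitz_domain R d) : visible (dom Omega).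
Proof.
have oO := @dom_open _ _ Omega.
have /near_covering_withinP : near_covering (closure (dom Omega)).
  apply/compact_near_coveringP/bounded_closure_compact; exact: dom_bounded.
pose P (V : R) y := forall (h : R) c, 0 < h -> h * V < 1 -> `|y - c| <= h ->
  exists v, `|v| <= V /\ forall x, dom Omega x -> `|x - c| <= h ->
    forall t : R, 0 <= t <= 1 -> dom Omega (x + t *: (c + h *: v - x)).
move=> /(_ R +oo P _) H.
have Hnear x0 r : 0 < r -> forall (C : R), 0 <= C ->
   (forall V y, (C + 6) * (2 / r + 1) <= V -> `|x0 - y| < r / 2 -> P V y) ->
   \forall x' \near x0 & i \near +oo, closure (dom Omega) x' -> P i x'.
  move=> r0 C C0 HP.
  exists (ball x0 (r / 2), [set V : R | (C + 6) * (2 / r + 1) <= V]).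
    split => /=; first by apply: nbhsx_ballx; rewrite divr_gt0.
    by apply: nbhs_pinfty_ge; exact: num_real.
  by move=> [y V] /= [yx HV] _; apply: HP => //; rewrite -ball_normE in yx.
have hsmall (r C V h : R) : 0 < r -> 0 <= C -> 0 < h -> (C + 6) * (2 / r + 1) <= V ->
    h * V < 1 -> [/\ h * (C + 6) < r / 2, C <= V & 0 <= V].
  move=> r0 C0 h0 HV hV.
  have r2 : 0 < 2 / r by rewrite divr_gt0.
  have h1 : h * ((C + 6) * (2 / r + 1)) < 1.
    by apply: le_lt_trans hV; rewrite ler_wpM2l// ltW.
  have h2 : h * (C + 6) * (2 / r) < 1.
    apply: le_lt_trans h1; rewrite -mulrA ler_wpM2l ?(ltW h0)//.
    by rewrite ler_wpM2l ?addr_ge0// lerDl.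
  have h3 : C <= V.
    apply: le_trans HV; apply: (@le_trans _ _ (C + 6)); first by rewrite lerDl.
    by rewrite ler_peMr ?addr_ge0// lerDr ltW.
  split=> //; last exact: le_trans h3.
  by move: h2; rewrite mulrA ltr_pdivrMr// mul1r; lra.
case: H => [x0 cx0|V /= [Vr HV]]; last first.
  pose W := Num.max V 0 + 1.
  exists W; split; first by rewrite ltr_wpDl// le_max lexx orbT.
  move=> h c h0 hW [y Oy yc].
  have := HV W; rewrite /W (le_lt_trans (_ : V <= Num.max V 0))//; last 2 first.
    by rewrite le_max lexx.
    by rewrite ltrDl.
  by move=> /(_ isT y (@subset_closure _ _ _ Oy) h c h0 hW yc).
have [iO|niO] := pselect ((dom Omega)° x0).
  have /nbhs_ballP[r /= r0 Hr] := iO.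
  apply: (Hnear x0 r r0 0 (lexx 0)) => V y HV yx h c h0 hV yc.
  have [h1 _ V0] := hsmall r 0 V h r0 (lexx 0) h0 HV hV.
  exists 0; split; first by rewrite normr0.
  move=> x Ox xc t /andP[t0 t1]; apply: Hr; rewrite -ball_normE /=.
  have -> : x0 - (x + t *: (c + h *: 0 - x)) = (x0 - y) + (y - c) + (1 - t) *: (c - x).
    by apply/rowP => j; rewrite !mxE; ring.
  rewrite (le_lt_trans (ler_normD _ _))//.
  have hx : `|(1 - t) *: (c - x)| <= h.
    rewrite normrZ ger0_norm ?subr_ge0// distrC -[leRHS]mul1r ler_pM ?subr_ge0//.
    by rewrite gerBl.
  have := ler_normD (x0 - y) (y - c); lra.
have [e [gam [M [r [ee r0 lip Hr]]]]] := @dom_lipschitz _ _ Omega x0 (conj cx0 niO).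
(* Up to the parameter [t], a segment that starts in the ball climbs by at
   least [t h C - t d h] along [e], while the graph rises by at most
   [`|M| t (1 + d) h]. *)
pose C := d%:R + `|M| * (1 + d%:R).
have C0 : 0 <= C by rewrite addr_ge0// mulr_ge0// addr_ge0.
have e1 := unit_norm ee.
apply: (Hnear x0 r r0 C C0) => V y HV yx h c h0 hV yc.
have [h1 CV V0] := hsmall r C V h r0 C0 h0 HV hV.
exists (C *: e); split.
  by rewrite normrZ ger0_norm// (le_trans _ CV)// ler_piMr.
move=> x Ox xc t /andP[t0 t1].
pose p := x + t *: (c + h *: (C *: e) - x); rewrite -/p.
have pE : p = x + t *: (c - x) + (t * h * C) *: e.
  by apply/rowP => j; rewrite !mxE; ring.
have hC0 : 0 <= h * C by rewrite mulr_ge0// ltW.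
have tx : `|t *: (c - x)| <= t * h.
  by rewrite normrZ ger0_norm// ler_wpM2l// distrC.
have th : t * h <= h by rewrite ler_piMl// ltW.
have thC : `|(t * h * C) *: e| <= h * C.
  rewrite normrZ ger0_norm; last by rewrite -mulrA mulr_ge0.
  rewrite -[leRHS]mulr1 ler_pM//; first by rewrite -mulrA mulr_ge0.
  by rewrite ler_wpM2r.
have xx0 : `|x - x0| < r.
  have -> : x - x0 = - (x0 - y) - (y - c) + (x - c) by apply/rowP => j; rewrite !mxE; ring.
  rewrite (le_lt_trans (ler_normD _ _))//.
  have := ler_normB (- (x0 - y)) (y - c); rewrite normrN; nra.
have px0 : `|p - x0| < r.
  have -> : p - x0 = - (x0 - y) - (y - c) + (x - c) + t *: (c - x) + (t * h * C) *: e.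
    by rewrite pE; apply/rowP => j; rewrite !mxE; ring.
  rewrite (le_lt_trans (ler_normD _ _))//.
  have := ler_normB (- (x0 - y)) (y - c); rewrite normrN.
  have := ler_normD (- (x0 - y) - (y - c)) (x - c).
  have := ler_normD (- (x0 - y) - (y - c) + (x - c)) (t *: (c - x)).
  by nra.
apply/(Hr p px0); have /(Hr x xx0) gx := Ox.
have dp : dotp p e = dotp x e + t * dotp (c - x) e + t * h * C.
  by rewrite pE 2!dotpDl !dotpZl ee mulr1.
pose pi w := w - dotp w e *: e.
have pi0 w : dotp (pi w) e = 0 by rewrite dotpBl dotpZl ee mulr1 subrr.
have pip : pi p - pi x = t *: (c - x - dotp (c - x) e *: e).
  by rewrite /pi dp pE; apply/rowP => j; rewrite !mxE; ring.
have cxh : `|c - x| <= h by rewrite distrC.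
have dcx := le_trans (dotp_le (c - x) ee) (ler_wpM2l (ler0n R d) cxh).
have := lip (pi p, pi x); rewrite /= => /(_ (conj (pi0 p) (pi0 x))) lipg.
have npi : `|pi p - pi x| <= t * ((1 + d%:R) * h).
  rewrite pip normrZ ger0_norm// ler_wpM2l// mulrDl mul1r.
  rewrite (le_trans (ler_normB _ _))// lerD// normrZ -[leRHS]mulr1 ler_pM//.
have gpx : gam (pi p) - gam (pi x) <= `|M| * (t * ((1 + d%:R) * h)).
  rewrite (le_trans (ler_norm _))// (le_trans lipg)// (le_trans (ler_wpM2r _ (ler_norm M)))//.
  by rewrite ler_wpM2l.
have dcx' : - (t * (d%:R * h)) <= t * dotp (c - x) e.
  by rewrite -mulrN ler_wpM2l//; move: dcx; rewrite ler_norml => /andP[].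
rewrite -/(pi p) dp; rewrite -/(pi x) in gx.
have -> : t * h * C = t * (d%:R * h) + `|M| * (t * ((1 + d%:R) * h)) by rewrite /C; ring.
lra.
Qed.

End Lipschitz.

(** * Lebesgue measure of open sets and weighted integrals *)

Section Lebesgue.
Variables (R : realType) (d : nat).
Implicit Types (c x : 'rV[R]_d) (A O : set 'rV[R]_d).

Definition box n (c : 'rV[R]_n) (r : R) : set 'rV[R]_n := [set x | forall i, `|x 0 i - c 0 i| < r].

Lemma measurable_box n (c : 'rV[R]_n) r : measurable (box c r).
Proof.
have -> : box c r = \bigcap_(i in [set: 'I_n]) (@coord_mx R n i @^-1` [set t | `|t - c 0 i| < r]).
  by apply/seteqP; split => x /= H i => [_|]; [exact: H|exact: (H i I)].
apply: fin_bigcap_measurable; first exact: finite_finset.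
move=> i _.
rewrite -[X in measurable X]setTI; apply: measurable_coord_mx => //.
have -> : [set t | `|t - c 0 i| < r] = [set` `]c 0 i - r, c 0 i + r[].
  by apply/seteqP; split => t /=; rewrite in_itv/= ltr_distl.
exact: measurable_itv.
Qed.

Lemma box_ball c r : 0 < r -> box c r = ball c r.
Proof.
move=> r0; apply/seteqP; split => x.
  move=> H; rewrite -ball_normE /= distrC.
  rewrite [ltLHS]/Num.norm/= mx_normrE; apply/bigmax_ltP; split=> //.
  by move=> [i j] _ /=; rewrite ord1 !mxE; exact: H.
rewrite -ball_normE /= distrC => H i.
by have := le_lt_trans (rV_coord_le (x - c) i) H; rewrite !mxE.
Qed.

(** An open set is the union of the boxes with rational centre and inverse
    integer size that it contains. *)
Lemma open_borel O : open O -> measurable O.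
Proof.
move=> oO.
pose rc (q : 'rV[rat]_d) : 'rV[R]_d := map_mx ratr q.
pose F (p : 'rV[rat]_d * nat) : set 'rV[R]_d :=
  if `[< box (rc p.1) p.2.+1%:R^-1 `<=` O >] then box (rc p.1) p.2.+1%:R^-1 else set0.
have -> : O = \bigcup_p F p.
  apply/seteqP; split => [x Ox|x [p _]]; last first.
    by rewrite /F; case: ifPn => // /asboolP; exact.
  have /nbhs_ballP[r /= r0 Hr] : nbhs x O by exact: open_nbhs_nbhs.
  have [n n2] : exists n, 2 * n.+1%:R^-1 < r.
    exists (Num.truncn (2 / r)); rewrite ltr_pdivrMr ?ltr0n// mulrC -ltr_pdivrMr//.
    exact: truncnS_gt.
  have n0 : 0 < n.+1%:R^-1 :> R by rewrite invr_gt0 ltr0n.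
  have [e eE] : exists e : R, e = n.+1%:R^-1 by exists n.+1%:R^-1.
  rewrite -eE in n0 n2.
  have /choice[q Hq] : forall i : 'I_d, exists q : rat, `|x 0 i - ratr q| < e.
    move=> i; have [|q] := @rat_in_itvoo R (x 0 i - e) (x 0 i + e); first by lra.
    by rewrite in_itv/= => /andP[h1 h2]; exists q; rewrite ltr_norml; apply/andP; split; lra.
  exists (\row_i q i, n) => //.
  have xb : box (rc (\row_i q i)) e x by move=> i; rewrite !mxE; exact: Hq.
  rewrite /F /= asboolT -eE// => y; rewrite !box_ball// in xb * => yb.
  apply: Hr; rewrite -!ball_normE /= in xb yb *.
  rewrite -(subrKA (rc (\row_i q i))) (le_lt_trans (ler_normD _ _))//.
  rewrite distrC in xb; lra.
apply: countable_bigcupT_measurable => // p; rewrite /F.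
by case: ifP => // _; exact: measurable_box.
Qed.

Lemma open_lebesgue O : open O -> measurable (O : set (lebesgueT R d)).
Proof. by move=> oO; apply: caratheodory_measurable_mu_ext; exact: open_borel. Qed.

Lemma lebesgue_rVE A : measurable A -> lebesgue_rV R d A = borel_lebesgue_rV R d A.
Proof. by move=> mA; rewrite /lebesgue_rV /completed_measure_extension measurable_mu_extE. Qed.

End Lebesgue.

Lemma cons_rV0 (R : realType) n (t : R) (x : 'rV[R]_n) : cons_rV (t, x) 0 ord0 = t.
Proof.
have -> : ord0 = lshift n (ord0 : 'I_1) by apply: val_inj.
by apply: (etrans (row_mxEl _ _ _ _)); rewrite mxE.
Qed.

Lemma cons_rVS (R : realType) n (t : R) (x : 'rV[R]_n) i : cons_rV (t, x) 0 (lift ord0 i) = x 0 i.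
Proof.
have -> : lift ord0 i = rshift 1 i by apply: val_inj.
exact: row_mxEr.
Qed.

Lemma borel_box (R : realType) n (c : 'rV[R]_n) (r : R) : 0 < r ->
  (0 < borel_lebesgue_rV R n (box c r) < +oo)%E.
Proof.
move=> r0; elim: n c => [|n IH] c /=.
  rewrite diracE (_ : _ \in _); last by rewrite inE => -[].
  by rewrite lte01 ltry.
pose c' : 'rV[R]_n := \row_i c 0 (lift ord0 i).
rewrite /lebesgue_rV_succ /pushforward.
have -> : @cons_rV R n @^-1` box c r = [set` `]c 0 ord0 - r, c 0 ord0 + r[] `*` box c' r.
  apply/seteqP; split => -[t x] /=.
    move=> H; split.
      by have := H ord0; rewrite cons_rV0 in_itv/= ltr_distl.
    by move=> i; have := H (lift ord0 i); rewrite cons_rVS !mxE.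
  move=> [H0 H] i; case: (unliftP ord0 i) => [j ->|->].
    by rewrite cons_rVS; have := H j; rewrite mxE.
  by rewrite cons_rV0 ltr_distl; move: H0; rewrite in_itv.
rewrite product_measure1E//=; last exact: measurable_box.
have /andP[h1 h2] := IH c'.
rewrite lebesgue_measure_itv/= lte_fin ifT; last by lra.
rewrite -EFinB (_ : _ - _ = 2 * r); last by ring.
rewrite mule_gt0 ?lte_fin ?mulr_gt0//=.
by rewrite lte_mul_pinfty ?lee_fin ?mulr_ge0 ?ltW.
Qed.

Section Integral.
Variables (R : realType) (d : nat) (Om : set 'rV[R]_d).
Hypothesis oOm : open Om.
Hypothesis bOm : bounded_set Om.
Local Notation mu := (lebesgue_rV R d).

Lemma lebesgue_fin : (mu Om < +oo)%E.
Proof.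
have [M [_ HM]] := bOm.
have Ob : Om `<=` box (0 : 'rV[R]_d) (`|M| + 2).
  move=> x Ox i; rewrite mxE subr0 (le_lt_trans (rV_coord_le x i))//.
  apply: (@le_lt_trans _ _ (`|M| + 1)); last by rewrite ltrD2l ltr1n.
  by apply: HM => //; rewrite (le_lt_trans (ler_norm M))// ltrDl.
have b0 : 0 < `|M| + 2 by rewrite ltr_wpDl.
have /andP[_ hb] := borel_box (0 : 'rV[R]_d) b0.
rewrite lebesgue_rVE; last exact: open_borel.
apply: le_lt_trans hb; apply: le_measure => //; rewrite inE.
  exact: open_borel.
exact: measurable_box.
Qed.

Lemma lebesgue_pos (O : set 'rV[R]_d) : open O -> O !=set0 -> (0 < mu O)%E.
Proof.
move=> oO [x Ox]; have /nbhs_ballP[r /= r0 Hr] : nbhs x O by exact: open_nbhs_nbhs.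
rewrite lebesgue_rVE; last exact: open_borel.
have /andP[hb _] := borel_box x r0.
apply: (lt_le_trans hb); apply: le_measure; rewrite ?inE.
- exact: measurable_box.
- exact: open_borel.
- by rewrite box_ball.
Qed.

Lemma cont_measurable (f : 'rV[R]_d -> R) : {within Om, continuous f} ->
  measurable_fun (Om : set (lebesgueT R d)) f.
Proof.
move=> cf; apply: (measurability _ (measurable_realfun.RGenOpens.measurableE R)).
move=> _ [_ [a [b ->] <-]].
have ab : open `]a, b[%classic by exact: interval_open.
have /continuousP/(_ _ ab)/open_subspaceP[V oV VD] := cf.
by rewrite setIC -VD; apply: open_lebesgue; exact: openI.
Qed.

Lemma cont_integrable (f : 'rV[R]_d -> R) M : {within Om, continuous f} ->
  (forall x, Om x -> `|f x| <= M) -> mu.-integrable Om (EFin \o f).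
Proof.
move=> cf fM; apply: measurable_bounded_integrable.
- exact: open_lebesgue.
- exact: lebesgue_fin.
- exact: cont_measurable.
- exists M; split; first exact: num_real.
  by move=> N MN x Ox; rewrite /= (le_trans (fM x Ox))// ltW.
Qed.

Lemma within_contM (f g : 'rV[R]_d -> R) : {within Om, continuous f} ->
  {within Om, continuous g} -> {within Om, continuous (fun x => f x * g x)}.
Proof. by move=> cf cg x; exact: (cvgM (cf x) (cg x)). Qed.

Variable eta : 'rV[R]_d -> R.
Hypothesis eta0 : forall y, Om y -> 0 <= eta y.
Hypothesis eta_neg : mu.-negligible [set y | Om y /\ eta y = 0].
Hypothesis ceta : {within Om, continuous eta}.
Variable E : R.
Hypothesis etaE : forall y, Om y -> `|eta y| <= E.

(** A vanishing integral would force [w ^+ 2 * eta] to vanish almost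
    everywhere, hence so would [w], as [eta] is nonzero almost everywhere; but
    [w] is nonzero on a nonempty open set. *)
Lemma integral_sq_pos (w : 'rV[R]_d -> R) M : {within Om, continuous w} ->
  (forall x, Om x -> `|w x| <= M) -> (exists2 y, Om y & w y != 0) ->
  0 < \int[mu]_(y in Om) (w y * w y * eta y).
Proof.
move=> cw wM [y0 Oy0 wy0]; pose g y := w y * w y * eta y.
have cg : {within Om, continuous g}.
  by apply: within_contM => //; exact: within_contM.
have gM x : Om x -> `|g x| <= M * M * E.
  move=> Ox; rewrite !normrM ler_pM ?mulr_ge0//; [|exact: etaE].
  by rewrite ler_pM// wM.
have g0 x : Om x -> 0 <= g x.
  by move=> Ox; rewrite mulr_ge0 ?eta0// -expr2 sqr_ge0.
have ig := cont_integrable cg gM.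
have mO := open_lebesgue oOm.
rewrite lt_neqAle Rintegral_ge0// andbT eq_sym; apply/eqP => I0.
have I0' : (\int[mu]_(y in Om) `|(EFin \o g) y| = 0)%E.
  have -> : (\int[mu]_(y in Om) `|(EFin \o g) y| = \int[mu]_(y in Om) (EFin \o g) y)%E.
    by apply: eq_integral => y; rewrite inE => Oy; rewrite /= ger0_norm// g0.
  by rewrite -(fineK (integrable_fin_num mO ig)); congr EFin.
have := (ae_eq_integral_abs mu mO (measurable_int mu ig)).1 I0'.
move=> gae.
(* The open set where [w] is nonzero is covered by two negligible sets. *)
pose U := Om `&` [set y | w y != 0].
have oU : open U.
  have /continuousP/(_ [set t : R | t != 0]) := cw.
  have on0 : open [set t : R | t != 0].
    rewrite (_ : [set t : R | t != 0] = ~` [set 0]); last first.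
      by apply/seteqP; split=> t /=; [move/eqP|move/eqP].
    by rewrite openC; exact: closed_eq.
  move=> /(_ on0)/open_subspaceP[V oV VD].
  by rewrite /U setIC (_ : _ `&` Om = V `&` Om)//; exact: openI.
have : mu.-negligible U.
  apply: (negligibleS _ (negligibleU eta_neg gae)) => y [Oy wy] /=.
  have [ey|ey] := eqVneq (eta y) 0; first by left.
  right => /(_ Oy) /= [gy]; move/eqP: gy; rewrite !mulf_eq0 (negbTE wy) (negbTE ey).
  by [].
rewrite negligibleP; last exact: open_lebesgue.
move=> U0; have : (0 < mu U)%E by apply: lebesgue_pos => //; exists y0.
by rewrite U0 ltxx.
Qed.

End Integral.

(** * Iterated partial derivatives of vector-valued functions *)

Section Conversion.
Variables (R : realType) (d : nat) (Om : set 'rV[R]_d).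
Hypothesis oOm : open Om.
Implicit Types (f g : 'rV[R]_d -> R).
Local Notation ax := (axis R).

Lemma Cs_on_smooth m D f : Cs_on m Om D f -> closure Om `<=` D -> smooth Om m f.
Proof.
move=> [df _ ef _] cD.
suff H j l : (size l + j <= m)%N -> smooth Om j (partials l f) by exact: (H m [::]).
elim: j l => [|j IH] l lj.
  split=> //; have [|g cg gE] := ef l; first by rewrite addn0 in lj.
  by exists g => //; exact: continuous_subspaceW cg.
split=> [|i].
  have [|g cg gE] := ef l; first by apply: leq_trans lj; exact: leq_addr.
  by exists g => //; exact: continuous_subspaceW cg.
split; last by apply: (IH (i :: l)); rewrite /= addSnnS.
by move=> x Ox; apply: df => //; apply: leq_trans lj; rewrite addnS ltnS leq_addr.
Qed.

Lemma smooth_partials m f l : smooth Om m f -> (size l <= m)%N ->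
  smooth Om (m - size l) (partials l f).
Proof.
move=> sf; elim: l => [|i l IH] /= lm; first by rewrite subn0.
have := IH (ltnW lm); rewrite -(subnSK lm) => H.
exact: (H.2 i).2.
Qed.

Lemma bnd_partials m f l e : bnd Om 1 m e f -> (size l <= m)%N ->
  bnd Om 1 (m - size l) e (partials l f).
Proof.
move=> bf; elim: l => [|i l IH] /= lm; first by rewrite subn0.
have := IH (ltnW lm); rewrite -(subnSK lm) => H.
by have := H.2 i; rewrite mulr1.
Qed.

Lemma smooth_derivable m f l i x : smooth Om m f -> (size l < m)%N -> Om x ->
  derivable (partials l f) x (ax i).
Proof.
move=> sf lm Ox; have := smooth_partials sf (ltnW lm); rewrite -(subnSK lm) => H.
exact: (H.2 i).1.
Qed.

Section Vector.
Variables (n : nat) (F : 'rV[R]_d -> 'rV[R]_n) (m : nat).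
Hypothesis sF : forall i, smooth Om m (fun x => F x 0 i).

Lemma partials_coord l x i : (size l <= m)%N -> Om x ->
  partials l F x 0 i = partials l (fun x => F x 0 i) x.
Proof.
elim: l x i => [|j l IH] x i //= lm Ox.
have E : forall y, Om y -> partials l F y = \row_i partials l (fun x => F x 0 i) y.
  by move=> y Oy; apply/rowP => k; rewrite mxE; apply: IH => //; exact: ltnW.
have dr : derivable (fun y => \row_i partials l (fun x => F x 0 i) y : 'rV[R]_n) x (ax j).
  apply/derivable_mxP => a b.
  have -> : (fun y => (\row_i partials l (fun x => F x 0 i) y : 'rV[R]_n) a b) =
     partials l (fun x => F x 0 b) by apply/funext => y; rewrite mxE.
  exact: (smooth_derivable (sF b)) lm Ox.
have -> : 'D_(ax j) (partials l F) x =
    'D_(ax j) (fun y => \row_i partials l (fun x => F x 0 i) y : 'rV[R]_n) x.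
  apply: near_eq_derive; near=> y; apply: E; near: y; exact: open_nbhs_nbhs.
rewrite derive_mx// mxE.
by congr ('D_(ax j) _ x); apply/funext => y; rewrite mxE.
Unshelve. all: by end_near. Qed.

Lemma Csder_vec : Csder m Om F.
Proof.
move=> l i x lm Ox.
have dr : derivable (fun y => \row_i partials l (fun x => F x 0 i) y : 'rV[R]_n) x (ax i).
  apply/derivable_mxP => a b.
  have -> : (fun y => (\row_i partials l (fun x => F x 0 i) y : 'rV[R]_n) a b) =
     partials l (fun x => F x 0 b) by apply/funext => y; rewrite mxE.
  exact: (smooth_derivable (sF b)) lm Ox.
apply: (near_eq_derivable _ dr); near=> y.
apply/rowP => k; rewrite mxE; apply/esym/partials_coord; first exact: ltnW.
by near: y; exact: open_nbhs_nbhs.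
Unshelve. all: by end_near. Qed.

(** The constant is a bound for the number of multi-indices. *)
Lemma Cnorm_vec_le e : 0 <= e -> (forall i, bnd Om 1 m e (fun x => F x 0 i)) ->
  (Cnorm m Om F <= (#|{ffun 'I_d -> 'I_m.+1}|%:R * e)%:E)%E.
Proof.
move=> e0 bF; apply: (@le_trans _ _ (\sum_(a : {ffun 'I_d -> 'I_m.+1} | (\sum_i a i <= m)%N) e%:E)%E).
  apply: lee_sum => a am; apply: esup_le => [|x Ox]; first by rewrite lee_fin.
  rewrite lee_fin; apply: rV_norm_le => // i.
  rewrite /pderiv partials_coord ?size_multi//.
  by apply: (bnd0 (bnd_partials (bF i) _)) => //; rewrite size_multi.
rewrite sumEFin lee_fin sumr_const -[e *+ _]mulr_natl ler_wpM2r// ler_nat.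
exact: max_card.
Qed.

Lemma within_cont_vec (D : set 'rV[R]_d) (G : 'rV[R]_d -> 'rV[R]_n) :
  (forall i, {within D, continuous (fun x => G x 0 i)}) -> {within D, continuous G}.
Proof.
move=> cG; apply/subspace_continuousP => x Dx.
apply/cvgrPdist_le => /= e e0; near=> y.
apply: rV_norm_le; first exact: ltW.
move=> i; rewrite !mxE; move: i; near: y; apply: filter_forall => i.
by have /subspace_continuousP/(_ x Dx)/cvgrPdist_le/(_ _ e0) := cG i.
Unshelve. all: by end_near. Qed.

Lemma smooth_Cs_on : compact (closure Om) -> Cs_on m Om Om F.
Proof.
move=> cOm; have cc l : (size l <= m)%N -> {within Om, continuous (partials l F)}.
  move=> lm; apply: within_cont_vec => i.
  have [g cg gE] := smooth_ext (smooth_partials (sF i) lm).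
  have := continuous_subspaceW (@subset_closure _ Om) cg.
  apply: subspace_eq_continuous => x; rewrite inE => Ox.
  by apply: (etrans (gE x Ox)); exact/esym/partials_coord.
split.
- exact: Csder_vec.
- exact: (cc [::]).
- by move=> l lm; exists (partials l F) => //; exact: cc.
- have /choice[M HM] : forall i, exists M, 0 <= M /\ bnd Om 1 m M (fun x => F x 0 i).
    by move=> i; have [M M0 bM] := smooth_bounded cOm ltr01 (sF i); exists M.
  have S0 : 0 <= \sum_i M i by apply: sumr_ge0 => i _; case: (HM i).
  apply: le_lt_trans (Cnorm_vec_le S0 _) (ltry _) => i.
  apply: bnd_mono (HM i).2 => //.
  by rewrite (bigD1 i)//= lerDl sumr_ge0// => j _; case: (HM j).
Qed.

End Vector.

Lemma smooth_inv m f : {within closure Om, continuous f} ->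
  (forall x, closure Om x -> f x != 0) -> smooth Om m f ->
  smooth Om m (fun x => (f x)^-1).
Proof.
move=> cf f0; have ei : extends Om (fun x => (f x)^-1).
  exists (fun x => (f x)^-1) => //.
  apply/subspace_continuousP => x cx; apply: cvgV; first exact: f0.
  by have /subspace_continuousP/(_ x cx) := cf.
elim: m => [|m IH] sf; first by split.
split=> // i; have [df sf'] := sf.2 i.
have f0' x : Om x -> f x != 0 by move=> Ox; apply: f0; exact: subset_closure.
split; first by move=> x Ox; apply: derivableV; [exact: f0'|exact: df].
have sm := IH (smooth_le (leqnSn m) sf).
apply: (smooth_eq oOm _ (smoothM oOm (smoothN oOm (smoothM oOm sm sm)) sf')) => x Ox.
rewrite [RHS](deriveV (f0' x Ox) (df x Ox)).
by rewrite [_ *: _]mulrC -exprVn expr2 mulNr mulrN mulrC.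
Qed.

End Conversion.

Lemma Cnorm_ge_pt (R : realType) (d s : nat) (V : normedModType R) (Om : set 'rV[R]_d)
  (f : 'rV[R]_d -> V) x : Om x -> (`|f x|%:E <= Cnorm s Om f)%E.
Proof.
move=> Ox; pose a0 := [ffun=> ord0] : {ffun 'I_d -> 'I_s.+1}.
have sa0 : (\sum_i a0 i <= s)%N by rewrite big1// => i _; rewrite ffunE.
have w0 : flatten [seq nseq (a0 i) i | i <- enum 'I_d] = [::].
  by apply: size0nil; rewrite size_multi big1// => i _; rewrite ffunE.
rewrite /Cnorm (bigD1 a0)//= -[leLHS]adde0 leeD//; last first.
  by apply: sume_ge0 => a _; exact: esup_ge0.
have := esup_ub (fun x => `|pderiv a0 f x|%:E) Ox.
by rewrite /pderiv w0.
Qed.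

(** * Functionals that separate points *)

Section Functionals.
Variables (R : realType) (d k s : nat) (Omega : lipschitz_domain R d).
Local Notation Om := (dom Omega).
Local Notation U := (Cclosed s Omega 'rV[R]_k).
Local Notation mu := (lebesgue_rV R d).
Variables (phi : nat -> R -> R) (eta1 : 'rV[R]_d -> R).
Hypothesis sphi : smooth_jet phi.
Hypothesis nzphi : forall n, exists b, phi n b != 0.
Hypothesis eta0 : forall y, Om y -> 0 <= eta1 y.
Hypothesis eta_neg : mu.-negligible [set y | Om y /\ eta1 y = 0].
Hypothesis eta_bd : has_ubound [set `|eta1 y| | y in Om].
Hypothesis ceta : {within Om, continuous eta1}.
Implicit Types (u v : U) (g : U -> 'rV[R]_d -> R).
Let oOm : open Om. Proof. exact: dom_open. Qed.
Let bOm : bounded_set Om. Proof. exact: dom_bounded. Qed.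
Let cOm : compact (closure Om). Proof. exact/bounded_closure_compact/dom_bounded. Qed.

Definition affine_in n (inp : U -> 'rV[R]_d -> 'rV[R]_n) : set (U -> 'rV[R]_d -> R) :=
  [set F | exists (a : 'I_n -> R) (b : R), forall u x, F u x = \sum_i inp u x 0 i * a i + b].

Definition pos_input (u : U) (x : 'rV[R]_d) : 'rV[R]_d := x.

Definition full_input (u : U) (x : 'rV[R]_d) : 'rV[R]_(k + d) := row_mx ((u : _ -> _) x) x.

Lemma fam_linear m (K : set U) : linear_fam Om m K (fam Om m K).
Proof.
split=> //; first by move=> c; exact: famC.
  by move=> F G; exact: famD.
by move=> c F; exact: famZ.
Qed.

Lemma affine_linear m (K : set U) n (inp : U -> 'rV[R]_d -> 'rV[R]_n) :
  (forall i, fam Om m K (fun u x => inp u x 0 i)) -> linear_fam Om m K (affine_in inp).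
Proof.
move=> finp; split.
- move=> F [a [b FE]].
  have -> : F = fun u x => \sum_i inp u x 0 i * a i + b.
    by apply/funext => u; apply/funext => x.
  apply: famD; [exact: oOm| |exact: famC].
  apply: (lin_sum _ (fam_linear m K)) => i.
  by apply: famM => //; exact: famC.
- by move=> c; exists (fun=> 0), c => u x; rewrite big1 ?add0r// => i _; rewrite mulr0.
- move=> F G [a [b FE]] [a' [b' GE]]; exists (fun i => a i + a' i), (b + b') => u x.
  rewrite FE GE addrACA -big_split; congr (_ + _); apply: eq_bigr => i _.
  by rewrite mulrDr.
- move=> c F [a [b FE]]; exists (fun i => c * a i), (c * b) => u x.
  by rewrite FE mulrDr mulr_sumr; congr (_ + _); apply: eq_bigr => i _; rewrite mulrCA.
Qed.

Lemma affine_coord n (inp : U -> 'rV[R]_d -> 'rV[R]_n) i : affine_in inp (fun u x => inp u x 0 i).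
Proof.
exists (fun j => (j == i)%:R), 0 => u x; rewrite addr0 (bigD1 i)//= eqxx mulr1 big1 ?addr0//.
by move=> j /negbTE ->; rewrite mulr0.
Qed.

Lemma cspace_pt_le u x : Om x -> `|(u : _ -> _) x| <= `|u|.
Proof.
move=> Ox; rewrite -lee_fin (_ : `|u|%:E = Cnorm s Om u); last exact: cspace_normE.
exact: Cnorm_ge_pt.
Qed.

Lemma cspace_coord_ext u i : extends Om (fun x => (u : _ -> _) x 0 i).
Proof.
exists (fun x => (u : _ -> _) x 0 i) => //.
have [_ cu _ _] := cspace_Cs_on u.
move=> x; exact: (continuous_comp (cu x) (@coord_continuous _ _ _ 0 i _)).
Qed.

Lemma fam_pos m (K : set U) i : fam Om m K (fun u x => pos_input u x 0 i).
Proof.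
have sc := smooth_coord Om m i.
split=> [u _|]; first exact: sc.
by have [M M0 bM] := smooth_bounded cOm ltr01 sc; exists M.
Qed.

Lemma fam_full (K : set U) i : compact K -> fam Om 0 K (fun u x => full_input u x 0 i).
Proof.
move=> cK; rewrite /full_input; case: (splitP i) => j ij.
  have -> : i = lshift d j by exact: val_inj.
  split=> [u _|].
    split=> //; apply: extends_eq (cspace_coord_ext u j) => x _.
    by rewrite row_mxEl.
  have [M M0 HM] := compact_norm_ub cK; exists M => // u Ku; split=> // x Ox.
  rewrite row_mxEl (le_trans (rV_coord_le _ _))// (le_trans (cspace_pt_le u Ox))//.
  exact: HM.
have -> : i = rshift k j by exact: val_inj.
apply: (fam_eq oOm _ (fam_pos 0 K j)) => u x _ _.
by rewrite row_mxEr.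
Qed.

Lemma net_full_fam (K : set U) : compact K ->
  sspan (phi 0%N) (affine_in full_input) `<=` fam Om 0 K.
Proof.
move=> cK; apply: (sspan_fam oOm (sphi 0)).
by apply: lin_fam; apply: affine_linear => i; exact: fam_full.
Qed.

Lemma net_full_ext g u : sspan (phi 0%N) (affine_in full_input) g -> extends Om (g u).
Proof.
by move=> /(net_full_fam (@compact_set1 _ u))[H _]; have [] := H u erefl.
Qed.

Definition weighted_int (f : 'rV[R]_d -> R) : R := \int[mu]_(y in Om) (f y * eta1 y).

Lemma eta_bound : exists2 E, 0 <= E & forall y, Om y -> `|eta1 y| <= E.
Proof.
have [E HE] := eta_bd; exists `|E| => // y Oy.
by rewrite (le_trans _ (ler_norm E))//; apply: HE; exists y.
Qed.

Lemma extends_within f : extends Om f -> {within Om, continuous f}.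
Proof.
move=> [g cg gf]; have := continuous_subspaceW (@subset_closure _ Om) cg.
by apply: subspace_eq_continuous => x; rewrite inE => Ox; exact: gf.
Qed.

Lemma weighted_int_integrable f : extends Om f -> mu.-integrable Om (EFin \o (fun y => f y * eta1 y)).
Proof.
move=> ef; have [M M0 fM] := extends_bounded cOm ef; have [E E0 etaE] := eta_bound.
apply: (cont_integrable oOm bOm (M := M * E)).
  by apply: within_contM => //; exact: extends_within.
by move=> x Ox; rewrite normrM ler_pM//; [exact: fM|exact: etaE].
Qed.

Lemma weighted_intD f h : extends Om f -> extends Om h ->
  weighted_int (fun y => f y + h y) = weighted_int f + weighted_int h.
Proof.
move=> ef eh; rewrite /weighted_int -RintegralD; last 3 first.
- exact: open_lebesgue.
- exact: weighted_int_integrable.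
- exact: weighted_int_integrable.
by congr fine; apply: eq_integral => y _; rewrite mulrDl.
Qed.

Lemma weighted_intZ c f : extends Om f -> weighted_int (fun y => c * f y) = c * weighted_int f.
Proof.
move=> ef; rewrite /weighted_int -RintegralZl; last 2 first.
- exact: open_lebesgue.
- exact: weighted_int_integrable.
by congr fine; apply: eq_integral => y _; rewrite mulrA.
Qed.

Lemma weighted_int_bound : exists2 C, 0 <= C & forall f h e, extends Om f -> extends Om h ->
  (forall y, Om y -> `|f y - h y| <= e) -> `|weighted_int f - weighted_int h| <= e * C.
Proof.
have [E E0 etaE] := eta_bound.
have mO := open_lebesgue oOm.
exists (E * fine (mu Om)); first by rewrite mulr_ge0// fine_ge0.
move=> f h e ef eh fh.
have ef' : extends Om (fun y => f y + -1 * h y).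
  by apply: extendsD => //; apply: extendsM => //; exact: extends_cst.
have -> : weighted_int f - weighted_int h = weighted_int (fun y => f y + -1 * h y).
  rewrite weighted_intD//; last by apply: extendsM => //; exact: extends_cst.
  by rewrite weighted_intZ// mulN1r.
have ib := weighted_int_integrable ef'.
rewrite (le_trans (le_normr_Rintegral mO ib))// mulrA -Rintegral_cst//.
apply: le_Rintegral => //.
- exact: (integrable_norm ib).
- apply: (cont_integrable oOm bOm (M := `|e * E|)) => //.
  by move=> x; exact: cvg_cst.
- move=> y Oy /=; rewrite normrM ler_pM//; last exact: etaE.
  by rewrite mulN1r fh.
Qed.

Variable K : set U.
Hypothesis cK : compact K.

(** Lipschitz in [u], uniformly in the position. This passes from affine
    functions to networks by composition, and makes the functionals continuous
    by integration. *)
Definition unif_lip g := exists2 C, 0 <= C & forall u v y, K u -> K v -> Om y ->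
  `|g u y - g v y| <= C * `|u - v|.

Lemma lip_bounded M : exists2 C, 0 <= C & forall a b, `|a| <= M -> `|b| <= M ->
  `|phi 0%N b - phi 0%N a| <= C * `|b - a|.
Proof.
(* Points between [a] and [b] have absolute value at most [`|a| + `|b - a|]. *)
have [C C0 HC] := jet_bounded (M + 2 * M) (sphi 1).
exists C => // a b aM bM; have M0 := le_trans (normr_ge0 a) aM.
have D (t : R) : is_derive t (1 : R) (fun t => phi 0%N (a + 1 * t)) (phi 1%N (a + 1 * t)).
  by have := is_derive_affine ((sphi 1%N).1 0%N (a + 1 * t) isT); rewrite [X in is_derive _ _ _ X -> _]mul1r.
have := @is_derive_mvt _ _ _ `|b - a| C D _ (b - a) (lexx _).
rewrite mul1r mulr0 addr0 [a + (b - a)]addrC subrK mulrC; apply.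
move=> t tb; apply: HC => //; rewrite mul1r (le_trans (ler_normD _ _))// lerD//.
rewrite (le_trans tb)// (le_trans (ler_normB _ _))// mulr_natl mulr2n lerD//.
Qed.

Lemma unif_lip_affine w : affine_in full_input w -> unif_lip w.
Proof.
move=> [a [b wE]]; exists (\sum_i `|a i|) => [|u v y Ku Kv Oy]; first exact: sumr_ge0.
have -> : w u y - w v y = \sum_i (full_input u y 0 i - full_input v y 0 i) * a i.
  rewrite !wE opprD addrACA subrr addr0 -sumrB; apply: eq_bigr => i _.
  by rewrite mulrBl.
rewrite (le_trans (ler_norm_sum _ _ _))// mulr_suml; apply: ler_sum => i _.
rewrite normrM mulrC ler_wpM2l//.
rewrite /full_input; case: (splitP i) => j ij.
  have -> : i = lshift d j by exact: val_inj.
  rewrite !row_mxEl (le_trans _ (cspace_pt_le (u - v) Oy))//.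
  by have := rV_coord_le ((u - v : U) y) j; rewrite !mxE.
have -> : i = rshift k j by exact: val_inj.
by rewrite !row_mxEr subrr normr0.
Qed.

Lemma unif_lip_net g : sspan (phi 0%N) (affine_in full_input) g -> unif_lip g.
Proof.
elim=> [c|c w F Vw _ [C C0 HC]]; first by exists 0 => // *; rewrite subrr normr0 mul0r.
have [D D0 HD] := unif_lip_affine Vw.
have [_ [M M0 bM]] : fam Om 0 K w.
  by apply: lin_fam Vw; apply: affine_linear => i; exact: fam_full.
have [L L0 HL] := lip_bounded M.
exists (`|c| * (L * D) + C); first by rewrite addr_ge0// !mulr_ge0.
move=> u v y Ku Kv Oy.
have -> : c * phi 0%N (w u y) + F u y - (c * phi 0%N (w v y) + F v y) =
   c * (phi 0%N (w u y) - phi 0%N (w v y)) + (F u y - F v y) by ring.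
rewrite (le_trans (ler_normD _ _))// mulrDl lerD//; last exact: HC.
rewrite normrM -mulrA ler_wpM2l// -mulrA.
rewrite (le_trans (HL _ _ _ _))//; [exact: (bnd0 (bM v Kv))|exact: (bnd0 (bM u Ku))|].
by rewrite ler_wpM2l//; exact: HD.
Qed.

Lemma weighted_int_net_cont g : sspan (phi 0%N) (affine_in full_input) g ->
  {within K, continuous (fun u => weighted_int (g u))}.
Proof.
move=> sg; have [C C0 HC] := weighted_int_bound; have [D D0 HD] := unif_lip_net sg.
apply/subspace_continuousP => u Ku; apply/cvgrPdist_le => /= e e0.
rewrite near_withinE.
have c0 : 0 < D * C + 1 by rewrite ltr_wpDl// mulr_ge0.
have : \forall v \near u, `|u - v| <= e / (D * C + 1).
  apply/nbhs_ballP; exists (e / (D * C + 1)); first exact: divr_gt0.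
  by move=> v; rewrite -ball_normE /= => /ltW.
apply: filterS => v uv Kv.
apply: le_trans (HC _ _ _ _ _ (fun y Oy => HD u v y Ku Kv Oy)) _; [exact: net_full_ext..|].
rewrite mulrAC; apply: le_trans (ler_wpM2l (mulr_ge0 D0 C0) uv) _.
by rewrite mulrCA ler_piMr ?(ltW e0)// ler_pdivrMr// mul1r lerDl.
Qed.

(** Suppose that coordinate [i] of [u] and [v] differ, by the function [w].
    For [g(u', y) = u'_i(y) w(y)] the two integrals differ by the integral of
    [w ^+ 2] against [eta1], which is positive. This [g] is in the closed
    algebra generated by the affine functions of [(u'(y), y)], since [w] is in
    it by density of polynomials; a network close to [g] separates as well. *)
Lemma weighted_int_separates u v : K u -> K v -> u <> v ->
  exists2 g, sspan (phi 0%N) (affine_in full_input) g & weighted_int (g u) <> weighted_int (g v).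
Proof.
move=> Ku Kv uv.
have [y [Oy uvy]] : exists y, Om y /\ (u : _ -> _) y != (v : _ -> _) y.
  apply: contrapT => H; apply: uv; apply/eqP; rewrite -subr_eq0 -normr_eq0; apply/eqP.
  apply: EFin_inj; rewrite (_ : `|u - v|%:E = Cnorm s Om (u - v : U)); last exact: cspace_normE.
  rewrite (@eq_Cnorm _ _ _ s Om _ (0 : 'rV[R]_d -> 'rV[R]_k) oOm); last first.
    move=> x Ox; rewrite -[LHS]/((u : _ -> _) x - (v : _ -> _) x).
    apply/eqP; rewrite subr_eq0; apply/negP => /negP nx; apply: H; exists x.
    by split => //; apply/eqP => E; rewrite E eqxx in nx.
  rewrite /Cnorm big1// => a _; apply/eqP; rewrite eq_le esup_ge0 andbT.
  by apply: esup_le => // x _; rewrite /pderiv partials0 normr0.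
have [i uvi] : exists i, (u : _ -> _) y 0 i != (v : _ -> _) y 0 i.
  apply: contrapT => H; move/eqP: uvy; apply; apply/rowP => i.
  by apply: contrapT => /eqP nE; apply: H; exists i.
pose w x := (u : _ -> _) x 0 i - (v : _ -> _) x 0 i.
have sw : smooth Om 0 w.
  by apply: smoothB => //; split => //; exact: cspace_coord_ext.
have la : linear_fam Om 0 K (affine_in full_input).
  by apply: affine_linear => j; exact: fam_full.
have [A [cA VA Acl]] := net_algebra oOm la sphi nzphi.
have Acoord j : A (fun _ x => x 0 j).
  apply: lin_eq (VA _ (affine_coord full_input (rshift k j))) _ => u' x.
  by rewrite /full_input row_mxEr.
have Aw := density oOm cOm cA Acoord (lipschitz_visible Omega) sw.
have Ai : A (fun u x => (u : _ -> _) x 0 i).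
  apply: lin_eq (VA _ (affine_coord full_input (lshift d i))) _ => u' x.
  by rewrite /full_input row_mxEl.
have [_ FG] := Acl _ (alg_mul cA Ai Aw).
have [M M0 wM] := extends_bounded cOm sw.1.
have [E E0 etaE] := eta_bound.
have pos : 0 < weighted_int (fun x => w x * w x).
  apply: (integral_sq_pos oOm bOm eta0 eta_neg ceta etaE (M := M) (extends_within sw.1) wM).
  by exists y => //; rewrite subr_eq0.
have [C C0 HC] := weighted_int_bound.
(* [e] is such that errors of size [e * C] on both integrals are less than the
   gap. *)
pose e := weighted_int (fun x => w x * w x) / (2 * C + 1).
have c0 : 0 < 2 * C + 1 by rewrite ltr_wpDl// mulr_ge0.
have e0 : 0 < e by rewrite divr_gt0.
have [g sg Hg] := FG e e0.
exists g => // E2.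
have eu (u' : U) : extends Om (fun x => (u' : _ -> _) x 0 i * w x).
  by apply: extendsM; [exact: cspace_coord_ext|exact: sw.1].
have H (u' : U) : K u' -> `|weighted_int (fun x => (u' : _ -> _) x 0 i * w x) - weighted_int (g u')| <= e * C.
  move=> Ku'; apply: HC; [exact: eu|exact: net_full_ext|].
  exact: (bnd0 (Hg u' Ku')).
have Ew : weighted_int (fun x => w x * w x) = weighted_int (fun x => (u : _ -> _) x 0 i * w x) -
    weighted_int (fun x => (v : _ -> _) x 0 i * w x).
  rewrite -mulN1r -weighted_intZ// -weighted_intD//; last first.
    by apply: extendsM => //; exact: extends_cst.
  by congr weighted_int; apply/funext => x; rewrite {1}/w; ring.
have := H u Ku; have := H v Kv; rewrite E2 => h1 h2.
have h3 : weighted_int (fun x => w x * w x) <= e * C + e * C.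
  rewrite Ew -(subrKA (weighted_int (g v))) (le_trans (ler_norm _))// (le_trans (ler_normD _ _))//.
  by rewrite lerD// distrC.
have h4 : e * (2 * C + 1) = weighted_int (fun x => w x * w x) by rewrite /e divfK// gt_eqF.
move: h3; rewrite -h4; have -> : e * (2 * C + 1) = e * C + e * C + e by ring.
by rewrite gerDl leNgt e0.
Qed.

End Functionals.

(** * The algebra generated by one nonlocal layer *)

Section Preactivation.
Variables (R : realType) (d k s m : nat) (Omega : lipschitz_domain R d).
Local Notation Om := (dom Omega).
Local Notation U := (Cclosed s Omega 'rV[R]_k).
Local Notation mu := (lebesgue_rV R d).
Variables (phi : nat -> R -> R) (eta1 eta2 : 'rV[R]_d -> R).
Hypothesis sphi : smooth_jet phi.
Hypothesis nzphi : forall n, exists b, phi n b != 0.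
Hypothesis eta0 : forall y, Om y -> 0 <= eta1 y.
Hypothesis eta_neg : mu.-negligible [set y | Om y /\ eta1 y = 0].
Hypothesis eta_bd : has_ubound [set `|eta1 y| | y in Om].
Hypothesis ceta : {within Om, continuous eta1}.
Hypothesis seta2 : smooth Om m eta2.
Hypothesis ceta2 : {within closure Om, continuous eta2}.
Hypothesis nzeta2 : forall x, closure Om x -> eta2 x != 0.
Variable K : set U.
Hypothesis cK : compact K.
Implicit Types (u v : U) (g r : U -> 'rV[R]_d -> R).
Let oOm : open Om. Proof. exact: dom_open. Qed.
Let cOm : compact (closure Om). Proof. exact/bounded_closure_compact/dom_bounded. Qed.
Local Notation pos_net := (sspan (phi 0%N) (affine_in (@pos_input R d k s Omega))).
Local Notation full_net := (sspan (phi 0%N) (affine_in (@full_input R d k s Omega))).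
Local Notation W := (weighted_int Omega eta1).

(** What a layer with the single pair [(eta1, eta2)] can compute before
    applying the activation: the lifting network supplies [r] and [g], the
    latter being averaged against [eta1] and multiplied by [eta2]. *)
Definition preact : set (U -> 'rV[R]_d -> R) := [set F | exists r g,
  [/\ pos_net r, full_net g & forall u x, F u x = r u x + eta2 x * W (g u)]].

Lemma weighted_int0 : W (fun=> 0) = 0.
Proof.
by have := weighted_intZ eta_bd ceta 0 (extends_cst Om 0); rewrite !mul0r.
Qed.

Lemma const_fam (al : U -> R) : {within K, continuous al} -> fam Om m K (fun u _ => al u).
Proof.
move=> cal; split=> [u _|]; first exact: smoothC.
have [M M0 HM] := compact_norm_ub (continuous_compact cal cK).
by exists M => // u Ku; apply: bndC => //; apply: HM; exists u.
Qed.

Lemma smooth_const_fam f : smooth Om m f -> fam Om m K (fun _ => f).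
Proof.
move=> sf; split=> //.
by have [M M0 bM] := smooth_bounded cOm ltr01 sf; exists M.
Qed.

Lemma pos_linear : linear_fam Om m K (affine_in (@pos_input R d k s Omega)).
Proof. by apply: affine_linear => i; exact: fam_pos. Qed.

Lemma preact_linear : linear_fam Om m K preact.
Proof.
have ext g (sg : full_net g) u := net_full_ext sphi u sg.
split.
- move=> F [r [g [sr sg FE]]].
  have -> : F = fun u x => r u x + eta2 x * W (g u) by apply/funext => u; apply/funext => x.
  apply: famD => //; first exact: (sspan_fam oOm (sphi m) (lin_fam pos_linear)).
  apply: famM => //; first exact: smooth_const_fam.
  exact/const_fam/(weighted_int_net_cont sphi eta_bd ceta cK).
- move=> c; exists (fun _ _ => c), (fun _ _ => 0); split; [exact: SpanC|exact: SpanC|].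
  by move=> u x; rewrite weighted_int0 mulr0 addr0.
- move=> F F' [r [g [sr sg FE]]] [r' [g' [sr' sg' FE']]].
  exists (fun u x => r u x + r' u x), (fun u x => g u x + g' u x).
  split; [exact: sspanD|exact: sspanD|] => u x.
  by rewrite FE FE' (weighted_intD eta_bd ceta (ext _ sg u) (ext _ sg' u)); ring.
- move=> c F [r [g [sr sg FE]]].
  exists (fun u x => c * r u x), (fun u x => c * g u x).
  split; [exact: sspanZ|exact: sspanZ|] => u x.
  by rewrite FE (weighted_intZ eta_bd ceta c (ext _ sg u)); ring.
Qed.

(** Dividing by [eta2] inside the algebra frees the functionals from their
    factor, after which Stone-Weierstrass applies to the algebra of those
    functions of [u] alone that are in [A]. *)
Theorem target_algebra : exists A : set (U -> 'rV[R]_d -> R),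
  [/\ closed_algebra Om m K A, A `<=` clos Om m K (sspan (phi 0%N) preact),
    forall f, smooth Om m f -> A (fun _ => f) &
    forall al, {within K, continuous al} -> A (fun u _ => al u)].
Proof.
have [A [cA VA Acl]] := net_algebra oOm preact_linear sphi nzphi.
exists A.
have Acoord i : A (fun _ x => x 0 i).
  (* Networks in [x] alone are preactivations, so [A] contains the algebra
     that they generate. *)
  have [A0 [cA0 VA0 Acl0]] := net_algebra oOm pos_linear sphi nzphi.
  have [fF FS] := Acl0 _ (VA0 _ (affine_coord (@pos_input R d k s Omega) i)).
  apply: (alg_clos cA); split=> // e /FS[G sG FG]; exists G => //.
  apply: VA; exists G, (fun _ _ => 0); split=> //; first exact: SpanC.
  by move=> u x; rewrite weighted_int0 mulr0 addr0.
have dens f (sf : smooth Om m f) := density oOm cOm cA Acoord (lipschitz_visible Omega) sf.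
split=> //.
move=> al cal.
have Ai := dens _ (smooth_inv oOm ceta2 nzeta2 seta2).
have AW g : full_net g -> A (fun u _ => W (g u)).
  move=> sg; have H : A (fun u x => eta2 x * W (g u)).
    apply: VA; exists (fun _ _ => 0), g; split=> //; first exact: SpanC.
    by move=> u x; rewrite add0r.
  have H2 := alg_mul cA Ai H.
  apply: (alg_clos cA); split.
    exact/const_fam/(weighted_int_net_cont sphi eta_bd ceta cK).
  move=> e e0; exists (fun u x => (eta2 x)^-1 * (eta2 x * W (g u))) => //.
  have Hr : close Om m K e (fun u _ => W (g u)) (fun u _ => W (g u)).
    by apply: close_refl => //; exact: ltW.
  apply: (close_eq oOm _ _ Hr) => // u x Ku Ox.
  by rewrite mulKf//; apply: nzeta2; exact: subset_closure.
pose AK := [set be : U -> R | {within K, continuous be} /\ A (fun u _ => be u)].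
have sAK : subalgebra K AK.
  split.
  - by move=> f [].
  - by move=> c; split; [move=> x; exact: cvg_cst|exact: (lin_cst (alg_lin cA))].
  - move=> f g [cf Af] [cg Ag]; split; first by move=> x; exact: (cvgD (cf x) (cg x)).
    exact: (lin_add (alg_lin cA)).
  - move=> f g [cf Af] [cg Ag]; split; first by move=> x; exact: (cvgM (cf x) (cg x)).
    exact: (alg_mul cA).
have sep u v : K u -> K v -> u <> v -> exists2 g, AK g & g u <> g v.
  move=> Ku Kv uv.
  have [g sg gg] := weighted_int_separates sphi nzphi eta0 eta_neg eta_bd ceta cK Ku Kv uv.
  exists (fun u => W (g u)) => //; split; last exact: AW.
  exact: (weighted_int_net_cont sphi eta_bd ceta cK).
apply: (alg_clos cA); split; first exact: const_fam.
move=> e e0; have [be [_ Abe] H] := stone_weierstrass cK sAK sep cal e0.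
exists (fun u _ => be u) => // u Ku; apply: bndC => //; exact: H.
Qed.

End Preactivation.

(** * Neural operators that realize the approximants *)

Section SpanVector.
Variables (R : realType) (A B : Type).

Lemma sspan_scalar (f : R -> R) (V : set (A -> B -> R)) F : sspan f V F ->
  exists (P : nat) (w : 'I_P -> A -> B -> R) (c : 'I_P -> R) (c0 : R),
  (forall p, V (w p)) /\ forall u x, F u x = \sum_p f (w p u x) * c p + c0.
Proof.
elim=> [c|c w G Vw _ [P [w' [c' [c0 [Vw' GE]]]]]].
  exists 0%N, (fun _ _ _ => 0), (fun _ => 0), c; split; first by case.
  by move=> u x; rewrite big_ord0 add0r.
exists P.+1, (fun p => if unlift ord0 p is Some q then w' q else w),
  (fun p => if unlift ord0 p is Some q then c' q else c), c0; split.
  by move=> p; case: unliftP.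
move=> u x; rewrite GE big_ord_recl unlift_none mulrC addrA; congr (_ * _ + _ + _) => //.
by apply: eq_bigr => q _; rewrite liftK.
Qed.

(** Finitely many scalar networks are run in parallel; the neurons are indexed
    by the disjoint union of their sets of neurons. *)
Lemma sspan_vec (f : R -> R) (V : set (A -> B -> R)) n (F : 'I_n -> A -> B -> R) :
  (forall i, sspan f V (F i)) ->
  exists (P : nat) (w : 'I_P -> A -> B -> R) (C : 'M[R]_(P, n)) (c : 'rV[R]_n),
  (forall p, V (w p)) /\
  forall u x i, F i u x = \sum_p f (w p u x) * C p i + c 0 i.
Proof.
move=> sF.
have /choice[D HD] : forall i, exists D : {P : nat & ('I_P -> A -> B -> R) * ('I_P -> R) * R}%type,
   (forall p, V ((projT2 D).1.1 p)) /\
   forall u x, F i u x = \sum_p f ((projT2 D).1.1 p u x) * (projT2 D).1.2 p + (projT2 D).2.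
  move=> i; have [P [w [c [c0 [Vw FE]]]]] := sspan_scalar (sF i).
  by exists (existT _ P (w, c, c0)).
pose Q i := 'I_(projT1 (D i)).
pose w (t : {i : 'I_n & Q i}) := (projT2 (D (tag t))).1.1 (tagged t).
pose c (t : {i : 'I_n & Q i}) := (projT2 (D (tag t))).1.2 (tagged t).
exists #|{: {i : 'I_n & Q i}}|, (fun p => w (enum_val p)),
  (\matrix_(p, i) (if tag (enum_val p) == i then c (enum_val p) else 0)),
  (\row_i (projT2 (D i)).2); split.
  by move=> p; exact: (HD (tag (enum_val p))).1.
move=> u x i; rewrite (HD i).2 mxE; congr (_ + _).
under [RHS]eq_bigr do rewrite mxE.
rewrite -(big_enum_val (A := {: {i : 'I_n & Q i}})
  (fun t => f (w t u x) * (if tag t == i then c t else 0))) /=.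
rewrite (eq_bigr (fun t => if tag t == i then f (w t u x) * c t else 0)); last first.
  by move=> t _; case: ifP => // _; rewrite mulr0.
rewrite -big_mkcondr /=.
have := @sig_big_dep R 0 +%R 'I_n Q (pred1 i) (fun _ _ => true)
   (fun i j => f (w (Tagged Q j) u x) * c (Tagged Q j)).
rewrite big_pred1_eq /= => E.
by rewrite [LHS]E; apply: eq_big => [t|[j q] _] //=; rewrite andbT.
Qed.

End SpanVector.

Section Realization.
Variables (R : realType) (d k k' s : nat) (Omega : lipschitz_domain R d).
Local Notation Om := (dom Omega).
Local Notation U := (Cclosed s Omega 'rV[R]_k).
Variables (sigma : R -> R) (eta1 eta2 : 'rV[R]_d -> R).

Lemma sspan_sub A B (f : R -> R) (V V' : set (A -> B -> R)) F : V `<=` V' ->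
  sspan f V F -> sspan f V' F.
Proof.
by move=> VV; elim=> [c|c w G Vw _ IH]; [exact: SpanC|apply: SpanS => //; exact: VV].
Qed.

Lemma pos_full : affine_in (@pos_input R d k s Omega) `<=` affine_in (@full_input R d k s Omega).
Proof.
move=> F [a [b FE]]; exists (fun i => if fintype.split i is inr j then a j else 0), b => u x.
rewrite FE big_split_ord /= [X in _ = X + _ + _]big1 ?add0r.
  congr (_ + _); apply: eq_bigr => i _.
  rewrite row_mxEr; case: splitP => [j /= ij|j /= /addnI/val_inj -> //].
  by have := ltn_ord j; rewrite -ij ltnNge leq_addr.
move=> i _; case: splitP => [j _|j /= ij]; first by rewrite mulr0.
by have := ltn_ord i; rewrite ij ltnNge leq_addr.
Qed.

(** The lifting network outputs the pairs [(r_p, g_p)]. The layer keeps the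
    first components through [layer_W], adds to them the averages of the
    second components through [layer_T], and the projection reads off the
    first half of the channels; its own activation is applied to
    [b0 + h F i]. *)
Lemma nno_realization (F : 'I_k' -> U -> 'rV[R]_d -> R) (h b0 al be : R) :
  (forall i, sspan sigma (preact (fun n => (sigma^`(n))%classic) eta1 eta2) (F i)) ->
  exists (dc : nat) (Psi : nno R d k k' dc 1 1),
    [/\ layer_psi (tnth (nno_layers Psi) ord0) ord0 = eta1,
        layer_phi (tnth (nno_layers Psi) ord0) ord0 = eta2 &
        forall (u : U) x i, nno_eval sigma Om Psi u x 0 i = al * sigma (b0 + h * F i u x) + be].
Proof.
move=> sF; have [P [w [C [c [Vw FE]]]]] := sspan_vec sF.
have /choice[rg Hrg] : forall p, exists rg : (U -> 'rV[R]_d -> R) * (U -> 'rV[R]_d -> R),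
  [/\ sspan sigma (affine_in (@pos_input R d k s Omega)) rg.1,
      sspan sigma (affine_in (@full_input R d k s Omega)) rg.2 &
      forall u x, w p u x = rg.1 u x + eta2 x * weighted_int Omega eta1 (rg.2 u)].
  by move=> p; have [r [g [sr sg wE]]] := Vw p; exists (r, g).
(* Channel [p] of the first half carries [r_p], channel [p] of the second half
   [g_p]. *)
pose G (j : 'I_(P + P)) := match fintype.split j with inl p => (rg p).1 | inr p => (rg p).2 end.
have sG j : sspan sigma (affine_in (@full_input R d k s Omega)) (G j).
  rewrite /G; case: splitP => p _; have [sr sg _] := Hrg p => //.
  by apply: sspan_sub sr; exact: pos_full.
have [N [w' [C' [c' [Vw' GE]]]]] := sspan_vec sG.
have /choice[ab Hab] : forall q, exists ab : ('I_(k + d) -> R) * R,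
    forall u x, w' q u x = \sum_i full_input u x 0 i * ab.1 i + ab.2.
  by move=> q; have [a [b E]] := Vw' q; exists (a, b).
pose A1 : 'M[R]_(k + d, N) := \matrix_(i, q) (ab q).1 i.
pose b1 : 'rV[R]_N := \row_q (ab q).2.
pose lay : nno_layer R d (P + P) 1 := {|
  layer_W := block_mx 1%:M 0 0 0; layer_b := 0;
  layer_T := fun _ => block_mx 0 0 1%:M 0;
  layer_psi := fun _ => eta1; layer_phi := fun _ => eta2 |}.
pose Psi : nno R d k k' (P + P) 1 1 := {|
  nno_R := ShallowNet A1 b1 C' c';
  nno_layers := [tuple lay];
  nno_Q := ShallowNet (h *: col_mx C 0) (const_mx b0 + h *: c) al%:M (const_mx be) |}.
exists (P + P)%N, Psi; split; [by []|by []|] => u x i.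
pose lift (x : 'rV[R]_d) : 'rV[R]_(P + P) := ffnn_eval sigma (ShallowNet A1 b1 C' c') (row_mx ((u : _ -> _) x) x).
have liftE y j : lift y 0 j = G j u y.
  rewrite GE /lift /= !mxE; congr (_ + _); apply: eq_bigr => q _; rewrite !mxE; congr (sigma _ * _).
  by rewrite Hab; congr (_ + _); apply: eq_bigr => l _; rewrite !mxE.
have Gl p : G (lshift P p) = (rg p).1.
  by rewrite /G; case: splitP => [q /= /val_inj -> //|q /= E]; have := ltn_ord p; rewrite E ltnNge leq_addr.
have Gr p : G (rshift P p) = (rg p).2.
  by rewrite /G; case: splitP => [q /= E|q /= /addnI/val_inj -> //]; have := ltn_ord q; rewrite -E ltnNge leq_addr.
pose z : 'rV[R]_P := \row_p w p u x.
have hid : layer_eval sigma Om lay lift x = row_mx (map_mx sigma z) (map_mx sigma 0).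
  rewrite /layer_eval /= big_ord1 addr0 -map_row_mx; congr map_mx.
  rewrite -[lift x]hsubmxK mul_row_block !mulmx1 !mulmx0 !addr0.
  rewrite -[inner_L2 _ _ _]hsubmxK mul_row_block !mulmx1 !mulmx0 !add0r.
  rewrite scale_row_mx add_row_mx scaler0 addr0; congr row_mx.
  apply/rowP => p.
  have E1 : lsubmx (lift x) 0 p = (rg p).1 u x by rewrite mxE liftE Gl.
  have E2 : rsubmx (inner_L2 Om lift eta1) 0 p = weighted_int Omega eta1 ((rg p).2 u).
    rewrite mxE mxE; congr fine; apply: eq_integral => y _.
    by rewrite liftE Gr.
  rewrite [LHS]mxE E1 [X in _ + X]mxE E2 [RHS]mxE.
  by have [_ _ ->] := Hrg p.
rewrite /nno_eval /= -/(lift _).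
rewrite (_ : (fun x => lift x) = lift)// hid.
rewrite -scalemxAr mul_row_col mulmx0 addr0 mul_mx_scalar !mxE.
congr (_ * sigma _ + _).
rewrite FE addrCA -mulrDr; congr (_ + _ * (_ + _)).
by apply: eq_bigr => p _; rewrite !mxE.
Qed.

End Realization.

(** * The approximation theorem *)

(** The case [n = 1] of the rescaled Taylor expansion, at a point where the
    derivative does not vanish. *)
Lemma identity_approx (R : realType) (phi : nat -> R -> R) b m M c : smooth_jet phi ->
  phi 1%N b != 0 -> 0 <= M -> 0 < c ->
  exists (h al be : R) (psi : nat -> R -> R), [/\ jet m psi,
    (forall t, psi 0%N t = al * phi 0%N (b + h * t) + be) &
    forall j t, (j <= m)%N -> `|t| <= M -> `|(('X : {poly R})^`(j)).[t] - psi j t| <= c].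
Proof.
move=> sphi pb M0 c0; pose a := phi 1%N b.
have a0 : 0 < `|a| by rewrite normr_gt0.
have [h h0 Hh] := rescaled_small b 1 m sphi M0 (mulr_gt0 c0 a0).
have jr := jet_rescaled b 1 m sphi (lt0r_neq0 h0).
pose psi j t := (('X : {poly R})^`(j)).[t] - (- a^-1 * rescaled phi b 1 h j t).
have jr' : jet m (fun j t => - a^-1 * rescaled phi b 1 h j t).
  split=> [j t jm|j jm t].
    exact: (is_deriveZ (- a^-1) (jr.1 j t jm)).
  by apply: cvgM; [exact: cvg_cst|exact: jr.2].
exists h, (a^-1 / h), (- (a^-1 / h * phi 0%N b)), psi; split.
- exact: (jetB (jet_poly m 'X) jr').
- move=> t; rewrite /psi derivn0 hornerX /= /taylor big_ord1 expr0 alg_polyC hornerC.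
  rewrite divr1 expr1 -/a divr1.
  have an0 : a != 0 by [].
  have hn0 : h != 0 by rewrite gt_eqF.
  by field; rewrite an0 hn0.
- move=> j t jm tM; rewrite /psi opprB addrC subrK mulNr normrN normrM normfV.
  by rewrite ler_pdivrMl// mulrC; exact: Hh.
Qed.

(** Restriction to the open domain preserves the norm. *)
Lemma restr_cont (R : realType) (d s : nat) (Omega : lipschitz_domain R d)
    (V : normedModType R) : continuous (@restr R d s Omega V).
Proof.
move=> f N /nbhs_ballP[e e0 HN]; apply/nbhs_ballP; exists e => // g.
rewrite -ball_normE => fg; have {fg} fg : `|f - g| < e by exact: fg.
apply: HN; rewrite -ball_normE; suff : `|restr f - restr g| < e by [].
apply: le_lt_trans fg.
rewrite -lee_fin (_ : `|f - g|%:E = Cnorm s Omega (f - g)); last exact: cspace_normE.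
rewrite (_ : `|restr f - restr g|%:E = Cnorm s Omega (restr f - restr g : Copen s Omega V)); last exact: cspace_normE.
rewrite (@eq_Cnorm _ _ _ _ _ _ (f - g : Cclosed s Omega V))//; first exact: dom_open.
move=> x Ox; change (restr f x - restr g x = (f : _ -> _) x - (g : _ -> _) x).
by rewrite /= /restr_fun !asboolT.
Qed.

Lemma Csder_cspace (cl : bool) (R : realType) (d s : nat) (Omega : lipschitz_domain R d)
    (V : normedModType R) (f : cspace cl s Omega V) : Csder s (dom Omega) f.
Proof. by have [] := cspace_Cs_on f. Qed.

Theorem theorem3p4 (R : realType) (d k k' s s' : nat)
    (Omega : lipschitz_domain R d)
    (Psid : Cclosed s Omega 'rV[R]_k -> Cclosed s' Omega 'rV[R]_k')
    (K : set (Cclosed s Omega 'rV[R]_k))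
    (xi : nat -> 'rV[R]_d -> R) (sigma : R -> R) (eta1 eta2 : 'rV[R]_d -> R) :
  continuous Psid ->
  compact K ->
  smoothed_approximation [set restr (Psid u) | u in K] xi ->
  (forall j, Cs_on s' Omega (closure Omega) (xi j)) ->
  activation_assumption s' sigma ->
  (forall y, dom Omega y -> 0 <= eta1 y) ->
  (lebesgue_rV R d).-negligible [set y | dom Omega y /\ eta1 y = 0] ->
  has_ubound [set `|eta1 y| | y in Omega] ->
  {within Omega, continuous eta1} ->
  Cs_on s' Omega (closure Omega) eta2 ->
  (forall x, closure Omega x -> eta2 x != 0) ->
  forall eps : R, 0 < eps ->
  exists (dc : nat) (Psi : nno R d k k' dc 1 1),
    [/\ layer_psi (tnth (nno_layers Psi) ord0) ord0 = eta1,
        layer_phi (tnth (nno_layers Psi) ord0) ord0 = eta2,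
        forall u, K u -> Cs_on s' Omega Omega (nno_eval sigma Omega Psi u) &
        (esup K (fun u => Cnorm s' Omega
          (fun x => Psid u x - nno_eval sigma Omega Psi u x)%R) < eps%:E)%E].
Proof.
move=> cPsi cK [B [f [fB sa]]] xiC act eta0 eta_neg eta_bd ceta Ceta2 nzeta2 eps eps0.
have [sphi nzphi] := activation_jet act.
pose phi n := (sigma^`(n))%classic.
have oOm : open (dom Omega) by exact: dom_open.
have cOm : compact (closure Omega) by exact/bounded_closure_compact/dom_bounded.
have sxi j : smooth Omega s' (xi j) by apply: Cs_on_smooth (xiC j) _.
have seta2 : smooth Omega s' eta2 by apply: Cs_on_smooth Ceta2 _.
have ceta2 : {within closure Omega, continuous eta2} by case: Ceta2.
pose e4 := eps / 4; have e40 : 0 < e4 by rewrite divr_gt0.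
have nb4 : nbhs 0%E [set y : \bar R | (y < e4%:E)%E].
  by apply: open_ereal_lt'; rewrite lte_fin.
have near0 (T : Type) (F : set_system T) (FF : ProperFilter F) (g : T -> \bar R) :
    g x @[x --> F] --> 0%E -> exists2 x, (g x < e4%:E)%E & True.
  by move=> H; have [x Hx] := @filter_ex _ _ FF _ (H _ nb4); exists x.
have [delta [delta0 Hdelta]] : exists delta, 0 < delta /\
   (esup [set restr (Psid u) | u in K] (fun w => `|f delta w - w|%:E) < e4%:E)%E.
  have := sa_S1 sa; set G := fun delta => esup _ _ => H.
  have H2 : (0 : R)^'+ [set x | (G x < e4%:E)%E] := H _ nb4.
  have [x [Hx x0]] := filter_ex (filterI H2 (nbhs_right_gt (0 : R))).
  by exists x.
have [J HJ _] := near0 _ _ _ _ (sa_S2 sa delta0).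
pose al u j : 'rV[R]_k' := inner_L2 B (fB delta (restr (Psid u))) (xi j).
have cal j i : {within K, continuous (fun u => al u j 0 i)}.
  apply: continuous_subspaceT => u.
  have c1 : {for u, continuous (fun u => restr (Psid u))}.
    by apply: continuous_comp; [exact: cPsi|exact: restr_cont].
  have c2 : {for u, continuous (fun u => al u j)}.
    pose ip (w : Copen s' Omega 'rV[R]_k') := inner_L2 B (fB delta w) (xi j).
    have c3 : {for restr (Psid u), continuous ip} by exact: (sa_S3 sa delta0).
    exact: (@continuous_comp _ _ _ (fun u => restr (Psid u)) ip _ c1 c3).
  exact: (continuous_comp c2 (@coord_continuous _ _ _ 0 i _)).
have [A [cA Acl Asm Aal]] := target_algebra sphi nzphi eta0 eta_neg eta_bd ceta seta2 ceta2 nzeta2 cK.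
pose F i (u : Cclosed s Omega 'rV[R]_k) x := \sum_(j < J) xi j x * al u j 0 i.
have AF i : A (F i).
  apply: (lin_sum _ (alg_lin cA)) => j; apply: (alg_mul cA); first exact: Asm.
  exact: Aal.
pose Nn : R := #|{ffun 'I_d -> 'I_s'.+1}|%:R.
(* Each scalar coordinate gets an error [e + e], one [e] from the span and one
   from the projection; [Cnorm] multiplies it by at most [Nn]. *)
pose e := e4 / (2 * Nn + 1).
have N0 : 0 < 2 * Nn + 1 by rewrite ltr_wpDl// mulr_ge0.
have e0 : 0 < e by rewrite divr_gt0.
have /choice[G HG] : forall i, exists G,
   sspan sigma (preact phi eta1 eta2) G /\ close Omega s' K e (F i) G.
  by move=> i; have [_ FS] := Acl _ (AF i); have [G sG FG] := FS e e0; exists G.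
have lp := preact_linear sphi eta_bd ceta seta2 cK.
have fG i : fam Omega s' K (G i).
  exact: (sspan_fam oOm (sphi s') (lin_fam lp) (HG i).1).
have [M [M0 bM]] : exists M, 0 <= M /\ forall i u, K u -> bnd Omega 1 s' M (G i u).
  have /choice[M HM] : forall i, exists M, 0 <= M /\ forall u, K u -> bnd Omega 1 s' M (G i u).
    by move=> i; have [_ [M M0 bM]] := fG i; exists M.
  exists (\sum_i M i); split; first by apply: sumr_ge0 => i _; case: (HM i).
  move=> i u Ku; apply: bnd_mono ((HM i).2 u Ku) => //.
  by rewrite (bigD1 i)//= lerDl sumr_ge0// => j _; case: (HM j).
have [b pb] := nzphi 1%N.
have [C C0 HC] := bnd_comp oOm s' M0.
have c0 : 0 < e / (C + 1) by rewrite divr_gt0// ltr_wpDl.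
have [h [a [be [psi [jpsi psiE psiX]]]]] := identity_approx s' sphi pb M0 c0.
have [dc [Psi [P1 P2 PE]]] := nno_realization h b a be (fun i => (HG i).1).
have PE' (u : Cclosed s Omega 'rV[R]_k) x i : nno_eval sigma Omega Psi u x 0 i = psi 0%N (G i u x).
  by rewrite PE psiE.
have sN (u : Cclosed s Omega 'rV[R]_k) i : K u -> smooth Omega s' (fun x => nno_eval sigma Omega Psi u x 0 i).
  move=> Ku; have := (fam_comp oOm jpsi (fG i)).1 u Ku.
  by apply: smooth_eq => // x _; rewrite PE'.
exists dc, Psi; split => //.
  by move=> u Ku; apply: smooth_Cs_on => // i; exact: sN.
pose Sum (u : Cclosed s Omega 'rV[R]_k) x : 'rV[R]_k' := \sum_(j < J) xi j x *: al u j.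
have SumE u x i : Sum u x 0 i = F i u x.
  by rewrite /Sum summxE; apply: eq_bigr => j _; rewrite mxE.
have sSum u i : K u -> smooth Omega s' (fun x => Sum u x 0 i).
  move=> Ku; have := (lin_fam (alg_lin cA) (AF i)).1 u Ku.
  by apply: smooth_eq => // x _; rewrite SumE.
have bSN (u : Cclosed s Omega 'rV[R]_k) i : K u -> bnd Omega 1 s' (e + e) (fun x => Sum u x 0 i - nno_eval sigma Omega Psi u x 0 i).
  move=> Ku.
  have TO := @subset_refl _ (dom Omega).
  have sF := (lin_fam (alg_lin cA) (AF i)).1 u Ku.
  have sG := (fG i).1 u Ku.
  have b1 : bnd Omega 1 s' e (fun x => G i u x - psi 0%N (G i u x)).
    have H := HC _ _ _ _ TO (jetB (jet_poly s' 'X) jpsi) (ltW c0) psiX sG (bM i u Ku).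
    have {}H : bnd Omega 1 s' e ((fun t => (('X : {poly R})^`(0)).[t] - psi 0%N t) \o G i u).
      apply: bnd_mono H => //; rewrite mulrCA ler_piMr ?(ltW e0)//.
      by rewrite ler_pdivrMr ?ltr_wpDl// mul1r lerDl.
    by apply: (bnd_eq oOm TO _ H) => x _; rewrite /= hornerX.
  have sp := (fam_comp oOm jpsi (fG i)).1 u Ku.
  have H := bndD oOm TO (smoothB oOm sF sG) (smoothB oOm sG sp) ((HG i).2 u Ku) b1.
  by apply: (bnd_eq oOm TO _ H) => x _; rewrite SumE PE' addrA subrK.
apply: (@le_lt_trans _ _ (e4 + e4 + e4)%:E); last first.
  by rewrite lte_fin /e4; lra.
have e43 : 0 <= e4 + e4 + e4 by lra.
apply: esup_le => [|u Ku]; first by rewrite lee_fin.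
pose w := restr (Psid u).
have Kw : [set restr (Psid u) | u in K] w by exists u.
(* The error is split into smoothing ([D1]), truncation of the series ([D2])
   and approximation of the finite sum ([D3]). *)
pose D1 : 'rV[R]_d -> 'rV[R]_k' := (w - f delta w : Copen s' Omega 'rV[R]_k').
pose D2 x : 'rV[R]_k' := (f delta w : Copen s' Omega _) x - Sum u x.
pose D3 x : 'rV[R]_k' := Sum u x - nno_eval sigma Omega Psi u x.
have dD1 : Csder s' Omega D1 by exact: Csder_cspace.
have dS : Csder s' Omega (Sum u) by apply: Csder_vec => // i; exact: sSum.
have dN : Csder s' Omega (nno_eval sigma Omega Psi u).
  by apply: Csder_vec => // i; exact: sN.
have CsderB g1 g2 : Csder s' Omega g1 -> Csder s' Omega g2 ->
    Csder s' Omega (fun x => g1 x - g2 x : 'rV[R]_k').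
  move=> dg1 dg2; have := Csder_D oOm dg1 (@Csder_Z _ _ _ _ _ (-1) _ oOm dg2).
  suff -> : (g1 + (-1) *: g2) = (fun x => g1 x - g2 x) by [].
  by apply/funext => x; rewrite -[LHS]/(g1 x + (-1) *: g2 x) scaleN1r.
have dD2 : Csder s' Omega D2 := CsderB _ _ (@Csder_cspace false _ _ _ Omega _ (f delta w)) dS.
have dD3 : Csder s' Omega D3 := CsderB _ _ dS dN.
have -> : Cnorm s' Omega (fun x => Psid u x - nno_eval sigma Omega Psi u x) =
    Cnorm s' Omega (D1 + (D2 + D3)).
  apply: (eq_Cnorm _ oOm) => x Ox.
  change ((Psid u : _ -> _) x - nno_eval sigma Omega Psi u x =
    (w x - (f delta w : Copen s' Omega _) x) + (D2 x + D3 x)).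
  rewrite /D2 /D3 addrA subrKA subrKA /w /= /restr_fun asboolT//.
apply: le_trans (CnormD oOm dD1 (Csder_D oOm dD2 dD3)) _.
rewrite (_ : e4 + e4 + e4 = e4 + (e4 + e4)); last by rewrite addrA.
rewrite EFinD; apply: leeD.
  have -> : Cnorm s' Omega D1 = `|f delta w - w|%:E.
    by rewrite distrC; apply/esym; exact: cspace_normE.
  apply: (le_trans _ (ltW Hdelta)).
  exact: (esup_ub (fun w => `|f delta w - w|%:E) Kw).
apply: le_trans (CnormD oOm dD2 dD3) _.
rewrite EFinD; apply: leeD.
  apply: (le_trans _ (ltW HJ)).
  exact: (esup_ub (fun w => Cnorm s' Omega (fun x => (f delta w : Copen s' Omega _) x -
      \sum_(j < J) xi j x *: inner_L2 B (fB delta w) (xi j))%R) Kw).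
have ee0 : 0 <= e + e by rewrite addr_ge0// ltW.
have sD3 i : smooth Omega s' (fun x => D3 x 0 i).
  have := smoothB oOm (sSum u i Ku) (sN u i Ku).
  by apply: smooth_eq => // x _; rewrite !mxE.
apply: le_trans (Cnorm_vec_le oOm sD3 ee0 _) _.
  by move=> i; apply: (bnd_eq oOm (@subset_refl _ _) _ (bSN u i Ku)) => x _; rewrite !mxE.
rewrite lee_fin -/Nn -mulr2n -mulr_natl mulrA [Nn * _]mulrC.
have eE : e * (2 * Nn + 1) = e4 by rewrite /e divfK// gt_eqF.
rewrite -[leRHS]eE mulrDr mulr1 [leLHS]mulrC lerDl.
exact: ltW.
Qed.
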